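(* Let $\alpha\in(0,1)$, $s\in(0,1)$, $H\in(0,1)$, $T>0$, and let $\epsilon>0$ be arbitrarily small. Let $u$ be the mild solution of $$\partial_t u+{}_0\partial_t^{1-\alpha}A^{s}u=f(u)+\dot W_Q^{H}\ \text{ in } D,\ t\in(0,T],\qquad u(\cdot,0)=0 \text{ in } D,\qquad u=0\text{ on }\partial D,\ t\in(0,T],$$ and suppose $\|A^{-\rho}Q^{1/2}\|_{\mathcal{L}_2}<\infty$ for some $\rho\in\left[0,\min\left(\frac{sH}{\alpha},s+\epsilon\right)\right)$. Then for every $\sigma\in\left[0,\min\left(s-\rho,\frac{sH}{\alpha}-\rho-\epsilon\right)\right]$ there is a constant $C>0$, independent of $t$, such that $$\mathbb{E}\|A^{\sigma}u(t)\|_{\mathbb{H}}^{2}\leq C\qquad\text{for all } t\in(0,T].$$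
   Context: $D\subset\mathbb{R}^d$ ($d=1,2,3$) is a (bounded) convex polygonal domain; $\mathbb{H}=L^2(D)$ with inner product $(\cdot,\cdot)$. $A=-\Delta$ with zero Dirichlet boundary condition, with non-decreasing eigenvalues $\{\lambda_k\}_{k\ge1}$ and $L^2$-normalized eigenfunctions $\{\phi_k\}_{k\ge1}$; for real $q$, $A^{q}u=\sum_{k}\lambda_k^{q}(u,\phi_k)\phi_k$. The nonlinearity $f:\mathbb{H}\to\mathbb{H}$ satisfies, for some constant $C>0$ and all $u,v\in\mathbb{H}$, $\|f(u)\|_{\mathbb{H}}\le C(1+\|u\|_{\mathbb{H}})$ and $\|f(u)-f(v)\|_{\mathbb{H}}\le C\|u-v\|_{\mathbb{H}}$. ${}_0\partial_t^{1-\alpha}u=\frac{1}{\Gamma(\alpha)}\frac{\partial}{\partial t}\int_0^t(t-\xi)^{\alpha-1}u(\xi)d\xi$ is the Riemann-Liouville derivative. $Q$ is a self-adjoint non-negative linear operator with $Q\phi_k=\Lambda_k\phi_k$, and $W_Q^{H}=\sum_{k}\sqrt{\Lambda_k}\,\phi_kW_k^{H}$, where $W_k^{H}$ are one-dimensional fractional Brownian motions with Hurst index $H$ on a complete filtered probability space. $\|\cdot\|_{\mathcal{L}_2}$ is the Hilbert-Schmidt norm on $\mathbb{H}$, so $\|A^{-\rho}Q^{1/2}\|_{\mathcal{L}_2}^2=\sum_k\lambda_k^{-2\rho}\Lambda_k$. For $\pi/2<\theta<\pi$, $\kappa>0$, $\Gamma_{\theta,\kappa}=\{re^{-\mathbf{i}\theta}:r\ge\kappa\}\cup\{\kappa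 e^{\mathbf{i}\psi}:|\psi|\le\theta\}\cup\{re^{\mathbf{i}\theta}:r\ge\kappa\}$, oriented with increasing imaginary part. Put $\mathcal{R}(t)=\frac{1}{2\pi\mathbf{i}}\int_{\Gamma_{\theta,\kappa}}e^{zt}z^{\alpha-1}(z^\alpha+A^s)^{-1}dz$ and $E_k(t)=\frac{1}{2\pi\mathbf{i}}\int_{\Gamma_{\theta,\kappa}}e^{zt}z^{\alpha-1}(z^\alpha+\lambda_k^s)^{-1}dz$, so $\mathcal{R}(t)v=\sum_kE_k(t)(v,\phi_k)\phi_k$. The mild solution is the $\mathbb{H}$-valued process $u$ satisfying (with all integrals well defined) $$u(t)=\int_0^t\mathcal{R}(t-r)f(u(r))dr+\sum_{k=1}^\infty\int_0^t\sqrt{\Lambda_k}E_k(t-r)\phi_k\,dW_k^{H}(r),$$ where integrals of deterministic functions against $W_k^H$ are Wiener integrals. *)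

(* Defs.v *)
From HB Require Import structures.
From mathcomp Require Import all_boot all_order all_algebra.
From mathcomp Require Import all_classical all_reals all_analysis measurable_realfun.
From mathcomp.real_closed Require Import complex.
Set Implicit Arguments. Unset Strict Implicit. Unset Printing Implicit Defensive.
Import Order.TTheory GRing.Theory Num.Theory.
Import numFieldNormedType.Exports.
Local Open Scope classical_set_scope.
Local Open Scope ring_scope.

(* The type 'rV[R]_d with the sup-norm topology of the library models R^d; its
   sigma-algebra, generated by the coordinates, is the Borel one. *)
Definition rV_display : measure_display. Proof. exact: default_measure_display. Qed.

Section rV_measurable.
Context (R : realType) (d : nat).

Definition rV_cylinder : set (set 'rV[R]_d) :=
  [set A | exists (i : 'I_d) (B : set (measurableTypeR R)),
    measurable B /\ A = (fun x : 'rV[R]_d => x 0 i) @^-1` B].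

HB.instance Definition _ := @isMeasurable.Build rV_display 'rV[R]_d <<s rV_cylinder >>
  (@sigma_algebra0 _ _ _) (@sigma_algebraC _ _) (@sigma_algebra_bigcup _ _ _).

Lemma measurable_rV_coord (i : 'I_d) :
  measurable_fun [set: 'rV[R]_d] (fun x : 'rV[R]_d => x 0 i).
Proof.
by move=> _ B mB; rewrite setTI; apply: sub_sigma_algebra; exists i, B.
Qed.

Lemma measurable_fun_rV d0 (T : measurableType d0) (f : T -> 'rV[R]_d) :
  (forall i, measurable_fun [set: T] (fun x => f x 0 i)) -> measurable_fun [set: T] f.
Proof.
move=> mf; apply: (measurability rV_cylinder) => // _ [_ [i [B [mB ->]]] <-].
exact: mf.
Qed.
End rV_measurable.

Section lebesgue_rV.
Context (R : realType).

Definition rV_cons n (z : measurableTypeR R * 'rV[R]_n) : 'rV[R]_n.+1 :=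
  \row_i (if unlift ord0 i is Some j then z.2 0 j else z.1).

Definition rV_uncons n (x : 'rV[R]_n.+1) : measurableTypeR R * 'rV[R]_n :=
  (x 0 ord0, \row_(j < n) x 0 (lift ord0 j)).

Lemma rV_consK n : cancel (@rV_cons n) (@rV_uncons n).
Proof.
move=> [a v]; rewrite /rV_uncons /rV_cons mxE unlift_none; congr (_, _).
by apply/rowP => j; rewrite !mxE liftK.
Qed.

Lemma measurable_rV_cons n : measurable_fun setT (@rV_cons n).
Proof.
apply: measurable_fun_rV => i; have [j ->|->] := unliftP ord0 i.
- rewrite (_ : (fun _ => _) = (fun x : 'rV[R]_n => x 0 j) \o snd).
    by apply: measurableT_comp => //; exact: measurable_rV_coord.
  by apply/funext => -[a v]; rewrite mxE liftK.
- rewrite (_ : (fun _ => _) = fst); first exact: measurable_fst.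
  by apply/funext => -[a v]; rewrite mxE unlift_none.
Qed.

Lemma measurable_rV_uncons n : measurable_fun setT (@rV_uncons n).
Proof.
apply/measurable_fun_pairP; split => /=; first exact: measurable_rV_coord.
apply: measurable_fun_rV => i /=.
rewrite (_ : (fun _ => _) = (fun x : 'rV[R]_n.+1 => x 0 (lift ord0 i))).
  exact: measurable_rV_coord.
by apply/funext => x /=; rewrite mxE.
Qed.

Section step.
Context (n : nat) (m : {sigma_finite_measure set 'rV[R]_n -> \bar R}).

Definition rV_cons_measure : set 'rV[R]_n.+1 -> \bar R :=
  pushforward (@lebesgue_measure R \x m)%E (@rV_cons n).

Let rV_cons_measure0 : rV_cons_measure set0 = 0%E.
Proof. by rewrite /rV_cons_measure /pushforward preimage_set0 measure0. Qed.

Let rV_cons_measure_ge0 A : (0 <= rV_cons_measure A)%E.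
Proof. by rewrite /rV_cons_measure /pushforward measure_ge0. Qed.

Let rV_cons_measure_sigma_additive : semi_sigma_additive rV_cons_measure.
Proof.
move=> F mF tF mUF; rewrite /rV_cons_measure /pushforward preimage_bigcup.
have mpre A : measurable A -> measurable (@rV_cons n @^-1` A).
  by move=> mA; rewrite -[X in measurable X]setTI; exact: measurable_rV_cons.
apply: measure_semi_sigma_additive => [k||]; first exact: mpre.
- apply/trivIsetP => /= i j _ _ ij; rewrite -preimage_setI.
  by move/trivIsetP : tF => /(_ _ _ _ _ ij) ->//; rewrite preimage_set0.
- by rewrite -preimage_bigcup; exact: mpre.
Qed.

HB.instance Definition _ := isMeasure.Build _ _ _ rV_cons_measure
  rV_cons_measure0 rV_cons_measure_ge0 rV_cons_measure_sigma_additive.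

Let rV_cons_measure_sigma_finite : sigma_finite setT rV_cons_measure.
Proof.
have /sigma_finiteP[F [TF ndF Foo]] := sigma_finiteT (@lebesgue_measure R).
have /sigma_finiteP[G [TG ndG Goo]] := sigma_finiteT m.
exists (fun k => @rV_uncons n @^-1` (F k `*` G k)).
  rewrite -preimage_bigcup (_ : \bigcup_k (F k `*` G k) = setT)//.
  rewrite -setXTT TF TG predeqE => -[x y]; split.
    by move=> [k _ []/= ? ?]; split; exists k.
  move=> [/= [k _ Fkx] [l _ Gly]]; exists (maxn k l) => //; split.
  - by move: x Fkx; exact/subsetPset/ndF/leq_maxl.
  - by move: y Gly; exact/subsetPset/ndG/leq_maxr.
move=> k; have [mF Fk] := Foo k; have [mG Gk] := Goo k; split.
  rewrite -[X in measurable X]setTI; apply: measurable_rV_uncons => //.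
  exact: measurableX.
rewrite /rV_cons_measure /pushforward -comp_preimage.
rewrite (_ : _ \o _ = id); last by apply/funext => x /=; rewrite rV_consK.
by rewrite preimage_id product_measure1E// lte_mul_pinfty// ge0_fin_numE.
Qed.

HB.instance Definition _ := Measure_isSigmaFinite.Build _ _ _ rV_cons_measure
  rV_cons_measure_sigma_finite.
End step.

(* Lebesgue measure on R^n as an iterated product, R^n.+1 = R * R^n. *)
Fixpoint lebesgue_rV n : {sigma_finite_measure set 'rV[R]_n -> \bar R} :=
  if n is n'.+1 then rV_cons_measure (lebesgue_rV n') else \d_(0 : 'rV[R]_0).
End lebesgue_rV.

(* An open set cut out by finitely many half-spaces, hence convex; for d = 1 it
   is an interval. *)
Record convex_polygonal_domain (R : realType) (d : nat) := ConvexPolygonalDomain {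
  domain_set :> set 'rV[R]_d ;
  domain_halfspaces : exists m (a : 'I_m -> 'rV[R]_d) (b : 'I_m -> R),
    domain_set = [set x | forall i, \sum_(j < d) a i 0 j * x 0 j < b i] ;
  domain_nonempty : domain_set !=set0 ;
  domain_bounded : exists M : R, forall x j, domain_set x -> `|x 0 j| <= M }.

Lemma measurable_domain (R : realType) (d : nat) (D : convex_polygonal_domain R d) :
  measurable (D : set 'rV[R]_d).
Proof.
have [m [a [b DE]]] := domain_halfspaces D.
pose h i (x : 'rV[R]_d) := \sum_(j < d) a i 0 j * x 0 j.
have -> : (D : set 'rV[R]_d) =
    \bigcap_(i in [set: 'I_m]) (h i @^-1` `]-oo, b i[%classic).
  rewrite DE; apply/seteqP; split => x /= hx i; first by move=> _; rewrite /= in_itv/=; exact: hx.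
  by have := hx i I; rewrite /= in_itv/=.
apply: fin_bigcap_measurable => // i _; rewrite -[X in measurable X]setTI.
suff mh : measurable_fun setT (h i) by exact: mh.
apply: measurable_sum => j; apply: measurable_funM => //.
exact: measurable_rV_coord.
Qed.

Section L2.
Context (R : realType) (d : nat) (D : convex_polygonal_domain R d).

Definition dom_measure : {measure set 'rV[R]_d -> \bar R} :=
  mrestr (lebesgue_rV R d) (measurable_domain D).

(* Representatives of L^2(D): equality in L^2(D) of g and h is hnorm (g - h) = 0. *)
Definition L2 := LfunType dom_measure (lee1n 2).

Definition inner (g h : L2) : R := \int[dom_measure]_x (g x * h x).

Definition hnorm (g : L2) : R := fine ('N[dom_measure]_2%:R%:E[EFin \o g])%E.

Definition hcvg (S : nat -> L2) (w : L2) : Prop :=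
  (fun n => hnorm (S n - w)) @ \oo --> (0 : R).

Definition partial (i : 'I_d) (v : 'rV[R]_d -> R) : 'rV[R]_d -> R :=
  fun x => 'D_(delta_mx 0 i) v x.

Definition iter_partial (s : seq 'I_d) (v : 'rV[R]_d -> R) : 'rV[R]_d -> R :=
  foldr partial v s.

Definition test_function (v : 'rV[R]_d -> R) : Prop :=
  (forall s, continuous (iter_partial s v) /\
     forall i x, derivable (iter_partial s v) x (delta_mx 0 i)) /\
  (exists K, [/\ compact K, K `<=` D & forall x, ~ K x -> v x = 0]).

(* phi is in H^1_0(D), the closure of C_c^oo(D) in H^1(D), and G is its weak
   gradient. *)
Definition H10 (phi : L2) (G : 'I_d -> L2) : Prop :=
  exists v : nat -> 'rV[R]_d -> R,
    [/\ forall n, test_function (v n),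
        (fun n => 'N[dom_measure]_2%:R%:E[EFin \o (v n \- phi)%R]%E) @ \oo --> 0%E &
        forall i, (fun n => 'N[dom_measure]_2%:R%:E[EFin \o (partial i (v n) \- G i)%R]%E)
          @ \oo --> 0%E].

(* Weak form of - Delta phi = lam phi in D, phi = 0 on the boundary of D. *)
Definition dirichlet_eigen (lam : R) (phi : L2) : Prop :=
  exists2 G, H10 phi G &
    forall v, test_function v ->
      \sum_(i < d) \int[dom_measure]_x (G i x * partial i v x) =
      lam * \int[dom_measure]_x (phi x * v x).

Record dirichlet_eigensystem (lam : nat -> R) (phi : nat -> L2) : Prop := {
  eigen_eq : forall k, dirichlet_eigen (lam k) (phi k) ;
  eigen_gt0 : forall k, 0 < lam k ;
  eigen_le : {homo lam : m n / (m <= n)%N >-> m <= n} ;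
  eigen_orthonormal : forall j k, inner (phi j) (phi k) = (j == k)%:R ;
  eigen_complete : forall g, (forall k, inner g (phi k) = 0) -> hnorm g = 0 }.

Section diagonal_operators.
Context (phi : nat -> L2).
Implicit Types (m : nat -> R) (u : L2).

Definition diag_sum m u (n : nat) : L2 :=
  \sum_(k < n) (m k * inner u (phi k)) *: phi k.

Definition diag_dom m u : Prop := exists w, hcvg (diag_sum m u) w.

(* The operator u |-> \sum_k m_k (u, phi_k) phi_k; the value is the junk 0 off
   the domain. *)
Definition diag_op m u : L2 := xget 0 [set w | hcvg (diag_sum m u) w].

Definition hs_norm2 (B : L2 -> L2) : \bar R :=
  (\sum_(k <oo) ((hnorm (B (phi k))) ^+ 2)%:E)%E.

End diagonal_operators.

Definition Apow_dom (lam : nat -> R) (phi : nat -> L2) (q : R) : L2 -> Prop :=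
  diag_dom phi (fun k => lam k `^ q).

Definition Apow (lam : nat -> R) (phi : nat -> L2) (q : R) : L2 -> L2 :=
  diag_op phi (fun k => lam k `^ q).

(* L^2(D) being separable, its Borel sets are generated by the open balls. *)
Definition hmeasurable d0 (T : measurableType d0) (A : set T) (X : T -> L2) : Prop :=
  forall (v : L2) (r : R), measurable (A `&` [set x | hnorm (X x - v) < r]).

(* w is the Bochner integral of g over J (of finite Lebesgue measure): the limit
   of the integrals of simple functions converging to g in L^1(J; L^2(D)). *)
Definition bochner_integral (J : set R) (g : R -> L2) (w : L2) : Prop :=
  hmeasurable J g /\
  exists (N : nat -> nat) (B : nat -> nat -> set R) (c : nat -> nat -> L2),
    [/\ forall n i, measurable (B n i),
        (fun n => \int[lebesgue_measure]_(x in J)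
           (hnorm (g x - \sum_(i < N n) \1_(B n i) x *: c n i))%:E)%E @ \oo --> 0%E &
        hcvg (fun n => \sum_(i < N n)
           fine (lebesgue_measure (J `&` B n i)) *: c n i) w].

End L2.

Section contour.
Context (R : realType).
Local Open Scope complex_scope.
Implicit Types (z : R[i]) (a r t psi theta kappa : R).

Definition cexp z : R[i] := (expR (complex.Re z))%:C * (cos (complex.Im z) +i* sin (complex.Im z)).

(* Principal argument, in ]-pi, pi]. *)
Definition carg z : R :=
  let x := acos (complex.Re z / Normc.normc z) in
  if 0 <= complex.Im z then x else - x.

(* Principal branch of z^a. *)
Definition cpow z a : R[i] :=
  if z == 0 then 0 else cexp (a%:C * (ln (Normc.normc z) +i* carg z)).

Definition cint (J : set R) (F : R -> R[i]) : R[i] :=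
  (\int[lebesgue_measure]_(r in J) complex.Re (F r)) +i*
  (\int[lebesgue_measure]_(r in J) complex.Im (F r)).

(* Integral along Gamma_{theta,kappa}: the lower ray (run inwards), the arc, the
   upper ray. *)
Definition contour_integral theta kappa (F : R[i] -> R[i]) : R[i] :=
  let e psi := cexp (psi *i) in
  - cint `[kappa, +oo[ (fun r => F (r%:C * e (- theta)) * e (- theta))
  + cint `[- theta, theta] (fun psi => F (kappa%:C * e psi) * ((0 +i* 1) * kappa%:C * e psi))
  + cint `[kappa, +oo[ (fun r => F (r%:C * e theta) * e theta).

(* E_k(t) for mu = lambda_k^s; the contour being symmetric with respect to the
   real axis, the value is real for t > 0. *)
Definition Ekernel (alpha theta kappa mu t : R) : R :=
  complex.Re ((2%:R * pi%:C * (0 +i* 1))^-1 * contour_integral theta kappa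
    (fun z => cexp (t%:C * z) * cpow z (alpha - 1) / (cpow z alpha + mu%:C))).

End contour.

Section fractional_noise.
Context (R : realType) (dO : measure_display) (Om : measurableType dO)
  (P : probability Om R).
Implicit Types (Hu t : R) (W : R -> {RV P >-> R}).

(* A filtration (F t)_{t >= 0} whose F 0 contains the P-null sets. *)
Record complete_filtration (F : R -> set (set Om)) : Prop := {
  filtration_sigma : forall t, 0 <= t -> sigma_algebra setT (F t) ;
  filtration_sub : forall t, 0 <= t -> F t `<=` measurable ;
  filtration_mono : forall r t, 0 <= r -> r <= t -> F r `<=` F t ;
  filtration_complete : forall N, P.-negligible N -> F 0 N }.

Definition adapted (F : R -> set (set Om)) W : Prop :=
  forall t (B : set R), 0 <= t -> measurable B -> F t (W t @^-1` B).

(* Law of a centered Gaussian variable, possibly degenerate. *)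
Definition centered_gaussian (X : Om -> R) : Prop :=
  exists s : R, 0 <= s /\ forall B : set R, measurable B ->
    P (X @^-1` B) = if s == 0 then \d_(0 : R) B else normal_prob 0 s B.

Record fBm Hu W : Prop := {
  fBm_gaussian : forall n (a r : 'I_n -> R), (forall i, 0 <= r i) ->
    centered_gaussian (fun w => \sum_(i < n) a i * W (r i) w) ;
  fBm_cov : forall r t, 0 <= r -> 0 <= t ->
    'E_P[(fun w => W r w * W t w)%R]%E =
    ((r `^ (2 * Hu) + t `^ (2 * Hu) - `|r - t| `^ (2 * Hu)) / 2)%:E }.

(* The list of the (a, (p, q)) stands for the step function \sum a 1_{]p, q]}. *)
Definition step_in t (s : seq (R * (R * R))) : bool :=
  all (fun e => [&& 0 <= e.2.1, e.2.1 <= e.2.2 & e.2.2 <= t]) s.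

Definition step_fun (s : seq (R * (R * R))) (x : R) : R :=
  \sum_(e <- s) e.1 * \1_(`]e.2.1, e.2.2]%classic) x.

Definition step_integral W (s : seq (R * (R * R))) (w : Om) : R :=
  \sum_(e <- s) e.1 * (W e.2.2 w - W e.2.1 w).

(* Squared norm completing the step functions to the integrands of the Wiener
   integral. For Hu <= 1/2 it equals E|int g dW|^2 on step functions; for
   Hu > 1/2 the absolute values give the norm of the usual space |H|, which
   dominates E|int g dW|^2. *)
Definition fBm_norm2 Hu (g : R -> R) : \bar R :=
  let mu := @lebesgue_measure R in
  if Hu < 1 / 2 then
    ((Hu * (1 - 2 * Hu) / 2)%:E * \int[mu \x mu]_z
      ((g z.1 - g z.2) ^+ 2 * `|z.1 - z.2| `^ (2 * Hu - 2))%:E)%E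
  else if Hu == 1 / 2 then (\int[mu]_x (g x ^+ 2)%:E)%E
  else ((Hu * (2 * Hu - 1))%:E * \int[mu \x mu]_z
      (`|g z.1| * `|g z.2| * `|z.1 - z.2| `^ (2 * Hu - 2))%:E)%E.

(* X is the Wiener integral of g against W over [0, t]. *)
Definition wiener_integral Hu W t (g : R -> R) (X : {RV P >-> R}) : Prop :=
  measurable_fun `[0, t] g /\
  exists s : nat -> seq (R * (R * R)),
    [/\ forall n, step_in t (s n),
        (fun n => fBm_norm2 Hu (fun x => g x * \1_(`[0, t]%classic) x - step_fun (s n) x))
          @ \oo --> 0%E &
        (fun n => 'E_P[(fun w => (X w - step_integral W (s n) w) ^+ 2)%R]%E) @ \oo --> 0%E].

End fractional_noise.

Section mild.
Context (R : realType) (d : nat) (D : convex_polygonal_domain R d).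
Context (dO : measure_display) (Om : measurableType dO) (P : probability Om R).
Context (alpha s theta kappa Hu T : R).
Context (lam : nat -> R) (phi : nat -> L2 D) (Lam : nat -> R).
Context (W : nat -> R -> {RV P >-> R}) (f : L2 D -> L2 D).

Definition Ek (k : nat) (t : R) : R := Ekernel alpha theta kappa (lam k `^ s) t.

Definition Rsol (t : R) : L2 D -> L2 D := diag_op phi (fun k => Ek k t).

(* The series converges in mean square in L^2(D). *)
Definition stochastic_convolution (t : R) (Z : Om -> L2 D) : Prop :=
  hmeasurable setT Z /\
  exists X : nat -> {RV P >-> R},
    (forall k, wiener_integral Hu (W k) t (fun r => Num.sqrt (Lam k) * Ek k (t - r)) (X k)) /\
    (fun n => 'E_P[(fun w => (hnorm (Z w - \sum_(k < n) X k w *: phi k)) ^+ 2)%R]%E)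
      @ \oo --> 0%E.

Record mild_solution (u : R -> Om -> L2 D) : Prop := {
  mild_measurable :
    hmeasurable (`[0, T] `*` [set: Om]) (fun z : measurableTypeR R * Om => u z.1 z.2) ;
  mild_integrable : {ae P, forall w,
    (\int[lebesgue_measure]_(r in `[0%R, T]) (hnorm (f (u r w)))%:E < +oo)%E} ;
  mild_eq : forall t, 0 <= t <= T ->
    exists2 Z, stochastic_convolution t Z &
      {ae P, forall w, exists2 v,
        bochner_integral `]0, t[ (fun r => Rsol (t - r) (f (u r w))) v &
        hnorm (u t w - (v + Z w)) = 0} }.

End mild.

(* Main.v *)
(** On the contour z = r e^(i psi) the integrand of E_k is e^(zt) q dz / z with
   q = z^alpha / (z^alpha + mu), mu = lam_k^s, and sectoriality gives
   |q| <= C r^alpha / (r^alpha + mu) <= C (r^alpha / mu)^b for 0 <= b <= 1. With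
   b = beta / s this yields, for 0 <= beta <= s, alpha beta / s <= a, 0 < a < 1 and
   0 < y < x <= T,
     lam_k^beta |E_k(t)| <= C t^(-a),
     lam_k^beta |E_k(x) - E_k(y)| <= C y^(-a) (x - y) / y,
   and no deformation of the contour is needed. If a < H, these two bounds make the
   fractional norm of E_k(t - .) on [0, t] at most C lam_k^(-beta), so that the k-th
   coefficient of A^sigma applied to the stochastic convolution has second moment at
   most C lam_k^(2 sigma - 2 beta) Lam_k; for beta = sigma + rho this is summable.
   The drift contributes at most C int_0^t (t - r)^(-a) |f(u(r))| dr to
   |A^sigma u(t)|, and by Cauchy-Schwarz it remains to bound E|f(u(t))|^2 uniformly
   in t. Since the E_k are bounded uniformly in k, |f(u(t))| is at most
   C (1 + |Z(t)|) + C int_0^t |f(u)|, Z being the stochastic convolution, and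
   Gronwall's inequality applies. *)

Require Import Defs.
From HB Require Import structures.
From mathcomp Require Import all_boot all_order all_algebra.
From mathcomp Require Import all_classical all_reals all_analysis measurable_realfun.
From mathcomp.real_closed Require Import complex.
From mathcomp Require Import ring lra.
Set Implicit Arguments. Unset Strict Implicit. Unset Printing Implicit Defensive.
Import Order.TTheory GRing.Theory Num.Theory.
Import numFieldNormedType.Exports.
Local Open Scope classical_set_scope.
Local Open Scope ring_scope.

(** * The Hilbert space L^2(D) *)

(** A Wiener integral is given here only through step functions converging to the integrand in
    [fBm_norm2], so the size of the integrand has to be carried over to the second moment by an
    inequality for step functions. For H > 1/2 this norm has absolute values inside, and a triangle
    inequality for it would rest on the positive definiteness of |x - y|^(2 H - 2). Boundedness of
    the integrand replaces that fact, at the cost of an error term that disappears in the limit; the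
    bound itself leaves no trace in the estimate of the noise. The exponent a must satisfy a > 0 and
    alpha beta / s <= a < H; with beta = sigma + rho, the epsilon subtracted in the range of sigma
    makes this possible. The drift is known only as a limit of integrals of simple functions. It is
    reached through scalar products with finite combinations of the [phi k], and a suitable
    combination turns these scalar estimates into one for the sum of the squared coefficients.
    Elements of [L2] are representatives, so vectors are compared through [hnorm] or their
    coefficients, not by equality. *)

Section L2_inner.
Context (R : realType) (d : nat) (D : convex_polygonal_domain R d).
Implicit Types (g h k : L2 D) (c : R).

Let mu := dom_measure D.

Lemma L2_integrableM g h : mu.-integrable setT (EFin \o (fun x => g x * h x)).
Proof.
have : (g : _ -> R) \* (h : _ -> R) \in Lfun mu 1.
  by apply: Lfun2_mul_Lfun1; exact: LfunP.
move=> /andP[/[!inE]/= mgh fgh]; apply/integrableP; split; first exact/measurable_EFinP.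
by move: fgh; rewrite /finite_norm Lnorm1.
Qed.

Lemma hnorm_ge0 g : 0 <= hnorm g.
Proof. by rewrite fine_ge0// Lnorm_ge0. Qed.

Lemma hnorm_sqE g : ((hnorm g ^+ 2)%:E = \int[mu]_x (g x ^+ 2)%:E)%E.
Proof.
have -> : ((hnorm g ^+ 2)%:E = (hnorm g)%:E `^ 2)%E.
  by rewrite poweR_EFin powR_mulrn ?hnorm_ge0.
rewrite /hnorm finite_norm_fine powR_Lnorm//.
by apply: eq_integral => x _; rewrite /= powR_mulrn// real_normK// num_real.
Qed.

Lemma hnorm_sq g : hnorm g ^+ 2 = inner g g.
Proof.
by apply/EFin_inj; rewrite hnorm_sqE /inner /Rintegral fineK//; exact: integrable_fin_num (L2_integrableM g g).
Qed.

Lemma innerC g h : inner g h = inner h g.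
Proof. by apply: eq_Rintegral => x _; rewrite mulrC. Qed.

Lemma innerDl g h k : inner (g + h) k = inner g k + inner h k.
Proof.
rewrite /inner -RintegralD//; [|exact: L2_integrableM..].
by apply: eq_Rintegral => x _; rewrite -mulrDl.
Qed.

Lemma innerZl c g h : inner (c *: g) h = c * inner g h.
Proof.
rewrite /inner -RintegralZl//; last exact: L2_integrableM.
by apply: eq_Rintegral => x _; rewrite mulrA.
Qed.

Lemma innerZr c g h : inner h (c *: g) = c * inner h g.
Proof. by rewrite innerC innerZl (innerC h). Qed.

Lemma inner0l g : inner 0 g = 0.
Proof. by rewrite -(scale0r g) innerZl mul0r. Qed.

Lemma innerNl g h : inner (- g) h = - inner g h.
Proof. by rewrite -scaleN1r innerZl mulN1r. Qed.

Lemma innerBl g h k : inner (g - h) k = inner g k - inner h k.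
Proof. by rewrite innerDl innerNl. Qed.

Lemma innerBr g h k : inner k (g - h) = inner k g - inner k h.
Proof. by rewrite innerC innerBl !(innerC k). Qed.

Lemma inner_suml (I : Type) (r : seq I) (Q : pred I) (G : I -> L2 D) h :
  inner (\sum_(i <- r | Q i) G i) h = \sum_(i <- r | Q i) inner (G i) h.
Proof.
apply: (big_morph (fun g => inner g h)) => [g k|]; [exact: innerDl|exact: inner0l].
Qed.

Lemma inner_sumr (I : Type) (r : seq I) (Q : pred I) (G : I -> L2 D) h :
  inner h (\sum_(i <- r | Q i) G i) = \sum_(i <- r | Q i) inner h (G i).
Proof. by rewrite innerC inner_suml; apply: eq_bigr => i _; rewrite innerC. Qed.

Lemma hnorm0 : hnorm (0 : L2 D) = 0.
Proof. by apply/eqP; rewrite -sqrf_eq0 hnorm_sq inner0l. Qed.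

Lemma hnorm_sqB g h : hnorm (g - h) ^+ 2 = hnorm g ^+ 2 - 2 * inner g h + hnorm h ^+ 2.
Proof. by rewrite !hnorm_sq innerBl !innerBr (innerC h g); ring. Qed.

Lemma hnormZ c g : hnorm (c *: g) = `|c| * hnorm g.
Proof.
apply/eqP; rewrite -(@eqrXn2 _ 2)// ?mulr_ge0 ?hnorm_ge0//.
by rewrite exprMn !hnorm_sq innerZl innerZr real_normK ?num_real// mulrA expr2.
Qed.

Lemma hnormN g : hnorm (- g) = hnorm g.
Proof. by rewrite -scaleN1r hnormZ normrN1 mul1r. Qed.

Lemma hnormB g h : hnorm (g - h) = hnorm (h - g).
Proof. by rewrite -hnormN opprB. Qed.

Lemma hnormD g h : hnorm (g + h) <= hnorm g + hnorm h.
Proof. exact: ler_LnormD. Qed.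

Lemma ler_hnormB g h : hnorm g <= hnorm h + hnorm (g - h).
Proof. by apply: le_trans (hnormD _ _); rewrite addrC subrK. Qed.

Lemma cauchy_schwarz g h : `|inner g h| <= hnorm g * hnorm h.
Proof.
suff CS : inner g h ^+ 2 <= (hnorm g * hnorm h) ^+ 2.
  by rewrite -(@ler_pXn2r _ 2) ?nnegrE ?mulr_ge0 ?hnorm_ge0// real_normK// num_real.
have H c : 0 <= hnorm g ^+ 2 - 2 * (c * inner g h) + c ^+ 2 * hnorm h ^+ 2.
  by rewrite -innerZr -[c ^+ 2]real_normK ?num_real// -exprMn -hnormZ -hnorm_sqB sqr_ge0.
rewrite exprMn; set a := inner g h in H *; set u := hnorm g ^+ 2 in H *.
have : 0 <= hnorm h ^+ 2 by exact: sqr_ge0.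
set v := hnorm h ^+ 2 in H *; rewrite le_eqVlt => /predU1P[v0|v0].
  (* [hnorm h = 0] does not force [h = 0]. The quadratic in c is then affine, and c = (u + 1) / (2
     a) would give it the value -1. *)
  rewrite -v0 in H *; have [->|a0] := eqVneq a 0; first by rewrite expr0n/= mulr0.
  have := H ((u + 1) / (2 * a)); rewrite mulr0 addr0.
  have -> : 2 * ((u + 1) / (2 * a) * a) = u + 1 by field.
  lra.
have := H (a / v).
have -> : u - 2 * (a / v * a) + (a / v) ^+ 2 * v = (u * v - a ^+ 2) / v by field; lra.
by rewrite pmulr_lge0 ?invr_gt0// subr_ge0.
Qed.

Lemma ler_inner g h : inner g h <= hnorm g * hnorm h.
Proof. exact: le_trans (ler_norm _) (cauchy_schwarz g h). Qed.

Lemma hnorm_eq0_inner g h : hnorm g = 0 -> inner g h = 0.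
Proof.
move=> g0; apply/eqP; rewrite -normr_le0.
by have := cauchy_schwarz g h; rewrite g0 mul0r.
Qed.

Lemma hcvg_inner (S : nat -> L2 D) g h : hcvg S g -> (fun n => inner (S n) h) @ \oo --> inner g h.
Proof.
move=> Sg; apply/cvgrPdist_le => e e0.
have e1 : 0 < e / (hnorm h + 1) by rewrite divr_gt0// ltr_wpDl ?hnorm_ge0.
move/cvgrPdist_le : Sg => /(_ _ e1); apply: filterS => n.
rewrite sub0r normrN ger0_norm ?hnorm_ge0// => Sn.
rewrite -innerBl (le_trans (cauchy_schwarz _ _))// hnormB.
rewrite ler_pdivlMr ?ltr_wpDl ?hnorm_ge0// in Sn.
by apply: le_trans Sn; rewrite ler_wpM2l ?hnorm_ge0// lerDl.
Qed.

Lemma hcvg_hnorm (S : nat -> L2 D) g : hcvg S g -> (fun n => hnorm (S n)) @ \oo --> hnorm g.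
Proof.
move=> Sg; apply/cvgrPdist_le => e e0.
move/cvgrPdist_le : Sg => /(_ _ e0); apply: filterS => n.
rewrite sub0r normrN ger0_norm ?hnorm_ge0//; apply: le_trans.
have := ler_hnormB (S n) g; have := ler_hnormB g (S n); rewrite (hnormB g) ler_norml => *.
by apply/andP; split; lra.
Qed.

End L2_inner.

(** * Completeness of L^2(D) *)

Section L2_complete.
Context (R : realType) (d : nat) (D : convex_polygonal_domain R d).
Let mu := dom_measure D.

Lemma L2_mk (f : 'rV[R]_d -> R) : measurable_fun setT f ->
  (\int[mu]_x (f x ^+ 2)%:E < +oo)%E -> exists g : L2 D, (g : _ -> R) = f.
Proof.
move=> mf foo; suff fL : f \in Lfun mu 2%:E by exists (Lfun_Sub (lee1n 2) fL); exact: Lfun_valP.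
apply/andP; split; rewrite inE//=/finite_norm unlock/=.
rewrite poweR_lty//; apply: le_lt_trans foo; rewrite le_eqVlt; apply/orP; left; apply/eqP.
by apply: eq_integral => x _; rewrite /= powR_mulrn// real_normK// num_real.
Qed.

(** Each increment is at most sqrt G / 2^k, so the telescoping series is dominated by a geometric
    one. *)
Lemma fast_cauchy_cvg (u : nat -> R) (G : R) : (forall k, 4 ^+ k * (u k.+1 - u k) ^+ 2 <= G) -> cvgn u.
Proof.
move=> uG.
have G0 : 0 <= G by apply: le_trans (uG 0%N); rewrite mulr_ge0 ?sqr_ge0//.
have uE : u = (fun n => u 0%N + series (fun k => u k.+1 - u k) n).
  by apply/funext => n; rewrite /series/= telescope_sumr// addrC subrK.
rewrite uE; apply: is_cvgD; first exact: is_cvg_cst.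
apply: normed_cvg; apply: (@series_le_cvg _ _ (fun k => Num.sqrt G * (2^-1) ^+ k)).
- by move=> n /=.
- by move=> n; rewrite mulr_ge0 ?sqrtr_ge0 ?exprn_ge0// invr_ge0.
- move=> n /=; rewrite exprVn ler_pdivlMr ?exprn_gt0//.
  rewrite -(@ler_pXn2r _ 2)// ?nnegrE ?mulr_ge0 ?sqrtr_ge0 ?exprn_ge0//.
  rewrite sqr_sqrtr// exprMn real_normK ?num_real// -exprM mulnC exprM mulrC.
  by rewrite (_ : 2 ^+ 2 = 4)//; ring.
- apply: is_cvg_geometric_series.
  by rewrite ger0_norm ?invr_ge0// invf_lt1// ltr1n.
Qed.

Lemma limn_einf_le (u : (\bar R)^nat) c : (forall n, u n <= c)%E -> (limn_einf u <= c)%E.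
Proof.
move=> uc; rewrite limn_einf_lim; apply: lime_le; first exact: is_cvg_einfs.
apply: nearW => n; apply: le_trans (uc n).
by apply: ereal_inf_lbound; exists n => //=.
Qed.

Lemma nneseries_geometric_lty (q : R) : 0 <= q < 1 -> (\sum_(k <oo) (q ^+ k)%:E < +oo)%E.
Proof.
move=> /andP[q0 q1].
have -> : (\sum_(k <oo) (q ^+ k)%:E = limn (EFin \o series (fun k => (q ^+ k)%R)))%E.
  by congr (limn _); apply/funext => n; rewrite /= /series/= -sumEFin.
have cv : cvgn (series (fun k => q ^+ k)).
  have := @is_cvg_geometric_series R 1 q; rewrite ger0_norm// => /(_ q1).
  rewrite (_ : geometric 1 q = (fun k => q ^+ k))//.
  by apply/funext => n; rewrite /= mul1r.
by rewrite EFin_lim// ltry.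
Qed.

(** The Riesz-Fischer argument: a fast subsequence converges almost everywhere, and Fatou's lemma
    turns the pointwise limit into a limit in norm. *)
Lemma L2_complete (S : nat -> L2 D) :
  (forall e : R, 0 < e -> exists N, forall m n, (N <= m)%N -> (N <= n)%N -> hnorm (S m - S n) <= e) ->
  exists w, hcvg S w.
Proof.
move=> cS.
(* Once squared, increments of size 3^-k beat the weight 4^k required by [fast_cauchy_cvg]: the
   weighted squares have total integral at most the sum of the (4/9)^k. *)
have [N NP] := choice (fun k : nat => cS ((3 ^+ k)^-1) ltac:(by rewrite invr_gt0 exprn_gt0)).
(* The sum puts [nn k] beyond every [N j] with [j <= k]; the summand [k] makes it tend to
   infinity. *)
pose nn k := (k + \sum_(i < k.+1) N i)%N.
have leN j k : (j <= k)%N -> (N j <= nn k)%N.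
  by move=> jk; rewrite /nn (bigD1 (Ordinal (jk : (j < k.+1)%N)))//= addnCA leq_addr.
pose dd k : L2 D := S (nn k.+1) - S (nn k).
have ddle k : hnorm (dd k) ^+ 2 <= (9 ^+ k)^-1.
  have := NP k _ _ (leN k k.+1 (leqnSn k)) (leN k k (leqnn k)).
  rewrite -/(dd k) -(@ler_pXn2r _ 2)// ?nnegrE ?hnorm_ge0 ?invr_ge0 ?exprn_ge0// => /le_trans; apply.
  by rewrite exprVn -exprM mulnC exprM lef_pV2 ?posrE ?exprn_gt0// lerXn2r ?nnegrE//; lra.
pose G x := (\sum_(k <oo) (4 ^+ k * dd k x ^+ 2)%:E)%E.
have mt k : measurable_fun setT (fun x => (4 ^+ k * dd k x ^+ 2)%:E).
  by apply/measurable_EFinP; apply: measurable_funM => //; exact: measurable_funX.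
have mG : measurable_fun setT G.
  apply: (@ge0_emeasurable_sum _ _ _ setT (fun k x => (4 ^+ k * dd k x ^+ 2)%:E) xpredT) => // k x _ _.
  by rewrite lee_fin mulr_ge0 ?sqr_ge0 ?exprn_ge0//.
have G0 x : (0 <= G x)%E.
  by apply: nneseries_ge0 => k _ _; rewrite lee_fin mulr_ge0 ?sqr_ge0 ?exprn_ge0//.
have Goo : (\int[mu]_x G x < +oo)%E.
  rewrite integral_nneseries//; last by move=> k x _; rewrite lee_fin mulr_ge0 ?sqr_ge0 ?exprn_ge0//.
  apply: (@le_lt_trans _ _ (\sum_(k <oo) ((4 / 9) ^+ k)%:E)%E); last first.
    by apply: nneseries_geometric_lty; apply/andP; split; lra.
  apply: lee_nneseries => [k _ _|k _].
    by apply: integral_ge0 => x _; rewrite lee_fin mulr_ge0 ?sqr_ge0 ?exprn_ge0//.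
  under eq_integral do rewrite EFinM.
  rewrite ge0_integralZl_EFin//; last first.
  - by apply/measurable_EFinP; exact: measurable_funX.
  - by move=> x _; rewrite lee_fin sqr_ge0.
  by rewrite -hnorm_sqE -EFinM lee_fin expr_div_n ler_wpM2l ?exprn_ge0.
pose E := [set x | (G x < +oo)%E].
have mE : measurable E by rewrite -[X in measurable X]setTI; exact: emeasurable_fun_infty_o.
have aeE : {ae mu, forall x, E x}.
  have iG : mu.-integrable setT G.
    by apply/integrableP; split => //; under eq_integral do rewrite gee0_abs//.
  by apply: filterS (integrable_ae measurableT iG) => x /(_ I); rewrite ge0_fin_numE.
(* Cutting off outside [E] makes the sequence converge at every point, hence its limit
   measurable. *)
pose T k x := S (nn k) x * \1_E x.
have mT k : measurable_fun setT (T k) by apply: measurable_funM.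
have cT x : cvgn (T^~ x).
  rewrite /T indicE; case: (boolP (x \in E)) => xE; last first.
    by under eq_fun do rewrite mulr0; exact: is_cvg_cst.
  under eq_fun do rewrite mulr1.
  apply: (@fast_cauchy_cvg _ (fine (G x))) => k.
  move: xE; rewrite inE /E/= => xE.
  rewrite -lee_fin fineK ?ge0_fin_numE// /G.
  rewrite (@nneseriesD1 _ (fun k => (4 ^+ k * dd k x ^+ 2)%:E) k xpredT)//; last by move=> *; rewrite lee_fin mulr_ge0 ?sqr_ge0 ?exprn_ge0//.
  rewrite leeDl//; apply: nneseries_ge0 => *.
  by rewrite lee_fin mulr_ge0 ?sqr_ge0 ?exprn_ge0//.
pose w x := limn (T^~ x).
have mw : measurable_fun setT w.
  by apply: (@measurable_fun_cvg _ _ _ _ T) => // x _; exact: cT.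
have key e n : 0 < e -> (forall m, (n <= m)%N -> forall k, (n <= k)%N -> hnorm (S m - S k) <= e) ->
   forall m, (n <= m)%N -> (\int[mu]_x ((S m x - w x) ^+ 2)%:E <= (e ^+ 2)%:E)%E.
  move=> e0 He m nm.
  have Hj k : (n <= k)%N -> hnorm (S m - S (nn k)) <= e.
    by move=> nk; apply: He => //; rewrite (leq_trans nk)// leq_addr.
  (* The shift by [n] keeps all indices [nn (k + n)] beyond [n], where the Cauchy bound [e]
     holds. *)
  pose ff k x := ((S m x - T (k + n)%N x) ^+ 2)%:E.
  have mff k : measurable_fun setT (ff k).
    by apply/measurable_EFinP/measurable_funX; apply: measurable_funB.
  have ff0 k x : setT x -> (0 <= ff k x)%E by move=> _; rewrite lee_fin sqr_ge0.
  have := fatou mu measurableT mff ff0.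
  have -> : (\int[mu]_x limn_einf (ff^~ x) = \int[mu]_x ((S m x - w x) ^+ 2)%:E)%E.
    apply: eq_integral => x _; have -> //: limn_einf (ff^~ x) = ((S m x - w x) ^+ 2)%:E.
    apply: (cvg_limn_einf_sup _).1; apply/fine_cvgP; split; first exact: nearW.
    have : (fun k => T (k + n)%N x) @ \oo --> w x by rewrite (cvg_shiftn n (T^~ x)); exact: cT.
    move=> /(cvgB (cvg_cst (S m x))) Tc.
    by rewrite expr2; apply: (cvgM Tc Tc).
  move/le_trans; apply; apply: limn_einf_le => k.
  apply: (@le_trans _ _ (\int[mu]_x ((S m - S (nn (k + n)%N)) x ^+ 2)%:E)%E); last first.
    rewrite -hnorm_sqE lee_fin ler_pXn2r ?nnegrE ?hnorm_ge0//; last exact: ltW.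
    by apply: Hj; rewrite leq_addl.
  apply: ae_ge0_le_integral => //.
  - by move=> x _; rewrite lee_fin sqr_ge0.
  - by move=> x _; rewrite lee_fin sqr_ge0.
  - by apply/measurable_EFinP; exact: measurable_funX.
  - apply: filterS aeE => x Ex _; rewrite /ff /T indicE mem_set// mulr1.
    by rewrite le_refl.
have [N1 HN1] := cS 1 ltr01.
(* The limit [w] is not yet known to be square integrable, but [S N1 - w] is, by the Fatou estimate
   with e = 1. The candidate limit is therefore written [S N1 - g0]. *)
have [g0 g0E] : exists g : L2 D, (g : _ -> R) = (fun x => S N1 x - w x).
  apply: L2_mk; first exact: measurable_funB.
  by apply: (le_lt_trans (key 1 N1 ltr01 _ N1 (leqnn _))); [move=> *; exact: HN1|rewrite ltry].
exists (S N1 - g0); apply/cvgrPdist_le => e e0.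
have [N2 HN2] := cS e e0; exists N2 => // m N2m /=.
rewrite sub0r normrN ger0_norm ?hnorm_ge0//.
rewrite -(@ler_pXn2r _ 2) ?nnegrE ?hnorm_ge0//; last exact: ltW.
rewrite -lee_fin hnorm_sqE; apply: le_trans (key e N2 e0 _ m N2m); last by move=> *; exact: HN2.
rewrite le_eqVlt; apply/orP; left; apply/eqP; apply: eq_integral => x _.
rewrite (_ : (S m - (S N1 - g0)) x = S m x - (S N1 x - g0 x))// g0E.
by congr (_%:E); ring.
Qed.
End L2_complete.

(** * Orthonormal expansions, diagonal operators and measurability *)

Section orthonormal_basis.
Context (R : realType) (d : nat) (D : convex_polygonal_domain R d) (phi : nat -> L2 D).
Hypothesis phi_orth : forall j k, inner (phi j) (phi k) = (j == k)%:R.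
Implicit Types (c m : nat -> R) (g u : L2 D).

Definition lin_comb c n : L2 D := \sum_(i < n) c i *: phi i.

Lemma inner_lin_comb c n k : inner (lin_comb c n) (phi k) = c k * (k < n)%:R.
Proof.
rewrite inner_suml; under eq_bigr do rewrite innerZl phi_orth.
have [kn|nk] := ltnP k n.
  rewrite (bigD1 (Ordinal kn))//= eqxx big1 ?addr0// => i ik.
  rewrite (_ : (i == k :> nat) = false) ?mulr0//.
  by apply: contra_neqF ik => /eqP ik; exact/val_inj.
rewrite mulr0 big1// => i _; rewrite (_ : (i == k :> nat) = false) ?mulr0//.
by apply/negbTE; rewrite neq_ltn (leq_trans (ltn_ord i) nk).
Qed.

Lemma inner_lin_combr g c n : inner g (lin_comb c n) = \sum_(i < n) c i * inner g (phi i).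
Proof. by rewrite inner_sumr; apply: eq_bigr => i _; rewrite innerZr. Qed.

Lemma lin_combB (a b : nat -> R) n : lin_comb (fun i => a i - b i) n = lin_comb a n - lin_comb b n.
Proof. by rewrite /lin_comb -sumrB; apply: eq_bigr => i _; rewrite scalerBl. Qed.

Lemma hnorm_lin_comb c n : hnorm (lin_comb c n) ^+ 2 = \sum_(i < n) c i ^+ 2.
Proof.
rewrite hnorm_sq inner_lin_combr; apply: eq_bigr => i _.
by rewrite inner_lin_comb ltn_ord mulr1 expr2.
Qed.

Lemma hnorm_phi k : hnorm (phi k) = 1.
Proof.
apply/eqP; rewrite -(@eqrXn2 _ 2)// ?hnorm_ge0//.
by rewrite hnorm_sq phi_orth eqxx expr1n.
Qed.

Lemma bessel g n : \sum_(i < n) inner g (phi i) ^+ 2 <= hnorm g ^+ 2.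
Proof.
have := sqr_ge0 (hnorm (g - lin_comb (fun i => inner g (phi i)) n)).
rewrite hnorm_sqB hnorm_lin_comb inner_lin_combr.
under [X in _ - 2 * X + _]eq_bigr do rewrite -expr2.
lra.
Qed.

Lemma hnorm_lin_combB c n p : (n <= p)%N ->
  hnorm (lin_comb c p - lin_comb c n) ^+ 2 = \sum_(i < p) c i ^+ 2 - \sum_(i < n) c i ^+ 2.
Proof.
move=> np; rewrite hnorm_sqB !hnorm_lin_comb inner_lin_combr.
under [X in _ - 2 * X + _]eq_bigr => i _ do
  rewrite inner_lin_comb (leq_trans (ltn_ord i) np) mulr1 -expr2.
ring.
Qed.

Lemma ler_sum_sq c n p : (n <= p)%N -> \sum_(i < n) c i ^+ 2 <= \sum_(i < p) c i ^+ 2.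
Proof. by move=> np; rewrite -subr_ge0 -hnorm_lin_combB// sqr_ge0. Qed.

(** The squared distance of two partial combinations is a difference of partial sums of squares, and
    those sums, being monotone and bounded, converge. *)
Lemma riesz_fischer c (M : R) : (forall n, \sum_(i < n) c i ^+ 2 <= M) ->
  exists w, hcvg (lin_comb c) w.
Proof.
move=> cM; apply: L2_complete => e e0.
have cs : cvgn (fun n => \sum_(i < n) c i ^+ 2).
  apply: nondecreasing_is_cvgn; first by move=> n p; exact: ler_sum_sq.
  by exists M => _ [n _ <-].
have e2 : 0 < e ^+ 2 / 2 by rewrite divr_gt0// exprn_gt0.
move/cvgrPdist_le : cs => /(_ _ e2)[N _ HN]; exists N => p n Np Nn.
rewrite -(@ler_pXn2r _ 2) ?nnegrE ?hnorm_ge0//; last exact: ltW.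
wlog np : p n Np Nn / (n <= p)%N.
  by move=> H; have [/H|/ltnW/H] := leqP n p; [exact|rewrite hnormB; exact].
rewrite hnorm_lin_combB//.
have := HN _ Np; have := HN _ Nn; rewrite /= !ler_norml => /andP[a b] /andP[a' b'].
lra.
Qed.

Lemma inner_hcvg_lin c w k : hcvg (lin_comb c) w -> inner w (phi k) = c k.
Proof.
move=> /(@hcvg_inner _ _ _ _ _ (phi k)) cw; apply/esym.
apply: (@cvg_unique _ _ _ _ _ _ _ cw) => //.
apply: cvg_near_cst; exists k.+1 => // n kn.
by rewrite inner_lin_comb (kn : (k < n)%N) mulr1.
Qed.

Lemma hcvg_lin_sq c w : hcvg (lin_comb c) w ->
  (fun n => \sum_(i < n) c i ^+ 2) @ \oo --> hnorm w ^+ 2.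
Proof.
move=> /hcvg_hnorm cw.
have -> : (fun n => \sum_(i < n) c i ^+ 2) = (fun n => hnorm (lin_comb c n) * hnorm (lin_comb c n)).
  by apply/funext => n; rewrite -expr2 hnorm_lin_comb.
by rewrite expr2; exact: cvgM.
Qed.

Lemma diag_opP m u : diag_dom phi m u ->
  hcvg (lin_comb (fun k => m k * inner u (phi k))) (diag_op phi m u).
Proof. by move=> /xgetPex; exact. Qed.

Lemma inner_diag_op m u k : diag_dom phi m u ->
  inner (diag_op phi m u) (phi k) = m k * inner u (phi k).
Proof. by move/diag_opP/inner_hcvg_lin; exact. Qed.

Lemma diag_dom_le m u (M : R) : (forall n, \sum_(i < n) (m i * inner u (phi i)) ^+ 2 <= M) ->
  diag_dom phi m u.
Proof. exact: (@riesz_fischer (fun i => m i * inner u (phi i)) M). Qed.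

Lemma diag_dom_bounded m u (M : R) : (forall k, `|m k| <= M) -> diag_dom phi m u.
Proof.
move=> mM; apply: (@diag_dom_le _ _ (M ^+ 2 * hnorm u ^+ 2)) => n.
apply: le_trans (_ : M ^+ 2 * \sum_(i < n) inner u (phi i) ^+ 2 <= _); last first.
  by rewrite ler_wpM2l ?sqr_ge0 ?bessel.
rewrite mulr_sumr ler_sum// => i _; rewrite exprMn ler_wpM2r ?sqr_ge0//.
rewrite -[m i ^+ 2]real_normK ?num_real// ler_pXn2r ?nnegrE//.
by apply: le_trans (mM i).
Qed.

Hypothesis phi_complete : forall g, (forall k, inner g (phi k) = 0) -> hnorm g = 0.

(** The Riesz-Fischer limit has the same coefficients as [g]; completeness of the system makes the
    difference vanish in norm. *)
Lemma parseval g : hcvg (lin_comb (fun k => inner g (phi k))) g.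
Proof.
have [w cw] := @riesz_fischer (fun k => inner g (phi k)) _ (bessel g).
suff wg : hnorm (w - g) = 0.
  apply: (@squeeze_cvgr _ _ _ _ (cst 0) (fun n => hnorm (lin_comb (fun k => inner g (phi k)) n - w))) => //.
    apply: nearW => n; rewrite hnorm_ge0/=.
    have -> : lin_comb (fun k => inner g (phi k)) n - g
       = (lin_comb (fun k => inner g (phi k)) n - w) + (w - g) by rewrite addrA subrK.
    by rewrite (le_trans (hnormD _ _))// wg addr0.
  exact: cvg_cst.
by apply: phi_complete => k; rewrite innerBl (inner_hcvg_lin k cw) subrr.
Qed.

Lemma hnorm_sq_le g (M : R) : (forall n, \sum_(i < n) inner g (phi i) ^+ 2 <= M) ->
  hnorm g ^+ 2 <= M.
Proof.
move=> gM; have /hcvg_lin_sq cg := parseval g.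
by rewrite -(cvg_lim _ cg)//; apply: limr_le; [exact: cvgP cg|exact: nearW].
Qed.

(** Provides countably many centres for balls, since [hmeasurable] speaks of balls only. *)
Lemma lin_comb_dense g (e : R) : 0 < e ->
  exists q : seq rat, hnorm (g - lin_comb (fun i => ratr q`_i) (size q)) < e.
Proof.
move=> e0; have e2 : 0 < e / 2 by rewrite divr_gt0.
have /cvgrPdist_lt /(_ _ e2)[n _ /(_ n (leqnn n))] := parseval g.
rewrite /= sub0r normrN ger0_norm ?hnorm_ge0// => gn.
(* Dividing by [n.+1] keeps [dl] positive also when n = 0. *)
pose cc i := inner g (phi i); pose dl := e / 2 / n.+1%:R.
have dl0 : 0 < dl by rewrite divr_gt0.
have H i : exists r : rat, `|cc i - ratr r| < dl.
  have lt_i : cc i < cc i + dl by rewrite ltrDl.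
  have [r] := rat_in_itvoo lt_i; rewrite in_itv/= => /andP[r1 r2]; exists r.
  by rewrite ltr_norml; apply/andP; split; lra.
have [r rP] := choice H; exists (mkseq r n); rewrite size_mkseq.
have -> : lin_comb (fun i => ratr (mkseq r n)`_i) n = lin_comb (ratr \o r) n.
  by apply: eq_bigr => i _; rewrite nth_mkseq.
have -> : g - lin_comb (ratr \o r) n = (g - lin_comb cc n) + lin_comb (fun i => cc i - ratr (r i)) n.
  by rewrite lin_combB addrA subrK.
rewrite (le_lt_trans (hnormD _ _))// (splitr e) ltr_leD// 1?hnormB//.
apply: (@le_trans _ _ (\sum_(i < n) dl)).
  elim: (n) => [|k ih]; first by rewrite /lin_comb !big_ord0 hnorm0.
  rewrite /lin_comb !big_ord_recr/= (le_trans (hnormD _ _))// lerD// hnormZ hnorm_phi mulr1.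
  exact/ltW.
have -> : \sum_(i < n) dl = e / 2 * ((n.+1%:R)^-1 * n%:R) by rewrite sumr_const card_ord -[LHS]mulr_natr mulrA.
rewrite ler_piMr//; first exact: ltW.
by rewrite mulrC ler_pdivrMr ?mul1r ?ler_nat.
Qed.

(** A sublevel set of a Lipschitz function is open, hence a countable union of balls with rational
    centres and radii 1 / (j + 1), whose preimages are measurable by hypothesis. *)
Lemma hmeasurable_lipschitz d0 (T : measurableType d0) (A : set T) (X : T -> L2 D)
    (F : L2 D -> R) (L : R) : measurable A -> hmeasurable A X ->
  (forall u v, `|F u - F v| <= L * hnorm (u - v)) -> measurable_fun A (F \o X).
Proof.
move=> mA mX FL; apply: (measurability _ (RGenInftyO.measurableE R)) => // _ [_ [c ->] <-].
pose cen (q : seq rat) := lin_comb (fun i => ratr q`_i) (size q).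
(* Enumerates the pairs (centre, radius). Balls that leave the sublevel set, and numbers coding no
   pair, contribute the empty set. *)
pose B (k : nat) := if unpickle k is Some (q, j) then
   if `[< forall v, hnorm (v - cen q) < (j.+1%:R)^-1 -> F v < c >] then
     A `&` [set x | hnorm (X x - cen q) < (j.+1%:R)^-1] else set0 else set0.
have -> : A `&` (F \o X) @^-1` `]-oo, c[%classic = \bigcup_k B k.
  apply/seteqP; split => x.
    move=> [Ax]; rewrite /= in_itv/= => Fc.
    (* [F] stays below [c] within distance [r] of [X x]. A ball of radius less than r / 2 whose
       centre is that close to [X x] contains [X x] and lies inside. The shift by 1 covers the case
       where [L] is not positive. *)
    have L0 : 0 < `|L| + 1 by rewrite ltr_wpDl.
    have r0 : 0 < (c - F (X x)) / (`|L| + 1) by rewrite divr_gt0// subr_gt0.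
    set r := _ / _ in r0.
    have [j jr] : exists j : nat, (j.+1%:R)^-1 < r / 2.
      have r20 : 0 < r / 2 by rewrite divr_gt0.
      have [j _ /(_ j (leqnn j))] := near_infty_natSinv_lt (PosNum r20); by exists j.
    have j0 : 0 < (j.+1%:R : R)^-1 by rewrite invr_gt0.
    have [q qP] := lin_comb_dense (X x) j0.
    exists (pickle (q, j)) => //; rewrite /B pickleK; case: asboolP => // nH.
    exfalso; apply: nH => v vq.
    have vx : hnorm (v - X x) < r.
      have -> : v - X x = (v - cen q) + (cen q - X x) by rewrite addrA subrK.
      have qX : hnorm (cen q - X x) < (j.+1%:R)^-1 by rewrite hnormB.
      apply: (le_lt_trans (hnormD _ _)); apply: (lt_trans (ltrD vq qX)).
      by rewrite [ltRHS]splitr ltrD.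
    have := le_trans (ler_norm _) (FL v (X x)).
    have : L * hnorm (v - X x) <= (`|L| + 1) * hnorm (v - X x).
      by rewrite ler_wpM2r ?hnorm_ge0// (le_trans (ler_norm L))// lerDl.
    have : (`|L| + 1) * hnorm (v - X x) < c - F (X x) by rewrite mulrC -ltr_pdivlMr.
    lra.
  move=> [k _]; rewrite /B; case: unpickle => // -[q j]; case: asboolP => // H [Ax xq]; split => //=.
  by rewrite in_itv/= H.
apply: bigcup_measurable => k _; rewrite /B; case: unpickle => // -[q j]; by case: ifP => // _; exact: mX.
Qed.

End orthonormal_basis.

(** * Integrals of powers *)

Section power_integrals.
Context (R : realType).
Local Notation mu := (@lebesgue_measure R).
Implicit Types (f : R -> \bar R) (c e x p q : R).

Let shift c : measurableTypeR R -> measurableTypeR R := fun x => x + c.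
Let rev c : measurableTypeR R -> measurableTypeR R := fun x => c - x.

Let measurable_shift c : measurable_fun setT (shift c).
Proof. by apply: measurable_funD. Qed.

Let measurable_rev c : measurable_fun setT (rev c).
Proof. by apply: measurable_funB. Qed.

Lemma lebesgue_measure_shift c (A : set R) : measurable A ->
  pushforward mu (shift c) A = mu A.
Proof.
move=> mA; apply/esym/lebesgue_measure_unique => //= _ [[a b]] _ <-.
rewrite /pushforward (_ : _ @^-1` _ = `]a - c, b - c]%classic); last first.
  by apply/seteqP; split => x /=; rewrite /shift !in_itv/= ltrBlDr lerBrDr.
rewrite !lebesgue_measure_itv/= !lte_fin ltrD2r.
by case: ifP => // _; rewrite -!EFinB; congr (_%:E); ring.
Qed.

(** A reflection moves the closed end of a half-open interval to the other side, which leaves its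
    length unchanged, and lengths of intervals determine the measure. *)
Lemma lebesgue_measure_rev c (A : set R) : measurable A ->
  pushforward mu (rev c) A = mu A.
Proof.
move=> mA; apply/esym/lebesgue_measure_unique => //= _ [[a b]] _ <-.
rewrite /pushforward (_ : _ @^-1` _ = `[c - b, c - a[%classic); last first.
  by apply/seteqP; split => x /=; rewrite /rev !in_itv/=; move=> /andP[? ?]; apply/andP; split; lra.
rewrite !lebesgue_measure_itv/= !lte_fin ltrD2l ltrN2.
by case: ifP => // _; rewrite -!EFinB; congr (_%:E); ring.
Qed.

Lemma ge0_integral_shift c (A : set R) f : measurable A -> measurable_fun A f ->
  (forall x, A x -> 0 <= f x)%E ->
  (\int[mu]_(x in A) f x = \int[mu]_(x in [set x | A (x + c)%R]) f (x + c)%R)%E.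
Proof.
move=> mA mf f0; have := @ge0_integral_pushforward _ _ _ _ _ _ (measurable_shift c) mu A f mA mf.
move=> /= H; rewrite [RHS](_ : _ = (\int[mu]_(x in shift c @^-1` A) (f \o shift c) x)%E)//.
rewrite -H; last by move=> y /set_mem; exact: f0.
by apply: eq_measure_integral => B mB _; exact/esym/lebesgue_measure_shift.
Qed.

Lemma ge0_integral_rev c (A : set R) f : measurable A -> measurable_fun A f ->
  (forall x, A x -> 0 <= f x)%E ->
  (\int[mu]_(x in A) f x = \int[mu]_(x in [set x | A (c - x)%R]) f (c - x)%R)%E.
Proof.
move=> mA mf f0; have := @ge0_integral_pushforward _ _ _ _ _ _ (measurable_rev c) mu A f mA mf.
move=> /= H; rewrite [RHS](_ : _ = (\int[mu]_(x in rev c @^-1` A) (f \o rev c) x)%E)//.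
rewrite -H; last by move=> y /set_mem; exact: f0.
by apply: eq_measure_integral => B mB _; exact/esym/lebesgue_measure_rev.
Qed.

Lemma cvg_powR0 (u : nat -> R) p : 0 < p -> (forall n, 0 <= u n) -> u @ \oo --> 0 ->
  (fun n => u n `^ p) @ \oo --> (0 : R).
Proof.
move=> p0 u0 /cvgrPdist_lt cu; apply/cvgrPdist_lt => e e0.
have := cu (e `^ p^-1) (powR_gt0 _ e0); apply: filterS => n.
rewrite !sub0r !normrN !ger0_norm ?powR_ge0// => un.
have := gt0_ltr_powR p0 (u0 n) (powR_ge0 e p^-1) un.
by rewrite -powRrM mulVf ?gt_eqF// powRr1// ltW.
Qed.

Let powR_prim e x : 0 < x -> e + 1 != 0 ->
  derivable (fun y : R => y `^ (e + 1) / (e + 1)) x 1 /\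
  ((fun y : R => y `^ (e + 1) / (e + 1))^`())%classic x = x `^ e.
Proof.
move=> x0 e1; have xi : x \in `]0, +oo[ by rewrite in_itv/= x0.
have dx : derivable (@powR R ^~ (e + 1)) x 1 by exact: derivable_powR.
have E : (fun y : R => y `^ (e + 1) / (e + 1)) = (e + 1)^-1 \*: (@powR R ^~ (e + 1)).
  by apply/funext => y /=; rewrite mulrC.
split; first by rewrite E; exact: derivableZ.
rewrite E derive1E deriveZ//= -derive1E powR_derive1// addrK.
by rewrite /GRing.scale/= mulrA mulVf// mul1r.
Qed.

Lemma integral_pow_itv e a b : 0 < a < b -> e + 1 != 0 ->
  (\int[mu]_(x in `[a, b]) (x `^ e)%:E = ((b `^ (e + 1) - a `^ (e + 1)) / (e + 1))%:E)%E.
Proof.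
move=> /andP[a0 ab] e1; rewrite mulrBl EFinB.
apply: (@continuous_FTC2 _ _ (fun y : R => y `^ (e + 1) / (e + 1))) => //.
- apply: derivable_within_continuous => x; rewrite in_itv/= => /andP[ax _].
  by apply: derivable_powR; rewrite in_itv/= (lt_le_trans a0 ax).
- have dc x : a <= x -> {for x, continuous (fun y : R => y `^ (e + 1) / (e + 1))}.
    move=> ax; apply/differentiable_continuous/derivable1_diffP.
    exact: (powR_prim (lt_le_trans a0 ax) e1).1.
  split.
  + by move=> x; rewrite in_itv/= => /andP[ax _]; exact: (powR_prim (lt_trans a0 ax) e1).1.
  + by apply: cvg_at_right_filter; exact: dc.
  + by apply: cvg_at_left_filter; apply: dc; exact: ltW.
- by move=> x; rewrite in_itv/= => /andP[ax _]; exact: (powR_prim (lt_trans a0 ax) e1).2.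
Qed.

Let mpow e (A : set R) : measurable_fun A (fun x => (x `^ e)%:E).
Proof. by apply/measurable_EFinP; apply: measurable_funTS; exact: measurable_powR. Qed.

(** The possible singularity at 0 confines the fundamental theorem of calculus to [c / (n + 2), c];
    monotone convergence does the rest. With n + 2 the left end is always strictly below c. *)
Lemma integral_pow_seg e c : -1 < e -> 0 <= c ->
  (\int[mu]_(x in `]0%R, c]) (x `^ e)%:E = (c `^ (e + 1) / (e + 1))%:E)%E.
Proof.
move=> e1; have e10 : 0 < e + 1 by lra.
rewrite le_eqVlt => /predU1P[<-|c0].
  by rewrite set_itvoc0 integral_set0 powR0 ?gt_eqF// mul0r.
pose F (n : nat) := `[c / n.+2%:R, c]%classic.
have cF n : 0 < c / n.+2%:R < c.
  by rewrite divr_gt0//= ltr_pdivrMr// ltr_pMr// ltr1n.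
have -> : `]0%R, c]%classic = \bigcup_n F n.
  apply/seteqP; split => x; rewrite /F/= in_itv/=.
    move=> /andP[x0 xc]; have xc0 : 0 < x / c by rewrite divr_gt0.
    have [n _ /(_ n (leqnn n))] := near_infty_natSinv_lt (PosNum xc0) => /= nx.
    exists n => //=; rewrite in_itv/= xc andbT mulrC -ler_pdivlMr//.
    by apply: le_trans (ltW nx); rewrite lef_pV2 ?posrE// ler_nat.
  by move=> [n _]; rewrite /= in_itv/= => /andP[nx ->]; rewrite andbT (lt_le_trans _ nx)// divr_gt0.
have ndF : nondecreasing_seq F.
  apply/nondecreasing_seqP => n; apply/subsetPset => x; rewrite /F/= !in_itv/= => /andP[nx ->].
  rewrite andbT; apply: le_trans nx; rewrite ler_pM2l// lef_pV2 ?posrE// ler_nat//.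
have H1 : (fun i => (\int[mu]_(x in F i) (x `^ e)%:E)%E) @ \oo -->
    (\int[mu]_(x in \bigcup_i F i) (x `^ e)%:E)%E.
  apply: ge0_nondecreasing_set_cvg_integral => // i.
  - exact: measurable_itv.
  - exact: mpow.
  - by move=> x _; exact: powR_ge0.
have H2 : (fun i => (\int[mu]_(x in F i) (x `^ e)%:E)%E) @ \oo --> (c `^ (e + 1) / (e + 1))%:E.
  under eq_fun => i do rewrite (integral_pow_itv (cF i) (lt0r_neq0 e10)).
  apply: cvg_EFin; first exact: nearW.
  have -> : c `^ (e + 1) / (e + 1) = (c `^ (e + 1) - 0) / (e + 1) by rewrite subr0.
  apply: cvgM; last exact: cvg_cst.
  apply: cvgB; first exact: cvg_cst.
  apply: cvg_powR0 => //; first by move=> n; rewrite divr_ge0// ltW.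
  have -> : (0 : R) = c * 0 by rewrite mulr0.
  apply: cvgM; first exact: cvg_cst.
  by have := @cvg_harmonic R; rewrite -cvg_shiftS; exact.
exact: (cvg_unique _ H1 H2).
Qed.

Lemma integral_pow_infty e c : e < -1 -> 0 < c ->
  (\int[mu]_(x in `[c, +oo[) (x `^ e)%:E = (c `^ (e + 1) / - (e + 1))%:E)%E.
Proof.
move=> e1 c0; have e10 : e + 1 < 0 by lra.
pose F (n : nat) := `[c, c + n.+1%:R]%classic.
have cF n : 0 < c < c + n.+1%:R by rewrite c0/= ltrDl.
have -> : `[c, +oo[%classic = \bigcup_n F n.
  apply/seteqP; split => x; rewrite /F/= in_itv/= ?andbT.
    move=> cx; exists (Num.truncn (x - c)) => //=; rewrite in_itv/= cx/=.
    by rewrite -lerBlDl ltW// truncnS_gt.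
  by move=> [n _]; rewrite /= in_itv/= => /andP[].
have ndF : nondecreasing_seq F.
  apply/nondecreasing_seqP => n; apply/subsetPset => x; rewrite /F/= !in_itv/= => /andP[-> nx]/=.
  by apply: le_trans nx _; rewrite lerD2l ler_nat.
have H1 : (fun i => (\int[mu]_(x in F i) (x `^ e)%:E)%E) @ \oo -->
    (\int[mu]_(x in \bigcup_i F i) (x `^ e)%:E)%E.
  apply: ge0_nondecreasing_set_cvg_integral => // i.
  - exact: measurable_itv.
  - exact: mpow.
  - by move=> x _; exact: powR_ge0.
have H2 : (fun i => (\int[mu]_(x in F i) (x `^ e)%:E)%E) @ \oo --> (c `^ (e + 1) / - (e + 1))%:E.
  under eq_fun => i do rewrite (integral_pow_itv (cF i) (ltr0_neq0 e10)).
  apply: cvg_EFin; first exact: nearW.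
  have -> : c `^ (e + 1) / - (e + 1) = (0 - c `^ (e + 1)) / (e + 1) by rewrite invrN sub0r mulrN mulNr.
  apply: cvgM; last exact: cvg_cst.
  apply: cvgB; last exact: cvg_cst.
  (* A negative power tending to 0 at infinity is rewritten as a positive power of the reciprocal,
     for [cvg_powR0]. *)
  have -> : (fun n => (c + n.+1%:R) `^ (e + 1)) = (fun n : nat => ((c + n.+1%:R)^-1) `^ (- (e + 1))).
    apply/funext => n; rewrite -powR_inv1 ?addr_ge0 ?(ltW c0)//.
    by rewrite -powRrM mulN1r opprK.
  apply: cvg_powR0; first by rewrite oppr_gt0.
    by move=> n; rewrite invr_ge0 addr_ge0// ltW.
  apply: (@squeeze_cvgr _ _ _ _ (cst 0) (fun n => n.+1%:R^-1)) => //; last exact: cvg_harmonic.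
    apply: nearW => n /=; rewrite invr_ge0 addr_ge0//= ?(ltW c0)//.
    by rewrite lef_pV2 ?posrE ?addr_gt0// lerDr ltW.
  exact: cvg_cst.
exact: (cvg_unique _ H1 H2).
Qed.

Lemma integral_powl e p q : -1 < e -> p <= q ->
  (\int[mu]_(x in `]p, q]) ((x - p) `^ e)%:E = ((q - p) `^ (e + 1) / (e + 1))%:E)%E.
Proof.
move=> e1 pq; have qp : 0 <= q - p by rewrite subr_ge0.
rewrite -(integral_pow_seg e1 qp).
rewrite [RHS](@ge0_integral_shift (- p)) => //; last by move=> x _; exact: powR_ge0.
congr (integral _ _ _); apply/seteqP; split => x /=; rewrite !in_itv/= => /andP[? ?]; apply/andP; split; lra.
Qed.

Lemma integral_powr e p q : -1 < e -> p <= q ->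
  (\int[mu]_(x in `[p, q[) ((q - x) `^ e)%:E = ((q - p) `^ (e + 1) / (e + 1))%:E)%E.
Proof.
move=> e1 pq; have qp : 0 <= q - p by rewrite subr_ge0.
rewrite -(integral_pow_seg e1 qp).
rewrite [RHS](@ge0_integral_rev q) => //; last by move=> x _; exact: powR_ge0.
congr (integral _ _ _); apply/seteqP; split => x /=; rewrite !in_itv/= => /andP[? ?]; apply/andP; split; lra.
Qed.

Lemma integral_pow_right e x q : e < -1 -> x < q ->
  (\int[mu]_(y in `[q, +oo[) ((y - x) `^ e)%:E = ((q - x) `^ (e + 1) / - (e + 1))%:E)%E.
Proof.
move=> e1 xq; have qx : 0 < q - x by rewrite subr_gt0.
rewrite -(integral_pow_infty e1 qx).
rewrite [RHS](@ge0_integral_shift (- x)) => //; last by move=> y _; exact: powR_ge0.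
congr (integral _ _ _); apply/seteqP; split => y /=; rewrite !in_itv/= !andbT; lra.
Qed.

Lemma integral_pow_left e p x : e < -1 -> p < x ->
  (\int[mu]_(y in `]-oo, p]) ((x - y) `^ e)%:E = ((x - p) `^ (e + 1) / - (e + 1))%:E)%E.
Proof.
move=> e1 px; have xp : 0 < x - p by rewrite subr_gt0.
rewrite -(integral_pow_infty e1 xp).
rewrite [RHS](@ge0_integral_rev x) => //; last by move=> y _; exact: powR_ge0.
congr (integral _ _ _); apply/seteqP; split => y /=; rewrite !in_itv/= !andbT; lra.
Qed.

Lemma measurable_dist_pow e (A : set R) x : measurable_fun A (fun y => (`|x - y| `^ e)%:E).
Proof.
apply/measurable_EFinP; apply: measurable_funTS.
apply: (measurableT_comp (measurable_powR e)); apply: measurableT_comp => //.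
exact: measurable_funB.
Qed.

Lemma integral_dist_pow_in e p q x : -1 < e -> p <= x <= q ->
  (\int[mu]_(y in `]p, q]) (`|x - y| `^ e)%:E =
   (((x - p) `^ (e + 1) + (q - x) `^ (e + 1)) / (e + 1))%:E)%E.
Proof.
move=> e1 /andP[px xq]; rewrite mulrDl EFinD.
have -> : `]p, q]%classic = `]p, x]%classic `|` `]x, q]%classic.
  by rewrite -itv_bndbnd_setU// bnd_simp.
rewrite ge0_integral_setU//=; last 2 first.
- exact: measurable_dist_pow.
- rewrite disj_set2E; apply/eqP/seteqP; split => // y /= []; rewrite !in_itv/= => /andP[_ yx] /andP[xy _].
  by move: (lt_le_trans xy yx); rewrite ltxx.
congr (_ + _)%E.
  rewrite -(integral_powr e1 px) -integral_itv_bndo_bndc; last exact: measurable_dist_pow.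
  rewrite integral_itv_obnd_cbnd; last exact: measurable_dist_pow.
  apply: eq_integral => y; rewrite inE/= in_itv/= => /andP[_ yx].
  by rewrite ger0_norm// subr_ge0 ltW.
rewrite -(integral_powl e1 xq); apply: eq_integral => y; rewrite inE/= in_itv/= => /andP[xy _].
by rewrite distrC ger0_norm// subr_ge0 ltW.
Qed.

Lemma integral_dist_pow_out e p q x : e < -1 -> p < x < q ->
  (\int[mu]_(y in ~` `]p, q]) (`|x - y| `^ e)%:E =
   (((x - p) `^ (e + 1) + (q - x) `^ (e + 1)) / - (e + 1))%:E)%E.
Proof.
move=> e1 /andP[px xq]; rewrite mulrDl EFinD.
have -> : ~` `]p, q]%classic = `]-oo, p]%classic `|` `]q, +oo[%classic.
  by rewrite setCitv.
rewrite ge0_integral_setU//=; last 2 first.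
- exact: measurable_dist_pow.
- rewrite disj_set2E; apply/eqP/seteqP; split => // y /= []; rewrite !in_itv/= => yp; rewrite andbT => qy.
  by move: (lt_trans (lt_trans (le_lt_trans yp px) xq) qy); rewrite ltxx.
congr (_ + _)%E.
  rewrite -(integral_pow_left e1 px); apply: eq_integral => y; rewrite inE/= in_itv/= => yp.
  by rewrite ger0_norm// subr_ge0 ltW// (le_lt_trans yp).
rewrite -(integral_pow_right e1 xq) -integral_itv_obnd_cbnd; last first.
  apply/measurable_EFinP/measurable_funTS/(measurableT_comp (measurable_powR e)).
  exact: measurable_funB.
apply: eq_integral => y; rewrite inE/= in_itv/= andbT => qy.
by rewrite distrC ger0_norm// subr_ge0 ltW// (lt_trans xq).
Qed.

(** Cutting [[0, t]] at [x] leaves two pieces no longer than [T], hence a constant that depends on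
    neither [x] nor [t]. *)
Lemma dist_pow_potential e T : -1 < e -> 0 <= T -> exists2 C : R, 0 <= C &
  forall x t, 0 <= x <= t -> t <= T -> (\int[mu]_(y in `[0%R, t]) (`|x - y| `^ e)%:E <= C%:E)%E.
Proof.
move=> e1 T0; have e10 : 0 < e + 1 by lra.
exists ((T `^ (e + 1) + T `^ (e + 1)) / (e + 1)).
  apply: divr_ge0; last exact: ltW.
  by rewrite addr_ge0// powR_ge0.
move=> x t /andP[x0 xt] tT; rewrite -integral_itv_obnd_cbnd; last exact: measurable_dist_pow.
rewrite integral_dist_pow_in// ?x0// lee_fin ler_pM2r ?invr_gt0// subr0.
by rewrite lerD// ge0_ler_powR ?nnegrE//; lra.
Qed.

Lemma measurable_dist_pow2 e :
  measurable_fun setT (fun z : measurableTypeR R * measurableTypeR R => `|z.1 - z.2| `^ e).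
Proof.
apply: (measurableT_comp (measurable_powR e)); apply: measurableT_comp => //.
exact: measurable_funB.
Qed.

(* The weight [t - x] alone; a bound for [min (t - x) (t - y)] follows since the
   power of a minimum is at most the sum of the powers. *)
Lemma double_potential e T : -1 < e -> 0 <= T -> exists2 C : R, 0 <= C &
  forall t, 0 <= t <= T ->
  (\int[mu \x mu]_z (\1_(`[0%R, t]%classic) z.1 * \1_(`[0%R, t]%classic) z.2 *
      (((t - z.1) `^ e + (t - z.2) `^ e) * `|z.1 - z.2| `^ e))%:E <= C%:E)%E.
Proof.
move=> e1 T0; have [C C0 HC] := dist_pow_potential e1 T0.
exists (C * C + C * C); first by rewrite addr_ge0// mulr_ge0.
move=> t /andP[t0 tT].
pose I := \1_(`[0%R, t]%classic) : R -> R.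
have I0 x : 0 <= I x by rewrite /I indicE.
have mI : measurable_fun setT I by exact: measurable_indic.
pose w (x : R) := I x * (t - x) `^ e.
have w0 x : 0 <= w x by rewrite mulr_ge0 ?powR_ge0.
have mw : measurable_fun setT w.
  apply: measurable_funM => //; apply: (measurableT_comp (measurable_powR e)).
  exact: measurable_funB.
have mw2 (a b : measurableTypeR R * measurableTypeR R -> R) :
    measurable_fun setT a -> measurable_fun setT b ->
    measurable_fun setT (fun z => (w (a z) * I (b z) * `|z.1 - z.2| `^ e)%:E).
  move=> ma mb; apply/measurable_EFinP; apply: measurable_funM; last exact: measurable_dist_pow2.
  by apply: measurable_funM; [exact: (measurableT_comp mw)|exact: (measurableT_comp mI)].
have bd : (\int[mu]_x ((w x)%:E * C%:E) <= (C * C)%:E)%E.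
  rewrite ge0_integralZr//; last 2 first.
  - exact/measurable_EFinP.
  - by move=> x _; rewrite lee_fin.
  rewrite EFinM lee_wpmul2r ?lee_fin//; apply: le_trans (HC t t _ tT); last by rewrite t0 lexx.
  rewrite [leRHS]integral_mkcond; apply: ge0_le_integral => //.
  - by move=> x _; rewrite lee_fin.
  - exact/measurable_EFinP.
  - by apply/(measurable_restrictT _ _).1 => //; exact: measurable_dist_pow.
  move=> x _; rewrite /w /I patchE indicE; case: ifPn => [|xt]; last by rewrite mul0r.
  rewrite inE/= in_itv/= => /andP[x0 xt]; rewrite mul1r ger0_norm ?subr_ge0//.
have inner x : 0 <= x <= t -> (\int[mu]_y (I y * `|x - y| `^ e)%:E <= C%:E)%E.
  move=> xt; apply: le_trans (HC x t xt tT); rewrite [leRHS]integral_mkcond.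
  apply: ge0_le_integral => //.
  - by move=> y _; rewrite lee_fin mulr_ge0 ?powR_ge0.
  - apply/measurable_EFinP; apply: measurable_funM => //.
    by apply/measurable_EFinP; exact: measurable_dist_pow.
  - by apply/(measurable_restrictT _ _).1 => //; exact: measurable_dist_pow.
  move=> y _; rewrite /I patchE indicE; case: ifPn => _; by rewrite ?mul1r ?mul0r.
(* Off [[0, t]] the weight [w x] is 0, so the bound on the inner integral is needed for [x] inside
   only. *)
have wI x (J : \bar R) : (0 <= J -> ((0 <= x <= t)%R -> J <= C%:E) -> (w x)%:E * J <= (w x)%:E * C%:E)%E.
  move=> J0 JC; rewrite /w /I indicE; case: (boolP (x \in `[0%R, t]%classic)) => [|_]; last by rewrite mul0r !mul0e.
  by rewrite inE/= in_itv/= => xt; apply: lee_wpmul2l; [rewrite lee_fin mulr_ge0 ?powR_ge0|exact: JC].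
have -> : (fun z : R * R => (\1_(`[0%R, t]%classic) z.1 * \1_(`[0%R, t]%classic) z.2 *
      (((t - z.1) `^ e + (t - z.2) `^ e) * `|z.1 - z.2| `^ e))%:E) =
   (fun z => (w z.1 * I z.2 * `|z.1 - z.2| `^ e)%:E + (w z.2 * I z.1 * `|z.1 - z.2| `^ e)%:E)%E.
  by apply/funext => z; rewrite -EFinD /w /I; congr (_%:E); ring.
rewrite ge0_integralD//; last 4 first.
- by move=> z _; rewrite lee_fin !mulr_ge0 ?powR_ge0.
- by apply: mw2.
- by move=> z _; rewrite lee_fin !mulr_ge0 ?powR_ge0.
- by apply: mw2.
rewrite EFinD leeD//.
  rewrite fubini_tonelli1//=; last 2 first.
  - by apply: mw2.
  - by move=> z; rewrite lee_fin !mulr_ge0 ?powR_ge0.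
  apply: le_trans bd; apply: ge0_le_integral => //=.
  - by move=> x _; apply: integral_ge0 => y _; rewrite lee_fin !mulr_ge0 ?powR_ge0.
  - apply: measurable_fun_fubini_tonelli_F; first by apply: mw2.
    by move=> z; rewrite lee_fin !mulr_ge0 ?powR_ge0.
  - by apply: emeasurable_funM => //; exact/measurable_EFinP.
  move=> x _; rewrite /fubini_F/=; under eq_integral do rewrite -mulrA EFinM.
  rewrite ge0_integralZl_EFin//; last 2 first.
  - by move=> y _; rewrite lee_fin mulr_ge0 ?powR_ge0.
  - apply/measurable_EFinP; apply: measurable_funM => //.
    by apply/measurable_EFinP; exact: measurable_dist_pow.
  apply: wI; last exact: inner.
  by apply: integral_ge0 => y _; rewrite lee_fin mulr_ge0 ?powR_ge0.
rewrite fubini_tonelli2//=; last 2 first.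
- by apply: mw2.
- by move=> z; rewrite lee_fin !mulr_ge0 ?powR_ge0.
apply: le_trans bd; apply: ge0_le_integral => //=.
- by move=> y _; apply: integral_ge0 => x _; rewrite lee_fin !mulr_ge0 ?powR_ge0.
- apply: measurable_fun_fubini_tonelli_G; first by apply: mw2.
  by move=> z; rewrite lee_fin !mulr_ge0 ?powR_ge0.
- by apply: emeasurable_funM => //; exact/measurable_EFinP.
move=> y _; rewrite /fubini_G/=; under eq_integral do rewrite distrC -mulrA EFinM.
rewrite ge0_integralZl_EFin//; last 2 first.
- by move=> x _; rewrite lee_fin mulr_ge0 ?powR_ge0.
- apply/measurable_EFinP; apply: measurable_funM => //.
  by apply/measurable_EFinP; exact: measurable_dist_pow.
apply: wI; last exact: inner.
by apply: integral_ge0 => x _; rewrite lee_fin mulr_ge0 ?powR_ge0.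
Qed.

End power_integrals.

(** * Comparison of nonnegative integrals and Tonelli's theorem in the plane *)

Lemma measurable_comp_fst (R : realType) (f : R -> R) : measurable_fun setT f ->
  measurable_fun setT (fun z : measurableTypeR R * measurableTypeR R => f z.1).
Proof. by move=> mf; exact: (measurableT_comp mf measurable_fst). Qed.

Lemma measurable_comp_snd (R : realType) (f : R -> R) : measurable_fun setT f ->
  measurable_fun setT (fun z : measurableTypeR R * measurableTypeR R => f z.2).
Proof. by move=> mf; exact: (measurableT_comp mf measurable_snd). Qed.

Lemma measurable_abs_fun d (T : measurableType d) (R : realType) (D : set T) (f : T -> R) :
  measurable_fun D f -> measurable_fun D (fun x => `|f x|).
Proof. by move=> mf; exact: measurableT_comp. Qed.

Section real_integral.
Context d (T : measurableType d) (R : realType) (m : {measure set T -> \bar R}).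
Implicit Types (f g h : T -> R) (a b c : R).

Lemma ge0_integralrZ c f : 0 <= c -> measurable_fun setT f -> (forall x, 0 <= f x) ->
  (\int[m]_x (c * f x)%:E = c%:E * \int[m]_x (f x)%:E)%E.
Proof.
move=> c0 mf f0; under eq_integral do rewrite EFinM.
rewrite ge0_integralZl_EFin//; last exact/measurable_EFinP.
by move=> x _; rewrite lee_fin.
Qed.

Lemma ge0_integralrD f g : measurable_fun setT f -> (forall x, 0 <= f x) ->
  measurable_fun setT g -> (forall x, 0 <= g x) ->
  (\int[m]_x (f x + g x)%:E = \int[m]_x (f x)%:E + \int[m]_x (g x)%:E)%E.
Proof.
move=> mf f0 mg g0; under eq_integral do rewrite EFinD.
rewrite ge0_integralD//.
- by move=> x _; rewrite lee_fin.
- exact/measurable_EFinP.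
- by move=> x _; rewrite lee_fin.
- exact/measurable_EFinP.
Qed.

Lemma ge0_integralr_ge0 f : (forall x, 0 <= f x) -> (0 <= \int[m]_x (f x)%:E)%E.
Proof. by move=> f0; apply: integral_ge0 => x _; rewrite lee_fin. Qed.

Lemma ge0_le_integralr f g : measurable_fun setT f -> (forall x, 0 <= f x) ->
  measurable_fun setT g -> (forall x, f x <= g x) ->
  (\int[m]_x (f x)%:E <= \int[m]_x (g x)%:E)%E.
Proof.
move=> mf f0 mg fg; apply: ge0_le_integral => //.
- by move=> x _; rewrite lee_fin.
- exact/measurable_EFinP.
- exact/measurable_EFinP.
- by move=> x _; rewrite lee_fin.
Qed.

Lemma ae_ge0_le_integralr f g : measurable_fun setT f -> (forall x, 0 <= f x) ->
  measurable_fun setT g -> (forall x, 0 <= g x) -> {ae m, forall x, f x <= g x} ->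
  (\int[m]_x (f x)%:E <= \int[m]_x (g x)%:E)%E.
Proof.
move=> mf f0 mg g0 fg; apply: ae_ge0_le_integral => //.
- by move=> x _; rewrite lee_fin.
- exact/measurable_EFinP.
- by move=> x _; rewrite lee_fin.
- exact/measurable_EFinP.
- by apply: filterS fg => x ? _; rewrite lee_fin.
Qed.

Lemma ae_ge0_integralr_le_lin f g h a b : measurable_fun setT f -> (forall x, 0 <= f x) ->
  measurable_fun setT g -> (forall x, 0 <= g x) -> measurable_fun setT h -> (forall x, 0 <= h x) ->
  0 <= a -> 0 <= b -> {ae m, forall x, f x <= a * g x + b * h x} ->
  (\int[m]_x (f x)%:E <= a%:E * \int[m]_x (g x)%:E + b%:E * \int[m]_x (h x)%:E)%E.
Proof.
move=> mf f0 mg g0 mh h0 a0 b0 fgh.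
have mag : measurable_fun setT (fun x => a * g x) by exact: measurable_funM.
have mbh : measurable_fun setT (fun x => b * h x) by exact: measurable_funM.
have ag0 x : 0 <= a * g x by rewrite mulr_ge0.
have bh0 x : 0 <= b * h x by rewrite mulr_ge0.
rewrite -!ge0_integralrZ// -ge0_integralrD//.
by apply: ae_ge0_le_integralr => //; [exact: measurable_funD|move=> x; rewrite addr_ge0].
Qed.

Lemma ge0_integralr_le_lin f g h a b : measurable_fun setT f -> (forall x, 0 <= f x) ->
  measurable_fun setT g -> (forall x, 0 <= g x) -> measurable_fun setT h -> (forall x, 0 <= h x) ->
  0 <= a -> 0 <= b -> (forall x, f x <= a * g x + b * h x) ->
  (\int[m]_x (f x)%:E <= a%:E * \int[m]_x (g x)%:E + b%:E * \int[m]_x (h x)%:E)%E.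
Proof. by move=> *; apply: ae_ge0_integralr_le_lin => //; exact: aeW. Qed.

End real_integral.

Section tonelli_line.
Context (R : realType).
Local Notation mu := (@lebesgue_measure R).
Implicit Types f : measurableTypeR R * measurableTypeR R -> \bar R.

Lemma tonelli_line f : measurable_fun setT f -> (forall z, 0 <= f z)%E ->
  (\int[mu \x mu]_z f z = \int[mu]_x \int[mu]_y f (x, y))%E.
Proof. exact: fubini_tonelli1. Qed.

Lemma measurable_tonelli_line f : measurable_fun setT f -> (forall z, 0 <= f z)%E ->
  measurable_fun setT (fun x : measurableTypeR R => \int[mu]_y f (x, y))%E.
Proof. exact: measurable_fun_fubini_tonelli_F. Qed.

Lemma tonelli_line_swap f : measurable_fun setT f -> (forall z, 0 <= f z)%E ->
  (\int[mu \x mu]_z f (z.2, z.1) = \int[mu \x mu]_z f z)%E.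
Proof.
move=> mf f0; rewrite [RHS]tonelli_line//.
have mf' : measurable_fun setT (fun z : measurableTypeR R * measurableTypeR R => f (z.2, z.1)).
  by apply: (measurableT_comp mf); exact: measurable_swap.
exact: (@fubini_tonelli2 _ _ _ _ _ mu mu _ mf' (fun z => f0 _)).
Qed.

Lemma tonelli_line_le (F : measurableTypeR R * measurableTypeR R -> R) (a : measurableTypeR R -> R) (C : \bar R) :
  measurable_fun setT F -> (forall z, 0 <= F z) ->
  measurable_fun setT a -> (forall x, 0 <= a x) -> (0 <= C)%E ->
  (forall x, \int[mu]_y (F (x, y))%:E <= (a x)%:E * C)%E ->
  (\int[mu \x mu]_z (F z)%:E <= (\int[mu]_x (a x)%:E) * C)%E.
Proof.
move=> mF F0 ma a0 C0 FC.
have mF' : measurable_fun setT (fun z => (F z)%:E) by exact/measurable_EFinP.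
have F0' z : (0 <= (F z)%:E)%E by rewrite lee_fin.
have ma' : measurable_fun setT (fun x => (a x)%:E) by exact/measurable_EFinP.
have a0' x : setT x -> (0 <= (a x)%:E)%E by rewrite lee_fin.
rewrite (tonelli_line mF' F0') -(ge0_integralZr _ measurableT ma' a0' C0).
apply: ge0_le_integral.
- exact: measurableT.
- by move=> x _; apply: integral_ge0 => y _; exact: F0'.
- exact: (measurable_tonelli_line mF' F0').
- by apply: emeasurable_funM => //; exact: measurable_cst.
- by move=> x _; exact: FC.
Qed.

Lemma tonelli_line_ge (F : measurableTypeR R * measurableTypeR R -> R) (a : measurableTypeR R -> R) (C : \bar R) :
  measurable_fun setT F -> (forall z, 0 <= F z) ->
  measurable_fun setT a -> (forall x, 0 <= a x) -> (0 <= C)%E ->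
  (forall x, (a x)%:E * C <= \int[mu]_y (F (x, y))%:E)%E ->
  ((\int[mu]_x (a x)%:E) * C <= \int[mu \x mu]_z (F z)%:E)%E.
Proof.
move=> mF F0 ma a0 C0 FC.
have mF' : measurable_fun setT (fun z => (F z)%:E) by exact/measurable_EFinP.
have F0' z : (0 <= (F z)%:E)%E by rewrite lee_fin.
have ma' : measurable_fun setT (fun x => (a x)%:E) by exact/measurable_EFinP.
have a0' x : setT x -> (0 <= (a x)%:E)%E by rewrite lee_fin.
rewrite (tonelli_line mF' F0') -(ge0_integralZr _ measurableT ma' a0' C0).
apply: ge0_le_integral.
- exact: measurableT.
- by move=> x _; rewrite mule_ge0// a0'.
- by apply: emeasurable_funM => //; exact: measurable_cst.
- exact: (measurable_tonelli_line mF' F0').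
- by move=> x _; exact: FC.
Qed.

(** Two exceptional points are allowed so that both ends of an interval can be discarded at once. *)
Lemma ae_line_neq (Q : R -> Prop) (c c' : R) : (forall x, x != c -> x != c' -> Q x) ->
  {ae mu, forall x, Q x}.
Proof.
move=> cQ; exists ([set c] `|` [set c']); split.
- by apply: measurableU; exact: measurable_set1.
- apply: null_set_setU; try exact: measurable_set1; exact: lebesgue_measure_set1.
move=> x /= nQ; apply: contrapT => xc; apply: nQ; apply: cQ.
  by apply/eqP => xc'; apply: xc; left.
by apply/eqP => xc'; apply: xc; right.
Qed.

Lemma integral_indicM (A : set R) (f : R -> R) :
  (\int[mu]_x (\1_A x * f x)%:E = \int[mu]_(x in A) (f x)%:E)%E.
Proof.
rewrite [RHS]integral_mkcond; apply: eq_integral => x _.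
by rewrite patchE indicE; case: ifPn => _; rewrite ?mul1r ?mul0r.
Qed.

Lemma measurable_trunc (t : R) (g : R -> R) : measurable_fun (`[0, t]%classic : set (measurableTypeR R)) g ->
  measurable_fun setT (fun x => g x * \1_(`[0, t]%classic) x).
Proof.
move=> mg; have := (measurable_restrictT g (measurable_itv `[0%R, t])).1 mg.
rewrite (_ : g \_ _ = (fun x => g x * \1_(`[0, t]%classic) x))//.
by apply/funext => x; rewrite patchE indicE; case: ifPn => _; rewrite ?mulr1 ?mulr0.
Qed.

End tonelli_line.

(** * Second moment of a Wiener integral *)

Section has_integral.
Context d (X : measurableType d) (R : realType) (m : {measure set X -> \bar R}).
Implicit Types (g h : X -> R) (r : R).

(** Integrability is carried along with the value, so that linear combinations transport both; the
    extended integral alone is not additive for functions of varying sign. *)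
Definition has_integral g r := m.-integrable setT (EFin \o g) /\ \int[m]_x g x = r.

Lemma has_integralD g h r r' : has_integral g r -> has_integral h r' ->
  has_integral (fun x => g x + h x) (r + r').
Proof.
move=> [ig <-] [ih <-]; split; last by rewrite -RintegralD.
exact: (integrableD _ ig ih).
Qed.

Lemma has_integralZ c g r : has_integral g r -> has_integral (fun x => c * g x) (c * r).
Proof.
move=> [ig <-]; split; last by rewrite -RintegralZl.
exact: (integrableZl _ c ig).
Qed.

Lemma has_integralB g h r r' : has_integral g r -> has_integral h r' ->
  has_integral (fun x => g x - h x) (r - r').
Proof.
move=> ig ih; rewrite -[- r']mulN1r.
rewrite (_ : (fun x => _) = (fun x => g x + -1 * h x)); last by apply/funext => x; rewrite mulN1r.
by apply: has_integralD => //; exact: has_integralZ.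
Qed.

Lemma has_integral0 : has_integral (fun=> 0) 0.
Proof.
split; first exact: integrable0.
by rewrite /Rintegral integral0.
Qed.

Lemma has_integral_sum (I : Type) (s : seq I) (g : I -> X -> R) (r : I -> R) (Q : pred I) :
  all Q s -> (forall i, Q i -> has_integral (g i) (r i)) ->
  has_integral (fun x => \sum_(i <- s) g i x) (\sum_(i <- s) r i).
Proof.
move=> + H; elim: s => [_|i s ih /= /andP[Qi Qs]].
  rewrite big_nil (_ : (fun x => _) = (fun=> 0)); first exact: has_integral0.
  by apply/funext => x; rewrite big_nil.
rewrite big_cons (_ : (fun x => _) = (fun x => g i x + \sum_(j <- s) g j x)).
  by apply: has_integralD; [exact: H|exact: ih].
by apply/funext => x; rewrite big_cons.
Qed.

Lemma has_integral_ereal g r : has_integral g r -> (\int[m]_x (g x)%:E = r%:E)%E.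
Proof. by move=> [ig <-]; rewrite /Rintegral fineK//; exact: integrable_fin_num. Qed.

Lemma has_integral_ge0 g r : measurable_fun setT g -> (forall x, 0 <= g x) ->
  (\int[m]_x (g x)%:E = r%:E)%E -> has_integral g r.
Proof.
move=> mg g0 gr; split; last by rewrite /Rintegral gr.
apply/integrableP; split; first exact/measurable_EFinP.
by rewrite (_ : (fun x => _) = EFin \o g) ?gr ?ltry//; apply/funext => x /=; rewrite ger0_norm.
Qed.

Section polarization.
Context (U V : R -> X -> R) (rho : R -> R -> R) (J : pred R).
Hypothesis H : forall p q, J p -> J q ->
  has_integral (fun x => (U q x - U p x) * (V q x - V p x)) (rho p q).

(** For [rho p q] = |q - p|^(2 H) the bracket is twice the covariance of two increments of
    fractional Brownian motion. [U] and [V] may differ because the energy for H > 1/2 pairs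
    functions of two different variables. *)
Definition step_mass (s : seq (R * (R * R))) : R :=
  \sum_(e <- s) \sum_(e' <- s) e.1 * e'.1 / 2 *
    (rho e'.2.1 e.2.2 + rho e'.2.2 e.2.1 - rho e'.2.2 e.2.2 - rho e'.2.1 e.2.1).

(* Every product of increments is a combination of squared increments, so the
   energy of a step function is determined by that of single intervals. *)
Lemma has_integral_step (s : seq (R * (R * R))) : all (fun e => J e.2.1 && J e.2.2) s ->
  has_integral (fun x => (\sum_(e <- s) e.1 * (U e.2.2 x - U e.2.1 x)) *
                         (\sum_(e <- s) e.1 * (V e.2.2 x - V e.2.1 x))) (step_mass s).
Proof.
move=> Js; pose f p q x := (U q x - U p x) * (V q x - V p x).
rewrite (_ : (fun x => _) = (fun x => \sum_(e <- s) \sum_(e' <- s) e.1 * e'.1 / 2 *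
    (f e'.2.1 e.2.2 x + f e'.2.2 e.2.1 x - f e'.2.2 e.2.2 x - f e'.2.1 e.2.1 x))).
  apply: (has_integral_sum Js) => e /andP[Jp Jq].
  apply: (has_integral_sum Js) => e' /andP[Jp' Jq'].
  apply: has_integralZ; apply: has_integralB; last exact: H.
  apply: has_integralB; last exact: H.
  by apply: has_integralD; exact: H.
apply/funext => x.
pose dU (e : R * (R * R)) := U e.2.2 x - U e.2.1 x.
pose dV (e : R * (R * R)) := V e.2.2 x - V e.2.1 x.
transitivity (\sum_(e <- s) \sum_(e' <- s) e.1 * e'.1 * (dU e * dV e')).
  rewrite mulr_suml; apply: eq_bigr => e _; rewrite mulr_sumr; apply: eq_bigr => e' _.
  by rewrite /dU /dV; ring.
(* Exchanging the two summations leaves only the part of [dU e * dV e'] symmetric in [e] and [e'];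
   that part is a combination of the terms [f], in which both factors have the same endpoints. *)
transitivity (\sum_(e <- s) \sum_(e' <- s) e.1 * e'.1 / 2 * (dU e * dV e') +
              \sum_(e <- s) \sum_(e' <- s) e.1 * e'.1 / 2 * (dU e' * dV e)).
  rewrite [X in _ + X]exchange_big/= -big_split/=; apply: eq_bigr => e _.
  by rewrite -big_split/=; apply: eq_bigr => e' _; field.
rewrite -big_split/=; apply: eq_bigr => e _; rewrite -big_split/=; apply: eq_bigr => e' _.
by rewrite /f /dU /dV; field.
Qed.

End polarization.
End has_integral.

(** * Energy of step functions in the three ranges of the Hurst index, and passage to the limit *)

Section fBm_step.
Context (R : realType) (dO : measure_display) (Om : measurableType dO)
  (P : probability Om R) (Hu : R) (W : R -> {RV P >-> R}).
Hypothesis hH : 0 < Hu < 1.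
Hypothesis hW : fBm Hu W.
Local Notation mu := (@lebesgue_measure R).

Let rho (p q : R) := `|q - p| `^ (2 * Hu).

Lemma fBm_increment p q : 0 <= p -> 0 <= q ->
  has_integral P (fun w => (W q w - W p w) * (W q w - W p w)) (rho p q).
Proof.
move=> p0 q0; have H2 : 2 * Hu != 0 by case/andP: hH => H0 _; rewrite mulf_neq0// gt_eqF.
have sq t : 0 <= t -> has_integral P (fun w => W t w * W t w) (t `^ (2 * Hu)).
  move=> t0; apply: has_integral_ge0.
  - exact: measurable_funM.
  - by move=> w; rewrite -expr2 sqr_ge0.
  - have := fBm_cov hW t0 t0; rewrite unlock => ->.
    by rewrite subrr normr0 powR0// subr0; congr (_%:E); field.
(* The value is the covariance; integrability comes from domination by the sum of the two
   squares. *)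
have pr : has_integral P (fun w => W q w * W p w)
    ((q `^ (2 * Hu) + p `^ (2 * Hu) - `|q - p| `^ (2 * Hu)) / 2).
  split; last first.
    by have := fBm_cov hW q0 p0; rewrite unlock /Rintegral => ->.
  apply: (le_integrable _ _ _ (has_integralD (sq q q0) (sq p p0)).1) => //.
    by apply/measurable_EFinP; exact: measurable_funM.
  move=> w _ /=; rewrite lee_fin -!expr2 [leRHS]ger0_norm ?addr_ge0 ?sqr_ge0//.
  have := sqr_ge0 (W q w - W p w); have := sqr_ge0 (W q w + W p w).
  rewrite sqrrD sqrrB ler_norml => h1 h2; apply/andP; split; nra.
have := has_integralD (has_integralD (sq q q0) (sq p p0)) (has_integralZ (-2) pr).
rewrite (_ : _ + _ + -2 * _ = rho p q); last by rewrite /rho; field.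
rewrite (_ : (fun w => _) = (fun w => (W q w - W p w) * (W q w - W p w)))//.
by apply/funext => w; ring.
Qed.

Lemma fBm_step_integral t s : step_in t s ->
  has_integral P (fun w => step_integral W s w ^+ 2) (step_mass rho s).
Proof.
move=> sin; have Js : all (fun e : R * (R * R) => (0 <= e.2.1) && (0 <= e.2.2)) s.
  apply: sub_all sin => e /and3P[p0 pq _]; apply/andP; split => //; exact: le_trans pq.
have := has_integral_step (J := fun r => 0 <= r) fBm_increment Js.
by rewrite (_ : (fun w => _) = (fun w => step_integral W s w ^+ 2)).
Qed.

(** The indicator of a half-line plays the part of [W p]: its increments are interval indicators, so
    the polarization lemma computes deterministic energies by the same [step_mass] as the second
    moment of [step_integral]. *)
Let theta (p x : R) : R := (x <= p)%R%:R.

Let step_theta t s x : step_in t s ->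
  \sum_(e <- s) e.1 * (theta e.2.2 x - theta e.2.1 x) = step_fun s x.
Proof.
elim: s => [|e s ih]/=; first by rewrite /step_fun !big_nil.
move=> /andP[/and3P[_ pq _] sin]; rewrite /step_fun !big_cons -/(step_fun s x) ih//.
congr (_ * _ + _); rewrite indicE /theta mem_setE in_itv/=.
have [xp|px] := leP x e.2.1; first by rewrite (le_trans xp pq) subrr.
by rewrite subr0 andTb.
Qed.

Lemma measurable_step_fun s : measurable_fun setT (step_fun s : measurableTypeR R -> R).
Proof.
by apply: measurable_sum => e; apply: measurable_funM.
Qed.

Let mtheta p : measurable_fun setT (theta p).
Proof.
rewrite (_ : theta p = \1_(`]-oo, p]%classic)); first exact: measurable_indic.
by apply/funext => x; rewrite indicE mem_setE in_itv.
Qed.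

Let theta_itv p q x : p <= q -> theta q x - theta p x = \1_(`]p, q]%classic) x.
Proof.
move=> pq; rewrite indicE /theta mem_setE in_itv/=.
have [xp|px] := leP x p; first by rewrite (le_trans xp pq) subrr.
by rewrite subr0 andTb.
Qed.

Let hint_half p q : Hu = 1 / 2 ->
  has_integral mu (fun x => (theta q x - theta p x) * (theta q x - theta p x)) (rho p q).
Proof.
move=> H12; wlog pq : p q / p <= q.
  move=> h; have [/h//|/ltW/h] := leP p q.
  rewrite /rho distrC (_ : (fun x => _) = (fun x => (theta q x - theta p x) * (theta q x - theta p x)))//.
  by apply/funext => x; ring.
apply: has_integral_ge0.
- by apply: measurable_funM; apply: measurable_funB; exact: mtheta.
- by move=> x; rewrite -expr2 sqr_ge0.
- under eq_integral do rewrite theta_itv//.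
  rewrite (_ : (fun x => _) = EFin \o \1_(`]p, q]%classic)); last first.
    by apply/funext => x /=; rewrite indicE; case: (_ \in _); rewrite ?mulr0 ?mulr1.
  rewrite integral_indic// setIT.
  transitivity ((q - p)%:E : \bar R).
    etransitivity; first exact: (lebesgue_measure_itv `]p, q]).
    rewrite /= lte_fin; case: ltP => [_|qp]; first by rewrite EFinB.
    by congr (_%:E); lra.
  by rewrite /rho ger0_norm ?subr_ge0// H12 (_ : 2 * (1 / 2) = 1) ?powRr1 ?subr_ge0//; field.
Qed.

Let K (z : measurableTypeR R * measurableTypeR R) := `|z.1 - z.2| `^ (2 * Hu - 2).

Let mK : measurable_fun setT K.
Proof. exact: measurable_dist_pow2. Qed.

Let mI (A B : set R) : measurable A -> measurable B ->
  measurable_fun setT (fun z => (\1_A z.1 * \1_B z.2 * K z)%:E).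
Proof.
move=> mA mB; apply/measurable_EFinP; apply: measurable_funM => //.
apply: measurable_funM.
  exact: (measurableT_comp (measurable_indic mA) measurable_fst).
exact: (measurableT_comp (measurable_indic mB) measurable_snd).
Qed.

Let I0 (A B : set R) z : (0 <= (\1_A z.1 * \1_B z.2 * K z)%:E)%E.
Proof. by rewrite lee_fin !mulr_ge0 ?powR_ge0// indicE. Qed.

Let energyE (A B : set R) : measurable A -> measurable B ->
  (\int[mu \x mu]_z (\1_A z.1 * \1_B z.2 * K z)%:E =
   \int[mu]_(x in A) \int[mu]_(y in B) (`|x - y| `^ (2 * Hu - 2))%:E)%E.
Proof.
move=> mA mB; rewrite (tonelli_line (mI mA mB) (I0 A B)).
rewrite [RHS]integral_mkcond; apply: eq_integral => x _.
rewrite patchE/=; under eq_integral do rewrite -mulrA mulrC -mulrA.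
rewrite integral_indicM; case: ifPn => xA.
  by apply: eq_integral => y _; rewrite indicE xA mulr1.
by rewrite integral0_eq// => y _; rewrite indicE (negbTE xA) mulr0.
Qed.

Let measurable_slice (B : set R) : measurable B ->
  measurable_fun setT (fun x : R => \int[mu]_(y in B) (`|x - y| `^ (2 * Hu - 2))%:E)%E.
Proof.
move=> mB; have := @measurable_fun_fubini_tonelli_F _ _ _ _ _ mu _ (mI measurableT mB) (I0 setT B).
rewrite /fubini_F; apply: eq_measurable_fun => x _ /=.
rewrite -(integral_indicM B); congr (integral _ _ _); apply/funext => y.
by rewrite [\1_setT _]indicE in_setT mul1r.
Qed.

Let sum_pow p q c : p <= q -> 0 < Hu -> 0 < c ->
  (\int[mu]_(x in `]p, q[) (((x - p) `^ (2 * Hu - 1) + (q - x) `^ (2 * Hu - 1)) / c)%:E =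
  ((q - p) `^ (2 * Hu) / (Hu * c))%:E)%E.
Proof.
move=> pq H0 c0; have H1 : -1 < 2 * Hu - 1 by lra.
have m1 (A : set R) : measurable_fun A (fun x => ((x - p) `^ (2 * Hu - 1))%:E).
  apply/measurable_EFinP/measurable_funTS/(measurableT_comp (measurable_powR _)).
  exact: measurable_funB.
have m2 (A : set R) : measurable_fun A (fun x => ((q - x) `^ (2 * Hu - 1))%:E).
  apply/measurable_EFinP/measurable_funTS/(measurableT_comp (measurable_powR _)).
  exact: measurable_funB.
under eq_integral do rewrite mulrC EFinM EFinD.
rewrite ge0_integralZl_EFin//; last 3 first.
- by move=> x _; rewrite -EFinD lee_fin addr_ge0 ?powR_ge0.
- by apply: emeasurable_funD; [exact: m1|exact: m2].
- by rewrite invr_ge0 ltW.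
rewrite ge0_integralD; [|exact: measurable_itv|by move=> x _; rewrite lee_fin powR_ge0|exact: m1|
  by move=> x _; rewrite lee_fin powR_ge0|exact: m2].
rewrite integral_itv_bndo_bndc// integral_powl//.
rewrite integral_itv_obnd_cbnd// integral_powr//.
rewrite -EFinD -EFinM; congr (_%:E).
have -> : 2 * Hu - 1 + 1 = 2 * Hu by ring.
by field; lra.
Qed.

(** For x in ]p, q] the potential of the complement is ((x - p)^(2 H - 1) + (q - x)^(2 H - 1)) / (1
    - 2 H), and each power integrates to (q - p)^(2 H) / (2 H). This is the source of the
    normalising constant in [fBm_norm2]. *)
Let out_energy p q : Hu < 1 / 2 -> p <= q ->
  (\int[mu \x mu]_z (\1_(`]p, q]%classic) z.1 * \1_(~` `]p, q]%classic) z.2 * K z)%:E =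
   ((q - p) `^ (2 * Hu) / (Hu * (1 - 2 * Hu)))%:E)%E.
Proof.
move=> H12 pq; case/andP: hH => H0 _; rewrite energyE//; last exact: measurableC.
rewrite -sum_pow//; last by lra.
(* The endpoint [q] is dropped: the formula for the outer potential holds in the open interval
   only. *)
rewrite -integral_itv_bndo_bndc; last first.
  by apply: measurable_funTS; apply: measurable_slice; exact: measurableC.
apply: eq_integral => x; rewrite inE/= in_itv/= => xpq.
rewrite integral_dist_pow_out//; last by lra.
have -> : 2 * Hu - 2 + 1 = 2 * Hu - 1 by ring.
by rewrite opprB.
Qed.

Let in_energy p q : 1 / 2 < Hu -> p <= q ->
  (\int[mu \x mu]_z (\1_(`]p, q]%classic) z.1 * \1_(`]p, q]%classic) z.2 * K z)%:E =
   ((q - p) `^ (2 * Hu) / (Hu * (2 * Hu - 1)))%:E)%E.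
Proof.
move=> H12 pq; case/andP: hH => H0 _; rewrite energyE//.
rewrite -sum_pow//; last by lra.
rewrite -integral_itv_bndo_bndc; last by apply: measurable_funTS; exact: measurable_slice.
apply: eq_integral => x; rewrite inE/= in_itv/= => /andP[px xq].
rewrite integral_dist_pow_in//; [|by lra|by rewrite !ltW].
by have -> : 2 * Hu - 2 + 1 = 2 * Hu - 1 by ring.
Qed.

(** The kernel and the constant are put into the first family, the second being theta p x - theta p
    y. Its increment 1_I(x) - 1_I(y) has square 1 exactly on the pairs separated by I = ]p, q]; both
    orders of a pair count, whence the factor 1/2. *)
Let hint_lt p q : Hu < 1 / 2 ->
  has_integral (mu \x mu)%E (fun z => (Hu * (1 - 2 * Hu) / 2 * K z * (theta q z.1 - theta q z.2) -
     Hu * (1 - 2 * Hu) / 2 * K z * (theta p z.1 - theta p z.2)) *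
     ((theta q z.1 - theta q z.2) - (theta p z.1 - theta p z.2))) (rho p q).
Proof.
move=> H12; case/andP: hH => H0 _; wlog pq : p q / p <= q.
  move=> h; have [/h//|/ltW/h] := leP p q.
  rewrite /rho distrC; congr has_integral.
  by apply/funext => z; ring.
have c0 : 0 <= Hu * (1 - 2 * Hu) / 2 by rewrite divr_ge0// mulr_ge0//; lra.
pose I := `]p, q]%classic : set R; have mII : measurable I by exact: measurable_itv.
have E z : (Hu * (1 - 2 * Hu) / 2 * K z * (theta q z.1 - theta q z.2) -
     Hu * (1 - 2 * Hu) / 2 * K z * (theta p z.1 - theta p z.2)) *
     ((theta q z.1 - theta q z.2) - (theta p z.1 - theta p z.2)) =
   Hu * (1 - 2 * Hu) / 2 * (\1_I z.1 * \1_(~` I) z.2 * K z + \1_I z.2 * \1_(~` I) z.1 * K z).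
  have -> : (theta q z.1 - theta q z.2) - (theta p z.1 - theta p z.2) = \1_I z.1 - \1_I z.2.
    by rewrite -!theta_itv//; ring.
  rewrite -mulrBr (_ : theta q z.1 - theta q z.2 - (theta p z.1 - theta p z.2) = \1_I z.1 - \1_I z.2); last first.
    by rewrite -!theta_itv//; ring.
  by rewrite !indicE !in_setC; case: (_ \in I); case: (_ \in I) => /=; ring.
rewrite (funext E).
have hI : has_integral (mu \x mu)%E (fun z => \1_I z.1 * \1_(~` I) z.2 * K z) ((q - p) `^ (2 * Hu) / (Hu * (1 - 2 * Hu))).
  apply: has_integral_ge0.
  - by apply/measurable_EFinP; apply: mI => //; exact: measurableC.
  - by move=> z; rewrite -lee_fin; exact: I0.
  - exact: out_energy.
have hI' : has_integral (mu \x mu)%E (fun z => \1_I z.2 * \1_(~` I) z.1 * K z) ((q - p) `^ (2 * Hu) / (Hu * (1 - 2 * Hu))).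
  have E2 z : \1_I z.2 * \1_(~` I) z.1 * K z = \1_(~` I) z.1 * \1_I z.2 * K z.
    by rewrite [X in X * _]mulrC.
  rewrite (funext E2); apply: has_integral_ge0.
  - by apply/measurable_EFinP; apply: mI => //; exact: measurableC.
  - by move=> z; rewrite -lee_fin; exact: I0.
  - rewrite -out_energy// -tonelli_line_swap; last 2 first.
    + by apply: mI => //; exact: measurableC.
    + exact: I0.
    apply: eq_integral => z _; rewrite /= /K/= distrC; congr (_%:E).
    by rewrite [X in X * _]mulrC.
have -> : rho p q = Hu * (1 - 2 * Hu) / 2 * ((q - p) `^ (2 * Hu) / (Hu * (1 - 2 * Hu)) +
    (q - p) `^ (2 * Hu) / (Hu * (1 - 2 * Hu))).
  by rewrite /rho ger0_norm ?subr_ge0//; field; apply/andP; split; lra.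
exact: has_integralZ (has_integralD hI hI').
Qed.

(** Here the first family acts on the first variable and carries the kernel, the second acts on the
    other variable; the product of the increments is the energy density of the square of ]p, q]. *)
Let hint_gt p q : 1 / 2 < Hu ->
  has_integral (mu \x mu)%E (fun z => (Hu * (2 * Hu - 1) * K z * theta q z.1 -
     Hu * (2 * Hu - 1) * K z * theta p z.1) * (theta q z.2 - theta p z.2)) (rho p q).
Proof.
move=> H12; case/andP: hH => H0 _; wlog pq : p q / p <= q.
  move=> h; have [/h//|/ltW/h] := leP p q.
  rewrite /rho distrC; congr has_integral.
  by apply/funext => z; ring.
pose I := `]p, q]%classic : set R; have mII : measurable I by exact: measurable_itv.
have E z : (Hu * (2 * Hu - 1) * K z * theta q z.1 -
     Hu * (2 * Hu - 1) * K z * theta p z.1) * (theta q z.2 - theta p z.2) =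
   Hu * (2 * Hu - 1) * (\1_I z.1 * \1_I z.2 * K z).
  by rewrite -mulrBr !theta_itv// -/I; ring.
rewrite (funext E).
have hI : has_integral (mu \x mu)%E (fun z => \1_I z.1 * \1_I z.2 * K z) ((q - p) `^ (2 * Hu) / (Hu * (2 * Hu - 1))).
  apply: has_integral_ge0.
  - by apply/measurable_EFinP; exact: mI.
  - by move=> z; rewrite -lee_fin; exact: I0.
  - exact: in_energy.
have -> : rho p q = Hu * (2 * Hu - 1) * ((q - p) `^ (2 * Hu) / (Hu * (2 * Hu - 1))).
  by rewrite /rho ger0_norm ?subr_ge0//; field; apply/andP; split; lra.
exact: has_integralZ hI.
Qed.

Lemma step_mass_lt t s : Hu < 1 / 2 -> step_in t s ->
  ((step_mass rho s)%:E = fBm_norm2 Hu (step_fun s))%E.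
Proof.
move=> H12 sin; case/andP: hH => H0 _.
have := has_integral_step (J := predT) (fun p q _ _ => hint_lt p q H12) (introT allP (fun e _ => isT)).
move=> /(_ s)/has_integral_ereal <-; rewrite /fBm_norm2 H12 -ge0_integralZl_EFin//; last 3 first.
- by move=> z _; rewrite lee_fin mulr_ge0 ?sqr_ge0 ?powR_ge0.
- apply/measurable_EFinP; apply: measurable_funM; last exact: mK.
  apply: measurable_funX; apply: measurable_funB.
    exact: (measurableT_comp (measurable_step_fun s) measurable_fst).
  exact: (measurableT_comp (measurable_step_fun s) measurable_snd).
- by rewrite divr_ge0// mulr_ge0//; lra.
apply: eq_integral => z _; rewrite -EFinM; congr (_%:E).
have -> : \sum_(e <- s) e.1 * ((theta e.2.2 z.1 - theta e.2.2 z.2) - (theta e.2.1 z.1 - theta e.2.1 z.2))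
   = step_fun s z.1 - step_fun s z.2.
  rewrite -!(step_theta _ sin) -sumrB; apply: eq_bigr => e _; ring.
under eq_bigr do rewrite -mulrBr mulrCA.
rewrite -mulr_sumr (_ : \sum_(e <- s) _ = step_fun s z.1 - step_fun s z.2); last first.
  rewrite -!(step_theta _ sin) -sumrB; apply: eq_bigr => e _; ring.
by rewrite /K; ring.
Qed.

Lemma step_mass_eq t s : Hu = 1 / 2 -> step_in t s ->
  ((step_mass rho s)%:E = fBm_norm2 Hu (step_fun s))%E.
Proof.
move=> H12 sin.
have := has_integral_step (J := predT) (fun p q _ _ => hint_half p q H12) (introT allP (fun e _ => isT)).
move=> /(_ s)/has_integral_ereal <-; rewrite /fBm_norm2 H12 ltxx eqxx.
by apply: eq_integral => x _; rewrite (step_theta _ sin) -expr2.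
Qed.

(** The energy obtained for H > 1/2 is signed, whereas [fBm_norm2] has absolute values; the latter
    can only dominate [step_mass]. *)
Lemma step_mass_gt t s : 1 / 2 < Hu -> step_in t s ->
  has_integral (mu \x mu)%E (fun z => Hu * (2 * Hu - 1) * (step_fun s z.1 * step_fun s z.2 * K z)) (step_mass rho s).
Proof.
move=> H12 sin.
have := has_integral_step (J := predT) (fun p q _ _ => hint_gt p q H12) (introT allP (fun e _ => isT)).
move=> /(_ s); congr has_integral; apply/funext => z.
rewrite (step_theta _ sin); under eq_bigr do rewrite -mulrBr mulrCA.
by rewrite -mulr_sumr (step_theta _ sin); ring.
Qed.

Let mfst (f : R -> R) : measurable_fun setT f ->
  measurable_fun setT (fun z : measurableTypeR R * measurableTypeR R => f z.1).
Proof. by move=> mf; exact: (measurableT_comp mf measurable_fst). Qed.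

Let msnd (f : R -> R) : measurable_fun setT f ->
  measurable_fun setT (fun z : measurableTypeR R * measurableTypeR R => f z.2).
Proof. by move=> mf; exact: (measurableT_comp mf measurable_snd). Qed.

Let mabs (f : R -> R) : measurable_fun setT f -> measurable_fun setT (fun x => `|f x|).
Proof. by move=> mf; exact: measurableT_comp. Qed.

Let mfgK (f h : R -> R) : measurable_fun setT f -> measurable_fun setT h ->
  measurable_fun setT (fun z => f z.1 * h z.2 * K z).
Proof.
move=> mf mh; apply: measurable_funM => //.
by apply: measurable_funM; [exact: mfst|exact: msnd].
Qed.

Let fgK0 (f h : R -> R) z : (forall x, 0 <= f x) -> (forall x, 0 <= h x) ->
  0 <= f z.1 * h z.2 * K z.
Proof. by move=> f0 h0; rewrite !mulr_ge0 ?powR_ge0. Qed.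

Lemma step_fun_out (t : R) s (x : R) : step_in t s -> ~ (0 <= x <= t) -> step_fun s x = 0.
Proof.
move=> /allP sin xt; rewrite /step_fun big_seq big1// => e /sin /and3P[p0 pq qt].
rewrite indicE memNset ?mulr0//= in_itv/= => /andP[px xq]; apply: xt.
by rewrite (le_trans p0 (ltW px)) (le_trans xq qt).
Qed.

Let abs_energy (b : R -> R) := (\int[mu \x mu]_z (`|b z.1| * `|b z.2| * K z)%:E)%E.

Let L1 (b : R -> R) := (\int[mu]_x (`|b x|)%:E)%E.

Let L1_ge0 b : (0 <= L1 b)%E.
Proof. by apply: integral_ge0 => x _; rewrite lee_fin. Qed.

(** Two points of [0, t] are at distance at most t, and 2 H - 2 is negative, so the kernel is at
    least t^(2 H - 2) there. *)
Let L1_sq_le (t : R) (b : R -> R) : 1 / 2 < Hu -> 0 < t -> measurable_fun setT b ->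
  (forall x, ~ (0 <= x <= t) -> b x = 0) ->
  (L1 b * L1 b <= (t `^ (2 - 2 * Hu))%:E * abs_energy b)%E.
Proof.
move=> H12 t0 mb b0; case/andP: hH => H0 H1.
have mb' := mabs mb; have mbK := mfgK mb' mb'; set c := t `^ _.
have c0 : 0 <= c by exact: powR_ge0.
have b00 z : 0 <= `|b z.1| * `|b z.2| * K z by exact: (@fgK0 (fun x => `|b x|) (fun x => `|b x|)).
have mcF : measurable_fun setT (fun z => c * (`|b z.1| * `|b z.2| * K z)) by exact: measurable_funM.
rewrite /abs_energy -ge0_integralrZ//.
apply: tonelli_line_ge => //; first by move=> z; rewrite mulr_ge0.
move=> x; rewrite /L1 -ge0_integralrZ//; apply: ae_ge0_le_integralr.
- exact: measurable_funM.
- by move=> y; rewrite mulr_ge0.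
- exact: (measurableT_comp mcF (pair1_measurable x)).
- by move=> y; rewrite mulr_ge0// (b00 (x, y)).
(* The diagonal is excluded because [K] is 0 there: 0 raised to a nonzero power is 0 by
   convention. *)
exists [set x]; split; [exact: measurable_set1|exact: lebesgue_measure_set1|].
move=> y /= nP; apply: contrapT => /eqP yx; apply: nP; rewrite /K/=.
have [xt|/negP xt] := boolP (0 <= x <= t); last by rewrite b0// normr0 !mul0r mulr0.
have [yt|/negP yt] := boolP (0 <= y <= t); last by rewrite (b0 y)// normr0 !mulr0 mul0r mulr0.
rewrite mulrCA ler_peMr ?mulr_ge0//.
have xy0 : 0 < `|x - y| by rewrite normr_gt0 subr_eq0 eq_sym.
rewrite (_ : 2 * Hu - 2 = - (2 - 2 * Hu)); last by ring.
rewrite powRN ler_pdivlMr ?powR_gt0// mul1r ge0_ler_powR ?nnegrE//; first lra.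
- exact: ltW.
by case/andP: xt => ? ?; case/andP: yt => ? ?; rewrite ler_norml; apply/andP; split; lra.
Qed.

(** The potential of the indicator of [0, t] is bounded on [0, t], the exponent 2 H - 2 being above
    -1, so the mixed energy is controlled by an L^1 norm. *)
Let cross_le (t : R) : 1 / 2 < Hu -> 0 < t -> exists2 C : R, 0 <= C &
  forall b : R -> R, measurable_fun setT b -> (forall x, ~ (0 <= x <= t) -> b x = 0) ->
  (\int[mu \x mu]_z (`|b z.1| * \1_(`[0%R, t]%classic) z.2 * K z)%:E <= C%:E * L1 b)%E.
Proof.
move=> H12 t0; have [C C0 HC] := @dist_pow_potential R (2 * Hu - 2) t ltac:(lra) (ltW t0).
exists C => // b mb b0; have mb' := mabs mb.
have mI' : measurable_fun setT (\1_(`[0%R, t]%classic) : R -> R) by exact: measurable_indic.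
have I0' x : 0 <= (\1_(`[0%R, t]%classic) : R -> R) x by rewrite indicE.
rewrite muleC; apply: tonelli_line_le.
- exact: (mfgK mb' mI').
- by move=> z; apply: (@fgK0 (fun x => `|b x|) \1_(`[0%R, t]%classic)).
- exact: mb'.
- by [].
- by rewrite lee_fin.
move=> x; have [xt|/negP xt] := boolP (0 <= x <= t); last first.
  rewrite b0// normr0 mul0e integral0_eq// => y _.
  by rewrite /= !mul0r.
under eq_integral do rewrite /= -mulrA.
rewrite ge0_integralrZ//; last 2 first.
- apply: measurable_funM => //.
  by apply/measurable_EFinP; exact: measurable_dist_pow.
- by move=> y; rewrite mulr_ge0 ?powR_ge0.
rewrite lee_wpmul2l ?lee_fin//.
by rewrite (integral_indicM _ (fun y => K (x, y))); exact: HC.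
Qed.

(** Either L <= e, or L <= L * L / e. *)
Let amgm_ereal (L : \bar R) (e : R) : (0 <= L)%E -> 0 < e -> (L <= e%:E + e^-1%:E * (L * L))%E.
Proof.
move: L => [r|_ e0|]//=; last by rewrite mulyy gt0_muley ?lte_fin ?invr_gt0// addey// leey.
rewrite !lee_fin => r0 e0; have [re|/ltW er] := leP r e.
  by rewrite (le_trans re)// lerDl mulr_ge0 ?mulr_ge0// invr_ge0 ltW.
rewrite (@le_trans _ _ (e^-1 * (r * r)))//; last by rewrite lerDr ltW.
by rewrite mulrA ler_peMl// mulrC ler_pdivlMr// mul1r.
Qed.

Let sq_energy (f : R -> R) := (\int[mu \x mu]_z ((f z.1 - f z.2) ^+ 2 * K z)%:E)%E.

Let msq (f : R -> R) : measurable_fun setT f ->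
  measurable_fun setT (fun z => (f z.1 - f z.2) ^+ 2 * K z).
Proof.
move=> mf; apply: measurable_funM => //; apply: measurable_funX.
by apply: measurable_funB; [exact: mfst|exact: msnd].
Qed.

Let sq_energyB (f h : R -> R) : measurable_fun setT f -> measurable_fun setT h ->
  (sq_energy (fun x => (f x - h x)%R) <= 2%:E * sq_energy f + 2%:E * sq_energy h)%E.
Proof.
move=> mf mh; have mfh : measurable_fun setT (fun x => f x - h x) by exact: measurable_funB.
have p0 (k : R -> R) z : 0 <= (k z.1 - k z.2) ^+ 2 * K z by rewrite mulr_ge0 ?sqr_ge0 ?powR_ge0.
apply: ge0_integralr_le_lin; [exact: (msq mfh)|by move=> z; exact: (p0 (fun x => f x - h x))
  |exact: (msq mf)|by move=> z; exact: (p0 f)|exact: (msq mh)|by move=> z; exact: (p0 h)|by []|by []|].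
move=> z; rewrite !mulrA -mulrDl ler_wpM2r ?powR_ge0//.
have := sqr_ge0 ((f z.1 - f z.2) + (h z.1 - h z.2)); nra.
Qed.

Let sq_integralB (f h : R -> R) : measurable_fun setT f -> measurable_fun setT h ->
  (\int[mu]_x ((f x - h x) ^+ 2)%:E <= 2%:E * \int[mu]_x (f x ^+ 2)%:E + 2%:E * \int[mu]_x (h x ^+ 2)%:E)%E.
Proof.
move=> mf mh; apply: ge0_integralr_le_lin => //.
- by apply: measurable_funX; exact: measurable_funB.
- by move=> x; exact: sqr_ge0.
- exact: measurable_funX.
- by move=> x; exact: sqr_ge0.
- exact: measurable_funX.
- by move=> x; exact: sqr_ge0.
by move=> z; have := sqr_ge0 (f z + h z); nra.
Qed.

Lemma fBm_norm2_ge0 (f : R -> R) : (0 <= fBm_norm2 Hu f)%E.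
Proof.
case/andP: hH => H0 H1; rewrite /fBm_norm2; case: ltgtP => H12.
- apply: mule_ge0; first by rewrite lee_fin divr_ge0// mulr_ge0//; lra.
  by apply: integral_ge0 => z _; rewrite lee_fin mulr_ge0 ?sqr_ge0 ?powR_ge0.
- apply: mule_ge0; first by rewrite lee_fin mulr_ge0//; lra.
  by apply: integral_ge0 => z _; rewrite lee_fin !mulr_ge0 ?powR_ge0.
- by apply: integral_ge0 => z _; rewrite lee_fin sqr_ge0.
Qed.

Let fBm_norm2_gt (f : R -> R) : 1 / 2 < Hu ->
  fBm_norm2 Hu f = ((Hu * (2 * Hu - 1))%:E * abs_energy f)%E.
Proof. by move=> H12; rewrite /fBm_norm2; case: ltgtP H12. Qed.

Let fBm_norm2B (f h : R -> R) : Hu <= 1 / 2 -> measurable_fun setT f -> measurable_fun setT h ->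
  (fBm_norm2 Hu (fun x => (f x - h x)%R) <= 2%:E * fBm_norm2 Hu f + 2%:E * fBm_norm2 Hu h)%E.
Proof.
case/andP: hH => H0 H1; rewrite /fBm_norm2; case: ltgtP => // H12 _ mf mh; last exact: sq_integralB.
have c0 : (0 <= (Hu * (1 - 2 * Hu) / 2)%:E)%E.
  by rewrite lee_fin divr_ge0// mulr_ge0//; lra.
rewrite !(muleCA 2%:E) -ge0_muleDr; last 2 first.
- by rewrite mule_ge0//; apply: integral_ge0 => z _; rewrite lee_fin mulr_ge0 ?sqr_ge0 ?powR_ge0.
- by rewrite mule_ge0//; apply: integral_ge0 => z _; rewrite lee_fin mulr_ge0 ?sqr_ge0 ?powR_ge0.
by apply: lee_wpmul2l => //; exact: sq_energyB.
Qed.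

(** The mixed terms |f| |h| are bounded by M |h| instead of being split by Cauchy-Schwarz, which
    would require the kernel to be positive definite. The price is a term linear in [h]. *)
Let abs_energyB (t M : R) (f h : R -> R) : measurable_fun setT f -> measurable_fun setT h ->
  0 <= M -> (forall x, `|f x| <= M * \1_(`[0%R, t]%classic) x) ->
  (abs_energy (fun x => (f x - h x)%R) <= abs_energy f + abs_energy h +
     (2 * M)%:E * (\int[mu \x mu]_z (`|h z.1| * \1_(`[0%R, t]%classic) z.2 * K z)%:E))%E.
Proof.
move=> mf mh M0 fM; set I := \1_(`[0%R, t]%classic) : R -> R.
have mf' := mabs mf; have mh' := mabs mh.
have mI' : measurable_fun setT I by exact: measurable_indic.
have I00 x : 0 <= I x by rewrite /I indicE.
have mfh : measurable_fun setT (fun x => `|f x - h x|) by apply: mabs; exact: measurable_funB.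
have n0 (k : R -> R) x : 0 <= `|k x| by [].
have mX1 := mfgK mh' mI'; have mX2 := mfgK mI' mh'.
have X1 z : 0 <= `|h z.1| * I z.2 * K z by exact: (@fgK0 (fun x => `|h x|) I).
have X2 z : 0 <= I z.1 * `|h z.2| * K z by exact: (@fgK0 I (fun x => `|h x|)).
have mA := mfgK mf' mf'; have mB := mfgK mh' mh'.
have A0 z : 0 <= `|f z.1| * `|f z.2| * K z by exact: (@fgK0 (fun x => `|f x|) (fun x => `|f x|)).
have B0 z : 0 <= `|h z.1| * `|h z.2| * K z by exact: (@fgK0 (fun x => `|h x|) (fun x => `|h x|)).
have swap : (\int[mu \x mu]_z (I z.1 * `|h z.2| * K z)%:E = \int[mu \x mu]_z (`|h z.1| * I z.2 * K z)%:E)%E.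
  rewrite -tonelli_line_swap; last 2 first.
  - exact/measurable_EFinP.
  - by move=> z; rewrite lee_fin.
  by apply: eq_integral => z _; rewrite /= /K/= distrC (mulrC (I z.2)).
have -> : ((2 * M)%:E * (\int[mu \x mu]_z (`|h z.1| * I z.2 * K z)%:E) =
   M%:E * (\int[mu \x mu]_z (`|h z.1| * I z.2 * K z)%:E + \int[mu \x mu]_z (I z.1 * `|h z.2| * K z)%:E))%E.
  have Y0 := ge0_integralr_ge0 (mu \x mu)%E X1; rewrite swap.
  move: Y0; case: (integral _ _ _) => [y _|_|]; last by [].
    by rewrite -EFinD -!EFinM; congr (_%:E); ring.
  (* When the mixed integral is infinite, M = 0 is treated apart because 0 times +oo is 0. *)
  rewrite addye//; have [->|Mn0] := eqVneq M 0; first by rewrite mulr0 !mul0e.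
  by rewrite !gt0_muley// lte_fin ?mulr_gt0// lt_neqAle eq_sym Mn0.
rewrite -ge0_integralrD//.
rewrite /abs_energy -ge0_integralrD// -[X in (_ <= X + _)%E]mul1e.
apply: ge0_integralr_le_lin => //.
- exact: (mfgK mfh mfh).
- by move=> z; exact: (@fgK0 (fun x => `|f x - h x|) (fun x => `|f x - h x|)).
- exact: measurable_funD.
- by move=> z; rewrite addr_ge0.
- exact: measurable_funD.
- by move=> z; rewrite addr_ge0.
move=> z; rewrite mul1r -!mulrDl mulrA -mulrDl ler_wpM2r ?powR_ge0//.
have n1 := ler_normB (f z.1) (h z.1); have n2 := ler_normB (f z.2) (h z.2).
have h1 := normr_ge0 (h z.1); have h2 := normr_ge0 (h z.2).
have : `|f z.1 - h z.1| * `|f z.2 - h z.2| <= (`|f z.1| + `|h z.1|) * (`|f z.2| + `|h z.2|).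
  by rewrite ler_pM.
have : `|f z.1| * `|h z.2| <= M * I z.1 * `|h z.2| by rewrite ler_wpM2r.
have : `|h z.1| * `|f z.2| <= M * `|h z.1| * I z.2 by rewrite (mulrC M) -mulrA ler_wpM2l.
nra.
Qed.

(** Written as g1 - (g1 - step), the step function costs twice the norm of [g1], a multiple of the
    norm of the error, and for H > 1/2 a small remainder [A * e]. The constants are uniform in the
    step function, so the error may tend to 0 before [e] does. *)
Lemma step_mass_le (t : R) (g : R -> R) (M : R) : 0 < t ->
  measurable_fun (`[0, t]%classic : set (measurableTypeR R)) g ->
  (forall x, 0 <= x <= t -> `|g x| <= M) ->
  let g1 x := g x * \1_(`[0, t]%classic) x in
  exists A B : R, [/\ 0 <= A, 0 <= B & forall s e, step_in t s -> 0 < e <= 1 ->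
   ((step_mass rho s)%:E <= 2%:E * fBm_norm2 Hu g1 + (A * e)%:E +
     (B / e)%:E * fBm_norm2 Hu (fun x => (g1 x - step_fun s x)%R))%E].
Proof.
move=> t0 /measurable_trunc mg gM g1; case/andP: hH => H0 H1.
have M0 : 0 <= M by apply: le_trans (gM 0 _); rewrite ?lexx//= ltW.
have mb s : measurable_fun setT (fun x => g1 x - step_fun s x).
  by apply: measurable_funB => //; exact: measurable_step_fun.
have [H12|H12] := leP Hu (1 / 2).
  exists 0, 2; split => // s e sin /andP[e0 e1].
  have -> : ((step_mass rho s)%:E = fBm_norm2 Hu (fun x => (g1 x - (g1 x - step_fun s x))%R))%E.
    rewrite (_ : (fun x => _) = step_fun s); last by apply/funext => x; ring.
    by move: H12; rewrite le_eqVlt => /predU1P[/step_mass_eq|/step_mass_lt] /(_ _ _ sin).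
  apply: (le_trans (fBm_norm2B H12 mg (mb s))).
  rewrite mul0r adde0 leeD2l// lee_wpmul2r ?fBm_norm2_ge0// lee_fin.
  by rewrite ler_pdivlMr// ler_piMr.
have [C C0 HC] := cross_le H12 t0.
pose c := Hu * (2 * Hu - 1); have c0 : 0 < c by rewrite mulr_gt0//; lra.
(* With b the error, the linear term 2 M C L1(b) is at most 2 M C (e + L1(b)^2 / e), and L1(b)^2 is
   at most t^(2 - 2 H) times the energy of b; multiplication by [c] gives these constants. *)
exists (2 * c * M * C), (1 + 2 * M * C * t `^ (2 - 2 * Hu)); split.
- by do 3 (apply: mulr_ge0 => //); exact: ltW.
- by rewrite addr_ge0// !mulr_ge0// powR_ge0.
move=> s e sin /andP[e0 e1]; rewrite !fBm_norm2_gt// -/c.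
pose b x := g1 x - step_fun s x; rewrite -/b.
have b0 x : ~ (0 <= x <= t) -> b x = 0.
  by move=> xt; rewrite /b (step_fun_out sin xt) /g1 indicE memNset ?mulr0 ?subrr//= in_itv.
have h1 : ((step_mass rho s)%:E <= c%:E * abs_energy (step_fun s))%E.
  have hi := step_mass_gt H12 sin.
  rewrite -(has_integral_ereal hi); apply: (le_trans (lee_abs _)).
  apply: (le_trans (le_abse_integral _ _ (measurable_int _ hi.1))) => //.
  rewrite -ge0_integralrZ; last 3 first.
  - exact: ltW.
  - exact: (mfgK (mabs (measurable_step_fun s)) (mabs (measurable_step_fun s))).
  - by move=> z; apply: (@fgK0 (fun x => `|step_fun s x|) (fun x => `|step_fun s x|)).
  rewrite le_eqVlt; apply/orP; left; apply/eqP; apply: eq_integral => z _ /=.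
  rewrite !normrM (gtr0_norm H0) (@ger0_norm _ (2 * Hu - 1)); last by lra.
  by rewrite (@ger0_norm _ (K z)) ?powR_ge0.
have h2 : (abs_energy (step_fun s) <= abs_energy g1 + abs_energy b + (2 * M)%:E * (C%:E * L1 b))%E.
  rewrite (_ : step_fun s = (fun x => g1 x - b x)); last by apply/funext => x; rewrite /b; ring.
  apply: (le_trans (@abs_energyB t M _ _ mg (mb s) M0 _)).
    move=> x; rewrite /g1 normrM indicE; case: (boolP (_ \in _)) => [|_]; last by rewrite normr0 !mulr0.
    by rewrite inE/= in_itv/= normr1 !mulr1; exact: gM.
  by rewrite leeD2l// lee_wpmul2l ?lee_fin ?mulr_ge0// HC//; exact: mb.
have h3 := amgm_ereal (L1_ge0 b) e0.
have h4 := L1_sq_le H12 t0 (mb s) b0.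
have T0 : 0 <= t `^ (2 - 2 * Hu) by exact: powR_ge0.
have ae0 (f : R -> R) : (0 <= abs_energy f)%E.
  by apply: integral_ge0 => z _; rewrite lee_fin !mulr_ge0 ?powR_ge0.
have h5 : (L1 b <= e%:E + e^-1%:E * ((t `^ (2 - 2 * Hu))%:E * abs_energy b))%E.
  by apply: (le_trans h3); rewrite leeD2l// lee_wpmul2l// lee_fin invr_ge0 ltW.
apply: (le_trans h1).
have h6 : (abs_energy (step_fun s) <= abs_energy g1 + abs_energy b + (2 * M)%:E * (C%:E *
    (e%:E + e^-1%:E * ((t `^ (2 - 2 * Hu))%:E * abs_energy b))))%E.
  apply: (le_trans h2); rewrite leeD2l// lee_wpmul2l ?lee_fin ?mulr_ge0//.
  by rewrite lee_wpmul2l.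
apply: (@le_trans _ _ (c%:E * (abs_energy g1 + abs_energy b + (2 * M)%:E * (C%:E *
    (e%:E + e^-1%:E * ((t `^ (2 - 2 * Hu))%:E * abs_energy b)))))%E).
  by rewrite lee_wpmul2l// lee_fin ltW.
have Be0 : 0 < (1 + 2 * M * C * t `^ (2 - 2 * Hu)) / e.
  by rewrite divr_gt0// ltr_pwDl// !mulr_ge0.
have := ae0 g1; have := ae0 b.
case: (abs_energy b) => [y|_|]; last by [].
- case: (abs_energy g1) => [x|y0 _|]; last by [].
  + rewrite !lee_fin => y0 x0.
    set T := t `^ _ in T0 *.
    have -> : c * (x + y + 2 * M * (C * (e + e^-1 * (T * y)))) =
       c * x + c * y + 2 * c * M * C * e + 2 * M * C * T / e * (c * y) by ring.
    have -> : 2 * (c * x) + 2 * c * M * C * e + (1 + 2 * M * C * T) / e * (c * y) =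
       c * x + c * x + c * y / e + 2 * c * M * C * e + 2 * M * C * T / e * (c * y) by field; exact: lt0r_neq0.
    have cx : 0 <= c * x by rewrite mulr_ge0// ltW.
    have cy : c * y <= c * y / e by rewrite ler_pdivlMr// ler_piMr// mulr_ge0// ltW.
    lra.
  + have -> : (2%:E * (c%:E * +oo) = +oo :> \bar R)%E by rewrite !gt0_muley ?lte_fin.
    by rewrite !addye// leey.
move=> x0; have -> : (c%:E * +oo = +oo :> \bar R)%E by rewrite gt0_muley ?lte_fin.
rewrite (gt0_muley (_ : 0 < (_ / e)%:E)%E) ?lte_fin// [leRHS]addey ?leey//.
rewrite gt_eqF// (@lt_le_trans _ _ 0%E)//; apply: adde_ge0.
  by apply: mule_ge0 => //; apply: mule_ge0 => //; rewrite lee_fin ltW.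
have e0' := ltW e0; have c0' := ltW c0.
by rewrite lee_fin; do 3 (apply: mulr_ge0 => //); exact: mulr_ge0.
Qed.

(** X = (X - S) + S with S the integral of an approximating step function: one factor 2 comes from
    this splitting, the other from [step_mass_le]. Boundedness by [M] only makes the remainder
    vanish in the limit. *)
Lemma wiener_second_moment (t : R) (g : R -> R) (M : R) (X : {RV P >-> R}) : 0 < t ->
  wiener_integral Hu W t g X -> (forall x, 0 <= x <= t -> `|g x| <= M) ->
  ('E_P[(fun w => X w ^+ 2)%R] <= 4%:E * fBm_norm2 Hu (fun x => (g x * \1_(`[0, t]%classic) x)%R))%E.
Proof.
move=> t0 [mg [s [sin ns Es]]] gM.
have [A [B [A0 B0 AB]]] := step_mass_le t0 mg gM.
set g1 := (fun x : R => _) in ns AB *.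
rewrite unlock; have := fBm_norm2_ge0 g1.
case Nn : (fBm_norm2 Hu g1) => [n| |]; last by [].
  rewrite lee_fin => n0; rewrite -EFinM.
  apply/lee_addgt0Pr => d d0.
  (* Chosen so that the remainder 2 A e is at most d, also when A = 0, and e <= 1. *)
  pose e := Num.min 1 (d / (2 * A + 1)).
  have A1 : 0 < 2 * A + 1 by rewrite ltr_wpDl// mulr_ge0.
  have e01 : 0 < e <= 1 by rewrite lt_min ltr01 divr_gt0//= ge_min lexx.
  have Ae : 2 * (A * e) <= d.
    have : e <= d / (2 * A + 1) by rewrite ge_min lexx orbT.
    rewrite ler_pdivlMr// => ed; case/andP: e01 => e0 _; nra.
  apply: (@le_trans _ _ (4 * n + 2 * (A * e))%:E); last by rewrite -EFinD lee_fin lerD2l.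
  pose dk k := ('E_P[(fun w => (X w - step_integral W (s k) w) ^+ 2)%R])%E.
  pose mk k := fBm_norm2 Hu (fun x => (g1 x - step_fun (s k) x)%R).
  have lim : ((fun k => 2%:E * dk k + (4 * n + 2 * (A * e))%:E + (2 * B / e)%:E * mk k) @ \oo -->
     2%:E * 0 + (4 * n + 2 * (A * e))%:E + (2 * B / e)%:E * 0)%E.
    rewrite !mule0 add0e; apply: cvgeD; first by rewrite fin_num_adde_defl.
    - rewrite -[X in _ --> X]add0e; apply: cvgeD; first by rewrite fin_num_adde_defl.
      + by rewrite -(mule0 2%:E); apply: cvgeZl.
      + exact: cvg_cst.
    - by rewrite -(mule0 (2 * B / e)%:E); apply: cvgeZl.
  rewrite !mule0 add0e adde0 in lim.
  rewrite -(cvg_lim _ lim)//; apply: lime_ge; first exact: (cvgP _ lim).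
  apply: nearW => k.
  have hs := fBm_step_integral (sin k).
  have mXS : measurable_fun setT (fun w => X w - step_integral W (s k) w).
    apply: measurable_funB => //; apply: measurable_sum => i; apply: measurable_funM => //.
    exact: measurable_funB.
  have mS : measurable_fun setT (fun w => step_integral W (s k) w).
    apply: measurable_sum => i; apply: measurable_funM => //.
    exact: measurable_funB.
  apply: (@le_trans _ _ (2%:E * dk k + 2%:E * (step_mass rho (s k))%:E)%E).
    rewrite -(has_integral_ereal hs) /dk unlock; apply: ge0_integralr_le_lin => //.
    - exact: measurable_funX.
    - by move=> w; exact: sqr_ge0.
    - exact: measurable_funX.
    - by move=> w; exact: sqr_ge0.
    - exact: measurable_funX.
    - by move=> w; exact: sqr_ge0.
    move=> w.
    have := sqr_ge0 (X w - 2 * step_integral W (s k) w); nra.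
  rewrite -addeA; apply: leeD2l.
  apply: (le_trans (lee_wpmul2l _ (AB (s k) e (sin k) e01))) => //.
  rewrite Nn -/(mk k); have := fBm_norm2_ge0 (fun x => (g1 x - step_fun (s k) x)%R); rewrite -/(mk k).
  case: (mk k) => [r _|_|]; last by [].
    rewrite -!(EFinM, EFinD) lee_fin le_eqVlt; apply/orP; left; apply/eqP.
    by case/andP: e01 => e0 _; field; exact: lt0r_neq0.
  (* An infinite error norm makes the right-hand side infinite, except for B = 0, where 0 times +oo
     is 0 and the remaining terms are compared. *)
  have [->|B1] := eqVneq B 0; first by rewrite !(mulr0, mul0r) !mul0e !adde0 -!(EFinM, EFinD) lee_fin; lra.
  rewrite [X in (_ <= _ + X)%E]gt0_muley ?addey ?leey// lte_fin divr_gt0//; last by case/andP: e01.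
  by rewrite mulr_gt0// lt_neqAle eq_sym B1.
by move=> _; rewrite gt0_muley ?lte_fin// leey.
Qed.

End fBm_step.

(** * The fractional norm of a singular integrand *)

Section fBm_norm_bound.
Context (R : realType).
Local Notation mu := (@lebesgue_measure R).
Implicit Types (x y p q r a t A : R).

Lemma powRD_gt0 x p q : 0 < x -> x `^ (p + q) = x `^ p * x `^ q.
Proof. by move=> x0; rewrite powRD// (gt_eqF x0) implybT. Qed.

Lemma ge0_powR_le x y p : 0 <= p -> 0 <= x -> x <= y -> x `^ p <= y `^ p.
Proof. by move=> p0 x0 xy; rewrite ge0_ler_powR ?nnegrE// (le_trans x0). Qed.

Lemma le0_powR_le x y p : p <= 0 -> 0 < x -> x <= y -> y `^ p <= x `^ p.
Proof.
move=> p0 x0 xy; rewrite -[p]opprK !(powRN _ (- p)) lef_pV2 ?posrE ?powR_gt0 ?(lt_le_trans x0)//.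
by rewrite ge0_powR_le ?oppr_ge0// ltW.
Qed.

(** With nonpositive exponents both powers are largest at the smaller of the two bases. *)
Lemma powR_mul_le x y p q : p <= 0 -> q <= 0 -> 0 < x -> 0 < y ->
  x `^ p * y `^ q <= x `^ (p + q) + y `^ (p + q).
Proof.
move=> p0 q0 x0 y0; rewrite !powRD_gt0//; have [xy|/ltW yx] := leP x y.
  by rewrite (@le_trans _ _ (x `^ p * x `^ q)) ?lerDl ?mulr_ge0 ?powR_ge0// ler_wpM2l ?powR_ge0// le0_powR_le.
by rewrite (@le_trans _ _ (y `^ p * y `^ q)) ?lerDr ?mulr_ge0 ?powR_ge0// ler_wpM2r ?powR_ge0// le0_powR_le.
Qed.

(** Interpolates between the size bound 1 and the Lipschitz bound u. *)
Lemma min1_le_powR (u g : R) : 0 < u -> 0 <= g <= 1 -> Num.min 1 u <= u `^ g.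
Proof.
move=> u0 /andP[g0 g1]; rewrite ge_min; have [u1|/ltW u1] := leP u 1.
  by rewrite ger1_powR ?u0//= orbT.
by rewrite -{1}(powRr0 u) ler_powR.
Qed.

(** For x < y, split y^(-a) = y^(H - 1) y^(1 - H - a) and replace y by x in the first factor and by
    y - x in the second. Both exponents are nonpositive, the second because H + a > 1. *)
Let gt_pointwise Hu a x y : 1 / 2 < Hu -> 1 / 2 <= a -> Hu < 1 -> 0 < x -> 0 < y ->
  x `^ (- a) * y `^ (- a) * `|x - y| `^ (2 * Hu - 2) <=
  (x `^ (Hu - 1 - a) + y `^ (Hu - 1 - a)) * `|x - y| `^ (Hu - 1 - a).
Proof.
move=> H12 a12 H1; wlog xy : x y / x <= y.
  move=> h x0 y0; have [xy|/ltW yx] := leP x y; first exact: h.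
  by rewrite (mulrC (x `^ (- a))) (distrC x y) (addrC (x `^ _)); exact: h.
move=> x0 y0; have [->|nxy] := eqVneq x y.
  by rewrite subrr normr0 powR0 ?mulr0 ?mulr_ge0 ?addr_ge0 ?powR_ge0//; apply/eqP; lra.
have xy' : 0 < y - x by rewrite subr_gt0 lt_neqAle nxy.
rewrite distrC gtr0_norm//.
apply: (@le_trans _ _ (x `^ (Hu - 1 - a) * (y - x) `^ (Hu - 1 - a))); last first.
  by rewrite ler_wpM2r ?powR_ge0// lerDl powR_ge0.
have -> : x `^ (Hu - 1 - a) * (y - x) `^ (Hu - 1 - a) =
   x `^ (- a) * (x `^ (Hu - 1) * (y - x) `^ (1 - Hu - a)) * (y - x) `^ (2 * Hu - 2).
  rewrite (_ : x `^ (Hu - 1 - a) = x `^ (- a) * x `^ (Hu - 1)); last first.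
    by rewrite -powRD_gt0//; congr (_ `^ _); ring.
  rewrite (_ : (y - x) `^ (Hu - 1 - a) = (y - x) `^ (1 - Hu - a) * (y - x) `^ (2 * Hu - 2)); last first.
    by rewrite -powRD_gt0//; congr (_ `^ _); ring.
  by ring.
rewrite ler_wpM2r ?powR_ge0// ler_wpM2l ?powR_ge0//.
have -> : y `^ (- a) = y `^ (Hu - 1) * y `^ (1 - Hu - a).
  by rewrite -powRD_gt0//; congr (_ `^ _); ring.
apply: ler_pM; rewrite ?powR_ge0//; apply: le0_powR_le => //; lra.
Qed.

(** The kernel |x - y|^(2 H - 2) is not integrable at the diagonal, so the difference has to supply
    a power of |x - y|; interpolating the size bound with the Lipschitz bound does so. *)
Let lt_pointwise Hu a A x y gx gy : 0 < Hu -> Hu < 1 / 2 -> 0 <= a < Hu -> 0 <= A ->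
  0 < x -> 0 < y -> `|gx| <= A * x `^ (- a) -> `|gy| <= A * y `^ (- a) ->
  (x < y -> `|gx - gy| <= A * (x `^ (- a) * ((y - x) / x))) ->
  (y < x -> `|gx - gy| <= A * (y `^ (- a) * ((x - y) / y))) ->
  (gx - gy) ^+ 2 * `|x - y| `^ (2 * Hu - 2) <=
  4 * A ^+ 2 * ((x `^ (Hu - 1 - a) + y `^ (Hu - 1 - a)) * `|x - y| `^ (Hu - 1 - a)).
Proof.
move=> H0 H12 /andP[a0 aH] A0; wlog xy : x y gx gy / x <= y.
  move=> h x0 y0 hx hy h1 h2; have [xy|/ltW yx] := leP x y; first exact: h.
  rewrite (distrC x y) (addrC (x `^ _)) -[(gx - gy) ^+ 2]sqrrN opprB.
  by apply: h => //; rewrite distrC.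
move=> x0 y0 hx hy + _; have [->|nxy] := eqVneq x y.
  by rewrite subrr normr0 powR0 ?mulr0 ?mulr_ge0 ?addr_ge0 ?powR_ge0 ?sqr_ge0//; apply/eqP; lra.
have xy' : 0 < y - x by rewrite subr_gt0 lt_neqAle nxy.
rewrite -subr_gt0 => /(_ xy') h1; rewrite (distrC x y) gtr0_norm//.
(* This interpolation exponent gives x and y - x the same power H - 1 - a, which is above -1 exactly
   because a < H. *)
pose g := (1 - Hu - a) / 2; pose u := (y - x) / x.
have u0 : 0 < u by rewrite divr_gt0.
have h2 : `|gx - gy| <= 2 * A * x `^ (- a) * Num.min 1 u.
  rewrite minr_pMr ?mulr_ge0 ?powR_ge0// mulr1 le_min; apply/andP; split.
    have yx : A * y `^ (- a) <= A * x `^ (- a) by rewrite ler_wpM2l// le0_powR_le// oppr_le0.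
    by have := ler_normB gx gy; lra.
  have : 0 <= A * (x `^ (- a) * u) by apply: mulr_ge0 => //; apply: mulr_ge0; [exact: powR_ge0|exact: ltW].
  by move: h1; rewrite -/u; lra.
have h3 : `|gx - gy| <= 2 * A * x `^ (- a) * u `^ g.
  apply: (le_trans h2); rewrite ler_wpM2l ?mulr_ge0 ?powR_ge0// min1_le_powR// /g.
  by apply/andP; split; lra.
rewrite -real_normK ?num_real//.
apply: (@le_trans _ _ ((2 * A * x `^ (- a) * u `^ g) ^+ 2 * (y - x) `^ (2 * Hu - 2))).
  by rewrite ler_wpM2r ?powR_ge0// lerXn2r ?nnegrE ?mulr_ge0 ?powR_ge0.
have -> : (2 * A * x `^ (- a) * u `^ g) ^+ 2 * (y - x) `^ (2 * Hu - 2) =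
   4 * A ^+ 2 * (x `^ (Hu - 1 - a) * (y - x) `^ (Hu - 1 - a)).
  have -> : x `^ (Hu - 1 - a) = (x `^ (- a)) ^+ 2 * (x^-1 `^ g) ^+ 2.
    rewrite -(powR_mulrn 2 (powR_ge0 x _)) -(powR_mulrn 2 (powR_ge0 x^-1 _)) -(powR_inv1 (ltW x0)) -!powRrM.
    by rewrite -powRD_gt0//; congr (_ `^ _); rewrite /g; field.
  have -> : (y - x) `^ (Hu - 1 - a) = ((y - x) `^ g) ^+ 2 * (y - x) `^ (2 * Hu - 2).
    rewrite -(powR_mulrn 2 (powR_ge0 (y - x) _)) -!powRrM.
    by rewrite -powRD_gt0//; congr (_ `^ _); rewrite /g; field.
  by rewrite /u powRM ?invr_ge0 ?(ltW x0) ?(ltW xy')//; ring.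
rewrite ler_wpM2l ?mulr_ge0 ?sqr_ge0// ler_wpM2r ?powR_ge0// lerDl powR_ge0//.
Qed.

Let line_bound e T : -1 < e -> 0 <= T -> exists2 C : R, 0 <= C &
  forall t c, 0 <= c <= t -> t <= T ->
  (\int[mu]_x (\1_(`[0%R, t]%classic) x * `|c - x| `^ e)%:E <= C%:E)%E.
Proof.
move=> e1 T0; have [C C0 HC] := dist_pow_potential e1 T0; exists C => // t c ct tT.
by rewrite integral_indicM; exact: HC.
Qed.

Let mdist c e : measurable_fun setT (fun x : measurableTypeR R => `|c - x| `^ e).
Proof. by apply/measurable_EFinP; exact: measurable_dist_pow. Qed.

Let mind (A : set R) : measurable A -> measurable_fun setT (\1_A : measurableTypeR R -> R).
Proof. by move=> mA; exact: measurable_indic. Qed.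

Let ae_fst c : {ae (mu \x mu)%E, forall z, z.1 != c}.
Proof.
exists ([set c] `*` setT); split.
- by apply: measurableX => //; exact: measurable_set1.
- etransitivity; first by apply: product_measure1E; [exact: measurable_set1|exact: measurableT].
  by rewrite [X in (X * _)%E](lebesgue_measure_set1 c) mul0e.
- by move=> z /= /negP; rewrite negbK => /eqP.
Qed.

Let ae_snd c : {ae (mu \x mu)%E, forall z, z.2 != c}.
Proof.
exists (setT `*` [set c]); split.
- by apply: measurableX => //; exact: measurable_set1.
- etransitivity; first by apply: product_measure1E; [exact: measurableT|exact: measurable_set1].
  by rewrite [X in (_ * X)%E](lebesgue_measure_set1 c) mule0.
- by move=> z /= /negP; rewrite negbK => /eqP.
Qed.

(* Majorant of the energy density of the pairs with exactly one point in [0, t]. *)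
Let outW (Hu a t : R) (z : measurableTypeR R * measurableTypeR R) :=
  \1_(`[0%R, t]%classic) z.1 * `|t - z.1| `^ (- (2 * a)) * \1_(~` `]0%R, t]%classic) z.2 *
  `|z.1 - z.2| `^ (2 * Hu - 2).

Let moutW Hu a t : measurable_fun setT (outW Hu a t).
Proof.
apply: measurable_funM; last exact: measurable_dist_pow2.
apply: measurable_funM.
  apply: (measurable_comp_fst (f := fun x => \1_(`[0%R, t]%classic) x * `|t - x| `^ (- (2 * a)))).
  by apply: measurable_funM; [exact: mind|exact: mdist].
by apply: measurable_comp_snd; apply: mind; exact: measurableC.
Qed.

Let outW_ge0 Hu a t z : 0 <= outW Hu a t z.
Proof. by rewrite !mulr_ge0 ?powR_ge0// indicE. Qed.

(** Integrating the outside point yields x^(2 H - 1) + (t - x)^(2 H - 1). Multiplied by (t - x)^(-2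
    a), the first power is separated by [powR_mul_le]; everything then has the exponent 2 H - 1 - 2
    a > -1 at one end of [0, t]. The end t receives two contributions, whence the factor 2. *)
Let out_bound Hu a T : 0 < Hu -> Hu < 1 / 2 -> 0 <= a < Hu -> 0 < T -> exists2 C : R, 0 <= C &
  forall t, 0 < t <= T -> (\int[mu \x mu]_z (outW Hu a t z)%:E <= C%:E)%E.
Proof.
move=> H0 H12 /andP[a0 aH] T0; pose e := 2 * Hu - 1 - 2 * a.
have e1 : -1 < e by rewrite /e; lra.
have [C C0 HC] := line_bound e1 (ltW T0).
pose k := (1 - 2 * Hu)^-1; have k0 : 0 <= k by rewrite invr_ge0; lra.
exists (k * C + k * 2 * C); first by rewrite addr_ge0// !mulr_ge0.
move=> t /andP[t0 tT].
have mW : measurable_fun setT (fun z => (outW Hu a t z)%:E).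
  by apply/measurable_EFinP; exact: moutW.
have W0 z : (0 <= (outW Hu a t z)%:E)%E by rewrite lee_fin outW_ge0.
rewrite (tonelli_line mW W0).
pose I := (\1_(`[0%R, t]%classic) : R -> R).
have I0 x : 0 <= I x by rewrite /I indicE.
have mI' : measurable_fun setT (I : measurableTypeR R -> R) by exact: mind.
pose f1 x := I x * `|0 - x| `^ e; pose f2 x := I x * `|t - x| `^ e.
have mf1 : measurable_fun setT (f1 : measurableTypeR R -> R) by apply: measurable_funM => //; exact: mdist.
have mf2 : measurable_fun setT (f2 : measurableTypeR R -> R) by apply: measurable_funM => //; exact: mdist.
have f10 x : 0 <= f1 x by rewrite mulr_ge0 ?powR_ge0.
have f20 x : 0 <= f2 x by rewrite mulr_ge0 ?powR_ge0.
apply: (@le_trans _ _ (\int[mu]_x (k * f1 x + k * 2 * f2 x)%:E)%E); last first.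
  apply: le_trans (_ : _ <= k%:E * (\int[mu]_x (f1 x)%:E) + (k * 2)%:E * (\int[mu]_x (f2 x)%:E))%E _.
    apply: ge0_integralr_le_lin => //; try exact: mulr_ge0.
    - by apply: measurable_funD; exact: measurable_funM.
    - by move=> x; rewrite addr_ge0// !mulr_ge0.
  rewrite EFinD (EFinM k C) (EFinM (k * 2) C); apply: leeD.
    by apply: lee_wpmul2l; [rewrite lee_fin|apply: HC => //; rewrite lexx ltW].
  by apply: lee_wpmul2l; [rewrite lee_fin mulr_ge0|apply: HC => //; rewrite lexx ltW].
apply: ae_ge0_le_integral.
- exact: measurableT.
- by move=> x _; apply: integral_ge0 => y _; exact: W0.
- exact: (measurable_tonelli_line mW W0).
- by move=> x _; rewrite lee_fin addr_ge0// !mulr_ge0.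
- by apply/measurable_EFinP; apply: measurable_funD; exact: measurable_funM.
apply: (@ae_line_neq _ _ 0 t) => x x0 xt _.
under eq_integral do rewrite /outW /= -mulrA.
rewrite ge0_integralrZ; last 3 first.
- by rewrite mulr_ge0 ?powR_ge0 ?indicE.
- by apply: measurable_funM; [apply: mind; exact: measurableC|exact: mdist].
- by move=> y; rewrite mulr_ge0 ?powR_ge0 ?indicE.
have [xI|xI] := boolP (0 <= x <= t); last first.
  rewrite indicE memNset ?mul0r ?mul0e ?lee_fin ?addr_ge0 ?mulr_ge0//.
  by rewrite /= in_itv/=; exact/negP.
case/andP: xI => x0' xt'; have xp : 0 < x by rewrite lt_neqAle eq_sym x0.
have tx : x < t by rewrite lt_neqAle xt.
rewrite (integral_indicM _ (fun y => `|x - y| `^ (2 * Hu - 2))) integral_dist_pow_out ?xp//; last by lra.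
have II : I x = 1 by rewrite /I indicE mem_set//= in_itv/= x0'.
rewrite -EFinM lee_fin -/(I x) /f1 /f2 II !mul1r !subr0 sub0r normrN (ger0_norm x0') gtr0_norm ?subr_gt0//.
rewrite (_ : - (2 * Hu - 2 + 1) = 1 - 2 * Hu); last by ring.
rewrite (_ : 2 * Hu - 2 + 1 = 2 * Hu - 1); last by ring.
have tx0 : 0 < t - x by rewrite subr_gt0.
rewrite -/k [X in _ * (X * k)]addrC mulrA mulrDr [X in _ <= X](_ : _ = (x `^ e + (t - x) `^ e * 2) * k); last by ring.
rewrite ler_wpM2r//.
have h1 : (t - x) `^ (- (2 * a)) * x `^ (2 * Hu - 1) <= (t - x) `^ e + x `^ e.
  rewrite (_ : e = - (2 * a) + (2 * Hu - 1)); last by rewrite /e; ring.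
  by apply: powR_mul_le => //; lra.
have h2 : (t - x) `^ (- (2 * a)) * (t - x) `^ (2 * Hu - 1) = (t - x) `^ e.
  by rewrite -powRD_gt0//; congr (_ `^ _); rewrite /e; ring.
by rewrite h2; lra.
Qed.

(** The two hypotheses on [g] are the bounds available for E_k in reversed time; the singularity
    sits at the end [t]. The constant depends on [T] alone, so the result is uniform in [t]. *)
Lemma fBm_norm2_bound (Hu a T : R) : 0 < Hu < 1 -> 0 <= a < Hu -> 0 < T ->
  exists2 C : R, 0 <= C & forall t (g : R -> R) A, 0 < t <= T ->
  measurable_fun (`[0, t]%classic : set (measurableTypeR R)) g -> 0 <= A ->
  (forall r, 0 < r <= t -> `|g (t - r)| <= A * r `^ (- a)) ->
  (forall x y, 0 < y -> y < x -> x <= t ->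
     `|g (t - x) - g (t - y)| <= A * (y `^ (- a) * ((x - y) / y))) ->
  (fBm_norm2 Hu (fun x => (g x * \1_(`[0, t]%classic) x)%R) <= (C * A ^+ 2)%:E)%E.
Proof.
move=> /andP[H0 H1] /andP[a0 aH] T0.
have gI t (g : R -> R) x : x != t -> g x * \1_(`[0, t]%classic) x != 0 -> 0 <= x /\ 0 < t - x.
  move=> xt; rewrite indicE; case: (boolP (_ \in _)); last by rewrite mulr0 eqxx.
  by rewrite inE/= in_itv/= => /andP[x0 xt'] _; split => //; rewrite subr_gt0 lt_neqAle xt.
have gI1 t (g : R -> R) x : 0 <= x -> 0 < t - x -> g x * \1_(`[0, t]%classic) x = g x.
  by move=> x0 tx; rewrite indicE mem_set ?mulr1//= in_itv/= x0/=; lra.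
have [H12|H12|H12] := ltgtP Hu (1 / 2).
(* For H < 1/2 the extension by zero jumps at the ends of [0, t], so pairs with exactly one point
   inside carry energy of their own, estimated by [outW]; pairs inside are handled by
   [lt_pointwise]. *)
- have e1 : -1 < Hu - 1 - a by lra.
  have [C1 C10 HC1] := double_potential e1 (ltW T0).
  have [C2 C20 HC2] := out_bound H0 H12 (introT andP (conj a0 aH)) T0.
  pose c := Hu * (1 - 2 * Hu) / 2; have c0 : 0 <= c by rewrite divr_ge0// mulr_ge0//; lra.
  exists (c * (4 * C1 + 2 * C2)); first by rewrite mulr_ge0// addr_ge0// mulr_ge0.
  move=> t g A tT mg A0 hA hB; rewrite /fBm_norm2 H12 -/c -mulrA (EFinM c).
  apply: lee_wpmul2l; first by rewrite lee_fin.
  case/andP: (tT) => t0 tT'.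
  have mg1 := measurable_trunc mg; set g1 := (fun x : measurableTypeR R => _) in mg1 *.
  pose I := (\1_(`[0%R, t]%classic) : R -> R).
  pose dp (z : measurableTypeR R * measurableTypeR R) := I z.1 * I z.2 *
      (((t - z.1) `^ (Hu - 1 - a) + (t - z.2) `^ (Hu - 1 - a)) * `|z.1 - z.2| `^ (Hu - 1 - a)).
  have I0 x : 0 <= I x by rewrite /I indicE.
  have mdp : measurable_fun setT dp.
    have mI' : measurable_fun setT (I : measurableTypeR R -> R) by exact: mind.
    have mt' : measurable_fun setT (fun x : measurableTypeR R => (t - x) `^ (Hu - 1 - a)).
      by apply: (measurableT_comp (measurable_powR _)); exact: measurable_funB.
    apply: measurable_funM.
      by apply: measurable_funM; [exact: (measurable_comp_fst mI')|exact: (measurable_comp_snd mI')].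
    apply: measurable_funM; last exact: measurable_dist_pow2.
    by apply: measurable_funD; [exact: (measurable_comp_fst mt')|exact: (measurable_comp_snd mt')].
  have dp0 z : 0 <= dp z by rewrite !mulr_ge0 ?addr_ge0 ?powR_ge0.
  have mW := @moutW Hu a t.
  have mW' : measurable_fun setT (fun z : measurableTypeR R * measurableTypeR R => outW Hu a t (z.2, z.1)).
    by apply: (measurableT_comp mW); exact: measurable_swap.
  have W0 := @outW_ge0 Hu a t.
  pose h z := outW Hu a t z + outW Hu a t (z.2, z.1).
  have mh : measurable_fun setT h by exact: measurable_funD.
  have h0 z : 0 <= h z by rewrite addr_ge0.
  have hE : (\int[mu \x mu]_z (h z)%:E <= (2 * C2)%:E)%E.
    rewrite ge0_integralrD// (@tonelli_line_swap _ (fun z => (outW Hu a t z)%:E)); last 2 first.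
    - exact/measurable_EFinP.
    - by move=> z; rewrite lee_fin.
    by rewrite (_ : 2 * C2 = C2 + C2); [rewrite EFinD leeD// HC2|ring].
  apply: (@le_trans _ _ ((4 * A ^+ 2)%:E * (\int[mu \x mu]_z (dp z)%:E) + (A ^+ 2)%:E * (\int[mu \x mu]_z (h z)%:E))%E); last first.
    have -> : (4 * C1 + 2 * C2) * A ^+ 2 = 4 * A ^+ 2 * C1 + A ^+ 2 * (2 * C2) by ring.
    rewrite EFinD (EFinM (4 * A ^+ 2)) (EFinM (A ^+ 2)); apply: leeD.
      by apply: lee_wpmul2l; [rewrite lee_fin mulr_ge0 ?sqr_ge0|apply: HC1; rewrite ltW].
    by apply: lee_wpmul2l; [rewrite lee_fin sqr_ge0|exact: hE].
  apply: ae_ge0_integralr_le_lin => //; try exact: sqr_ge0.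
  - apply: measurable_funM; last exact: measurable_dist_pow2.
    apply: measurable_funX; apply: measurable_funB.
      exact: (measurable_comp_fst mg1).
    exact: (measurable_comp_snd mg1).
  - by move=> z; rewrite mulr_ge0 ?sqr_ge0 ?powR_ge0.
  - by rewrite mulr_ge0 ?sqr_ge0.
  have := ae_snd t; have := ae_fst t; apply: filterS2 => -[x y] /= xt yt.
  have onein (u v : R) : u \in `[0, t] -> v \notin `[0, t] -> u != t ->
     (g1 u - g1 v) ^+ 2 * `|u - v| `^ (2 * Hu - 2) <= A ^+ 2 * outW Hu a t (u, v).
    rewrite !in_itv/= => uI vI ut; rewrite /outW /=.
    have -> : g1 v = 0 by rewrite /g1 indicE memNset ?mulr0//= in_itv/=; exact/negP.
    rewrite subr0 /g1 !indicE (@mem_set _ `[0, t]%classic u) ?in_itv//= mulr1 mul1r.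
    (* [outW] lets the second point range over the complement of []0, t]], which contains the
       complement of [[0, t]]. *)
    rewrite mem_set; last first.
      by rewrite /= in_itv/= => /andP[v0 vt]; move/negP: vI; apply; rewrite (ltW v0).
    rewrite mulr1 mulrA ler_wpM2r ?powR_ge0//.
    case/andP: uI => u0 ut'; have tu : 0 < t - u by rewrite subr_gt0 lt_neqAle ut.
    have := hA (t - u); rewrite tu/= (_ : t - (t - u) = u); last by ring.
    have tu' : t - u <= t by rewrite gerBl.
    rewrite (gtr0_norm tu) => /(_ tu') hu.
    rewrite -real_normK ?num_real//.
    apply: (@le_trans _ _ ((A * (t - u) `^ (- a)) ^+ 2)).
      by rewrite lerXn2r ?nnegrE ?mulr_ge0 ?powR_ge0.
    rewrite exprMn -(powR_mulrn 2 (powR_ge0 _ _)) -powRrM.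
    by rewrite (_ : - a * 2%:R = - (2 * a)); [|ring].
  have A20 : 0 <= A ^+ 2 by exact: sqr_ge0.
  have rhs0 : 0 <= 4 * A ^+ 2 * dp (x, y) by apply: mulr_ge0; [apply: mulr_ge0|exact: dp0].
  have r1 : 0 <= A ^+ 2 * outW Hu a t (x, y) by apply: mulr_ge0; [|exact: W0].
  have r2 : 0 <= A ^+ 2 * outW Hu a t (y, x) by apply: mulr_ge0; [|exact: W0].
  rewrite -/(g1 x) -/(g1 y).
  have [xI|xI] := boolP (x \in `[0, t]); have [yI|yI] := boolP (y \in `[0, t]).
  + apply: (@le_trans _ _ (4 * A ^+ 2 * dp (x, y))); last by rewrite lerDl; apply: mulr_ge0; [|exact: h0].
    have gx : g1 x = g x by rewrite /g1 indicE mem_set ?mulr1.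
    have gy : g1 y = g y by rewrite /g1 indicE mem_set ?mulr1.
    rewrite gx gy /dp /= /I !indicE !mem_set// !mul1r.
    move: xI yI; rewrite !in_itv/= => /andP[x0 xt'] /andP[y0 yt'].
    have tx : 0 < t - x by rewrite subr_gt0 lt_neqAle xt.
    have ty : 0 < t - y by rewrite subr_gt0 lt_neqAle yt.
    have Ex : t - (t - x) = x by ring.
    have Ey : t - (t - y) = y by ring.
    have -> : `|x - y| = `|(t - x) - (t - y)| by rewrite distrC; congr (`|_|); ring.
    apply: (@lt_pointwise Hu a A) => //.
    * by rewrite a0.
    * by have := hA (t - x); rewrite tx Ex; apply; rewrite /= gerBl.
    * by have := hA (t - y); rewrite ty Ey; apply; rewrite /= gerBl.
    * by move=> lxy; have := hB (t - y) (t - x) tx lxy; rewrite Ex Ey distrC; apply; rewrite gerBl.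
    * by move=> lxy; have := hB (t - x) (t - y) ty lxy; rewrite Ex Ey; apply; rewrite gerBl.
  + by apply: (le_trans (onein x y xI yI xt)); rewrite /h/= mulrDr addrCA lerDl addr_ge0.
  + have := onein y x yI xI yt; rewrite (distrC y x) -(sqrrN (g1 y - g1 x)) opprB => /le_trans; apply.
    by rewrite /h/= mulrDr addrA lerDr addr_ge0.
  + have -> : g1 x = 0 by rewrite /g1 indicE memNset ?mulr0//; exact/negP.
    have -> : g1 y = 0 by rewrite /g1 indicE memNset ?mulr0//; exact/negP.
    by rewrite subrr expr0n/= mul0r; apply: addr_ge0 => //; apply: mulr_ge0; [|exact: h0].
(* [gt_pointwise] needs an exponent of at least 1/2, still below H. Raising a to b costs the factor
   T^(b - a), since r^(-a) = r^(b - a) r^(-b). *)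
- pose b := Num.max a (1 / 2).
  have ab : a <= b by rewrite /b le_max lexx.
  have b12 : 1 / 2 <= b by rewrite /b le_max lexx orbT.
  have bH : b < Hu by rewrite /b gt_max aH.
  have e1 : -1 < Hu - 1 - b by lra.
  have [C1 C10 HC1] := double_potential e1 (ltW T0).
  pose c := Hu * (2 * Hu - 1); have c0 : 0 <= c by rewrite mulr_ge0//; lra.
  pose k := T `^ (b - a); have k0 : 0 <= k by exact: powR_ge0.
  exists (c * (k ^+ 2 * C1)); first by apply: mulr_ge0 => //; apply: mulr_ge0 => //; exact: sqr_ge0.
  move=> t g A tT mg A0 hA hB; case/andP: (tT) => t0 tT'.
  have -> : fBm_norm2 Hu (fun x => g x * \1_(`[0, t]%classic) x) =
      (c%:E * \int[mu \x mu]_z (`|g z.1 * \1_(`[0, t]%classic) z.1| * `|g z.2 * \1_(`[0, t]%classic) z.2| * `|z.1 - z.2| `^ (2 * Hu - 2))%:E)%E.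
    by rewrite /fBm_norm2; case: ltgtP H12.
  rewrite -mulrA (EFinM c); apply: lee_wpmul2l; first by rewrite lee_fin.
  have mg1 := measurable_trunc mg; set g1 := (fun x : measurableTypeR R => _) in mg1 *.
  pose I := (\1_(`[0%R, t]%classic) : R -> R).
  pose dp (z : measurableTypeR R * measurableTypeR R) := I z.1 * I z.2 *
      (((t - z.1) `^ (Hu - 1 - b) + (t - z.2) `^ (Hu - 1 - b)) * `|z.1 - z.2| `^ (Hu - 1 - b)).
  have I0 x : 0 <= I x by rewrite /I indicE.
  have mdp : measurable_fun setT dp.
    have mI' : measurable_fun setT (I : measurableTypeR R -> R) by exact: mind.
    have mt' : measurable_fun setT (fun x : measurableTypeR R => (t - x) `^ (Hu - 1 - b)).
      by apply: (measurableT_comp (measurable_powR _)); exact: measurable_funB.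
    apply: measurable_funM.
      by apply: measurable_funM; [exact: (measurable_comp_fst mI')|exact: (measurable_comp_snd mI')].
    apply: measurable_funM; last exact: measurable_dist_pow2.
    by apply: measurable_funD; [exact: (measurable_comp_fst mt')|exact: (measurable_comp_snd mt')].
  have dp0 z : 0 <= dp z by rewrite !mulr_ge0 ?addr_ge0 ?powR_ge0.
  have K0 : 0 <= (A * k) ^+ 2 by rewrite sqr_ge0.
  apply: (@le_trans _ _ (\int[mu \x mu]_z ((A * k) ^+ 2 * dp z)%:E)%E); last first.
    rewrite ge0_integralrZ// (_ : k ^+ 2 * C1 * A ^+ 2 = (A * k) ^+ 2 * C1); last by ring.
    by rewrite (EFinM ((A * k) ^+ 2)); apply: lee_wpmul2l; [rewrite lee_fin|apply: HC1; rewrite ltW].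
  have mag := measurable_abs_fun mg1.
  apply: ae_ge0_le_integralr.
  - apply: measurable_funM; last exact: measurable_dist_pow2.
    by apply: measurable_funM; [exact: (measurable_comp_fst mag)|exact: (measurable_comp_snd mag)].
  - by move=> z; rewrite !mulr_ge0 ?powR_ge0.
  - exact: measurable_funM.
  - by move=> z; rewrite mulr_ge0.
  have := ae_snd t; have := ae_fst t; apply: filterS2 => -[x y] /= xt yt.
  rewrite -/(g1 x) -/(g1 y); have rhs0 : 0 <= (A * k) ^+ 2 * dp (x, y) by apply: mulr_ge0; [|exact: dp0].
  have hg (u : R) : u \in `[0, t] -> u != t -> [/\ 0 < t - u, `|g1 u| <= A * k * (t - u) `^ (- b) & I u = 1].
    move=> uI; have Iu : I u = 1 by rewrite /I indicE mem_set.
    move: uI; rewrite in_itv/= => /andP[u0 ut'] ut.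
    have tu : 0 < t - u by rewrite subr_gt0 lt_neqAle ut.
    split => //; rewrite /g1 -/(I u) Iu mulr1.
    have := hA (t - u); rewrite tu/= (_ : t - (t - u) = u); last by ring.
    have tu' : t - u <= t by rewrite gerBl.
    move=> /(_ tu') /le_trans; apply; rewrite -mulrA ler_wpM2l//.
    rewrite (_ : - a = (b - a) + - b); last by ring.
    by rewrite powRD_gt0// ler_wpM2r ?powR_ge0// ge0_powR_le ?subr_ge0 ?(ltW tu) ?(le_trans tu' tT').
  have [xI|xI] := boolP (x \in `[0, t]); last first.
    have -> : g1 x = 0 by rewrite /g1 indicE memNset ?mulr0//; exact/negP.
    by rewrite normr0 !mul0r.
  have [yI|yI] := boolP (y \in `[0, t]); last first.
    have -> : g1 y = 0 by rewrite /g1 indicE memNset ?mulr0//; exact/negP.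
    by rewrite normr0 mulr0 mul0r.
  have [tx gx Ix] := hg x xI xt; have [ty gy Iy] := hg y yI yt.
  rewrite /dp/= Ix Iy !mul1r.
  have -> : `|x - y| = `|(t - x) - (t - y)| by rewrite distrC; congr (`|_|); ring.
  apply: (@le_trans _ _ ((A * k) ^+ 2 * ((t - x) `^ (- b) * (t - y) `^ (- b) * `|t - x - (t - y)| `^ (2 * Hu - 2)))); last first.
    by rewrite ler_wpM2l//; apply: gt_pointwise => //; lra.
  rewrite mulrA ler_wpM2r ?powR_ge0//.
  apply: (@le_trans _ _ ((A * k * (t - x) `^ (- b)) * (A * k * (t - y) `^ (- b)))).
    by rewrite ler_pM.
  by rewrite le_eqVlt; apply/orP; left; apply/eqP; ring.
(* For H = 1/2 the norm is that of L^2, and the square of the singularity is integrable because 2 a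
   < 1. *)
- have e1 : -1 < - (2 * a) by lra.
  have [C C0 HC] := line_bound e1 (ltW T0); exists C => // t g A tT mg A0 hA _.
  case/andP: (tT) => t0 tT'.
  have -> : fBm_norm2 Hu (fun x => g x * \1_(`[0, t]%classic) x) =
      (\int[mu]_x ((g x * \1_(`[0, t]%classic) x) ^+ 2)%:E)%E.
    by rewrite /fBm_norm2 H12 ltxx eqxx.
  have mg1 := measurable_trunc mg; set g1 := (fun x : measurableTypeR R => _) in mg1 *.
  have A20 : 0 <= A ^+ 2 by exact: sqr_ge0.
  have mf : measurable_fun setT (fun x : measurableTypeR R => \1_(`[0%R, t]%classic) x * `|t - x| `^ (- (2 * a))).
    by apply: measurable_funM; [exact: mind|exact: mdist].
  have f0 x : 0 <= (\1_(`[0%R, t]%classic) x : R) * `|t - x| `^ (- (2 * a)).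
    by rewrite mulr_ge0 ?powR_ge0// indicE.
  apply: (@le_trans _ _ (\int[mu]_x (A ^+ 2 * (\1_(`[0%R, t]%classic) x * `|t - x| `^ (- (2 * a))))%:E)%E); last first.
    rewrite ge0_integralrZ// [C * _]mulrC (EFinM (A ^+ 2)); apply: lee_wpmul2l; first by rewrite lee_fin.
    by apply: HC => //; rewrite lexx ltW.
  apply: ae_ge0_le_integralr.
  - exact: measurable_funX.
  - by move=> x; exact: sqr_ge0.
  - exact: measurable_funM.
  - by move=> x; rewrite mulr_ge0.
  apply: (@ae_line_neq _ _ t t) => x xt _; rewrite /g1 indicE; case: (boolP (_ \in _)) => [|_].
    rewrite inE/= in_itv/= mulr1 mul1r => /andP[x0 xt'].
    have tx : 0 < t - x by rewrite subr_gt0 lt_neqAle xt.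
    have := hA (t - x); rewrite tx/= (_ : t - (t - x) = x); last by ring.
    have tx' : t - x <= t by rewrite lerBlDr lerDl.
    move=> /(_ tx') hx; rewrite gtr0_norm// -real_normK ?num_real//.
    apply: (@le_trans _ _ ((A * (t - x) `^ (- a)) ^+ 2)).
      by rewrite lerXn2r ?nnegrE ?mulr_ge0 ?powR_ge0.
    rewrite exprMn -(powR_mulrn 2 (powR_ge0 _ _)) -powRrM.
    by rewrite (_ : - a * 2%:R = - (2 * a)); [|ring].
  by rewrite mulr0 mul0r mulr0 expr0n.
Qed.

End fBm_norm_bound.

(** * The kernels E_k *)

Section contour_kernel.
Context {R : realType}.
Local Open Scope complex_scope.
Implicit Types (alpha theta kappa mu t r psi phi rho : R).

Lemma cexp_imagE psi : cexp (psi *i) = cos psi +i* sin psi.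
Proof. by apply/eqP; rewrite eq_complex /cexp /= expR0 !mul0r subr0 addr0 !mul1r !eqxx. Qed.

Lemma polar_complexE r psi : r%:C * cexp (psi *i) = (r * cos psi) +i* (r * sin psi).
Proof. by rewrite cexp_imagE; apply/eqP; rewrite eq_complex /= !mul0r subr0 addr0 !eqxx. Qed.

Lemma normc_polar r psi : 0 < r -> Normc.normc (r%:C * cexp (psi *i)) = r.
Proof.
move=> r0; rewrite polar_complexE /= !exprMn -mulrDr cos2Dsin2 mulr1 sqrtr_sqr ger0_norm//.
exact: ltW.
Qed.

Lemma carg_polar r psi : 0 < r -> - pi < psi < pi -> carg (r%:C * cexp (psi *i)) = psi.
Proof.
move=> r0 /andP[p1 p2]; rewrite /carg normc_polar// polar_complexE /=.
rewrite mulrAC divff ?gt_eqF// mul1r pmulr_rge0//.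
have [p0|p0] := leP 0 psi.
  have -> : 0 <= sin psi by apply: sin_ge0_pi; rewrite p0 ltW.
  by rewrite cosK// in_itv/= p0 ltW.
have -> : (0 <= sin psi) = false.
  apply/negbTE; rewrite -ltNge -oppr_gt0 -sinN; apply: sin_gt0_pi.
  by rewrite oppr_gt0 p0/=; lra.
by rewrite -cosN cosK ?opprK// in_itv/=; lra.
Qed.

Lemma cpow_polar alpha r psi : 0 < r -> - pi < psi < pi ->
  cpow (r%:C * cexp (psi *i)) alpha = (r `^ alpha * cos (alpha * psi)) +i* (r `^ alpha * sin (alpha * psi)).
Proof.
move=> r0 hpsi; rewrite /cpow ifF; last first.
  apply/negbTE; apply/eqP => h; have := normc_polar psi r0.
  by rewrite h Normc.normc0 => /esym/eqP; rewrite gt_eqF.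
rewrite normc_polar// carg_polar// /cexp /powR gt_eqF//=.
by apply/eqP; rewrite eq_complex /= !mul0r !subr0 !addr0 !eqxx.
Qed.

(* Real and imaginary parts of w / (w + mu), for w = rho e^(i phi). *)
Definition resolvent_den mu rho phi := (rho * cos phi + mu) ^+ 2 + (rho * sin phi) ^+ 2.
Definition resolvent_re mu rho phi :=
  (rho * cos phi * (rho * cos phi + mu) + (rho * sin phi) ^+ 2) / resolvent_den mu rho phi.
Definition resolvent_im mu rho phi := mu * (rho * sin phi) / resolvent_den mu rho phi.
Definition exp_re t r psi := expR (t * (r * cos psi)) * cos (t * (r * sin psi)).
Definition exp_im t r psi := expR (t * (r * cos psi)) * sin (t * (r * sin psi)).
(** Division by 2 pi i selects the imaginary part of the contour integral. On a ray this leaves Im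
    (e^(zt) q) / r with q = z^alpha / (z^alpha + mu); on the arc the factor i of dz turns the
    imaginary part into the real part of e^(zt) q. *)
Definition ray_integrand alpha mu t psi r :=
  (exp_im t r psi * resolvent_re mu (r `^ alpha) (alpha * psi) +
   exp_re t r psi * resolvent_im mu (r `^ alpha) (alpha * psi)) / r.
Definition arc_integrand alpha mu t r psi :=
  exp_re t r psi * resolvent_re mu (r `^ alpha) (alpha * psi) -
  exp_im t r psi * resolvent_im mu (r `^ alpha) (alpha * psi).

Lemma resolvent_complexE mu rho phi : resolvent_den mu rho phi != 0 ->
  (rho * cos phi +i* (rho * sin phi)) / ((rho * cos phi +i* (rho * sin phi)) + mu%:C) =
  resolvent_re mu rho phi +i* resolvent_im mu rho phi.
Proof.
move=> h.
have w0 : (rho * cos phi +i* (rho * sin phi)) + mu%:C != 0 :> R[i].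
  apply/eqP => /eqP; rewrite eq_complex /= => /andP[/eqP h1 /eqP h2].
  move/eqP: h; apply; rewrite /resolvent_den h1; rewrite addr0 in h2; rewrite h2; ring.
apply: (mulIf w0); rewrite mulfVK//; apply/eqP; rewrite eq_complex /= !addr0.
rewrite /resolvent_re /resolvent_im; apply/andP; split; apply/eqP.
  rewrite mulrAC [X in _ - X]mulrAC -mulrBl; apply: (mulIf h); rewrite mulfVK// /resolvent_den; ring.
rewrite mulrAC [X in _ + X]mulrAC -mulrDl; apply: (mulIf h); rewrite mulfVK// /resolvent_den; ring.
Qed.

(** The factor e^(i psi) of dz combines with z^(alpha - 1) into z^alpha / r, which produces the
    bounded quotient z^alpha / (z^alpha + mu). *)
Lemma contour_integrandE alpha mu t r psi : 0 < r -> - pi < psi < pi ->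
  resolvent_den mu (r `^ alpha) (alpha * psi) != 0 ->
  let z := r%:C * cexp (psi *i) in
  cexp (t%:C * z) * cpow z (alpha - 1) / (cpow z alpha + mu%:C) * cexp (psi *i) =
  (exp_re t r psi +i* exp_im t r psi) * r^-1%:C *
  (resolvent_re mu (r `^ alpha) (alpha * psi) +i* resolvent_im mu (r `^ alpha) (alpha * psi)).
Proof.
move=> r0 hpsi hd z.
rewrite -resolvent_complexE// -cpow_polar// -/z.
have -> : cexp (t%:C * z) = exp_re t r psi +i* exp_im t r psi.
  by rewrite /z polar_complexE /cexp; apply/eqP; rewrite eq_complex /= !mul0r !subr0 !addr0 !eqxx.
have -> : cpow z alpha = cpow z (alpha - 1) * cexp (psi *i) * r%:C.
  rewrite /z !cpow_polar// cexp_imagE.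
  have -> : alpha * psi = (alpha - 1) * psi + psi by ring.
  have -> : r `^ alpha = r `^ (alpha - 1) * r.
    by rewrite -{3}(powRr1 (ltW r0)) -powRD; [congr (_ `^ _); ring|apply/implyP => _; rewrite gt_eqF].
  rewrite cosD sinD; apply/eqP; rewrite eq_complex /=; apply/andP; split; apply/eqP; ring.
have rV : r^-1%:C * r%:C = 1 :> R[i] by rewrite -rmorphM/= mulVf// gt_eqF.
set E := (_ +i* _); set c := cpow _ _; set e := cexp _; set d := (_ + mu%:C).
have -> : E * r^-1%:C * (c * e * r%:C / d) = E * c / d * e * (r^-1%:C * r%:C).
  by set a := r^-1%:C; set b := r%:C; ring.
by rewrite rV mulr1.
Qed.

Lemma Re_div_2pii (p : R) (Z : R[i]) : p != 0 ->
  complex.Re ((2%:R * p%:C * (0 +i* 1))^-1 * Z) = (2 * p)^-1 * complex.Im Z.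
Proof.
move=> p0; have -> : (2%:R * p%:C * (0 +i* 1))^-1 = 0 +i* (- (2 * p)^-1) :> R[i].
  have h : 2%:R * p%:C * (0 +i* 1) = 0 +i* (2 * p) :> R[i].
    by apply/eqP; rewrite eq_complex /=; apply/andP; split; apply/eqP; ring.
  have h0 : 0 +i* (2 * p) != 0 :> R[i].
    by rewrite eq_complex /= eqxx/= mulf_neq0// pnatr_eq0.
  rewrite h; apply: (mulfI h0); rewrite divff//; apply/eqP; rewrite eq_complex /=.
  rewrite !mul0r mulr0 addr0 eqxx andbT sub0r mulrN opprK divff//.
  by rewrite mulf_neq0// pnatr_eq0.
by case: Z => a b /=; ring.
Qed.

Lemma Ekernel_realE alpha theta kappa mu t : 0 < theta < pi -> 0 < kappa ->
  (forall r psi, 0 < r -> - theta <= psi <= theta -> resolvent_den mu (r `^ alpha) (alpha * psi) != 0) ->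
  Ekernel alpha theta kappa mu t = (2 * pi)^-1 *
   (- (\int[lebesgue_measure]_(r in `[kappa, +oo[) ray_integrand alpha mu t (- theta) r)
    + (\int[lebesgue_measure]_(psi in `[- theta, theta]) arc_integrand alpha mu t kappa psi)
    + (\int[lebesgue_measure]_(r in `[kappa, +oo[) ray_integrand alpha mu t theta r)).
Proof.
move=> /andP[th0 thpi] k0 hd; rewrite /Ekernel Re_div_2pii ?gt_eqF ?pi_gt0//; congr (_ * _).
have ray psi r : - theta <= psi <= theta -> r \in `[kappa, +oo[%classic ->
   complex.Im (let z := r%:C * cexp (psi *i) in
  cexp (t%:C * z) * cpow z (alpha - 1) / (cpow z alpha + mu%:C) * cexp (psi *i)) = ray_integrand alpha mu t psi r.
  move=> /[dup] hp /andP[p1 p2]; rewrite inE/= in_itv/= andbT => rk; have r0 : 0 < r by apply: lt_le_trans rk.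
  rewrite /= contour_integrandE//; [|lra|exact: hd].
  rewrite /ray_integrand /=; ring.
have ImD (z w : R[i]) : complex.Im (z + w) = complex.Im z + complex.Im w by case: z w => [? ?] [? ?].
have ImN (z : R[i]) : complex.Im (- z) = - complex.Im z by case: z.
rewrite /contour_integral !ImD ImN /cint; congr (- _ + _ + _); rewrite [LHS]/=.
- by apply: eq_Rintegral => r hr; apply: ray => //; lra.
- apply: eq_Rintegral => psi; rewrite inE/= in_itv/= => hpsi.
  set z := _%:C * _.
  set X := _ / _; have -> : X * ((0 +i* 1) * kappa%:C * cexp (psi *i)) = X * cexp (psi *i) * kappa%:C * (0 +i* 1).
    by ring.
  rewrite /X contour_integrandE//; [|lra|exact: hd].
  have -> : forall (E Q : R[i]), E * kappa^-1%:C * Q * kappa%:C * (0 +i* 1) = E * Q * (0 +i* 1) * (kappa^-1%:C * kappa%:C).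
    by move=> E Q; ring.
  rewrite -rmorphM/= mulVf ?gt_eqF// mulr1 /arc_integrand /=; ring.
- by apply: eq_Rintegral => r hr; apply: ray => //; lra.
Qed.

End contour_kernel.

(** * Sectorial bounds and estimates of the contour integrals *)

Section kernel_bounds.
Context {R : realType}.
Implicit Types (alpha theta kappa mu t r psi phi rho : R).
Local Notation mu1 := (@lebesgue_measure R).

Lemma cos_gtN1 phi : 0 <= phi < pi -> -1 < cos phi.
Proof.
by move=> /andP[p0 p1]; rewrite -cospi ltr_cos// in_itv/= ?pi_ge0 ?lexx// p0 ltW.
Qed.

Lemma ler_cos_abs phi phi0 : `|phi| <= phi0 -> phi0 <= pi -> cos phi0 <= cos phi.
Proof.
move=> h h0; have -> : cos phi = cos `|phi| by case: (ger0P phi) => // _; rewrite cosN.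
have := normr_ge0 phi; move: (`|phi|) h => p hp p0.
rewrite le_eqVlt; have [->|ne] := eqVneq p phi0; first by rewrite eqxx.
rewrite ltr_cos ?in_itv/=; [|lra|lra].
by rewrite lt_neqAle ne hp orbT.
Qed.

Section resolvent.
Variables (phi0 : R) (hphi0 : 0 <= phi0 < pi).
Let c := (1 + cos phi0) / 2.

Let c0 : 0 < c. Proof. by rewrite divr_gt0//; have := cos_gtN1 hphi0; lra. Qed.

(** The denominator is rho^2 + 2 rho mu cos phi + mu^2. Subtracting c (rho + mu)^2 with c = (1 + cos
    phi0) / 2 leaves (1 - c) (rho - mu)^2 + 2 rho mu (cos phi - cos phi0). *)
Lemma resolvent_den_ge mu rho phi : 0 <= mu -> 0 <= rho -> `|phi| <= phi0 ->
  c * (rho + mu) ^+ 2 <= resolvent_den mu rho phi.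
Proof.
move=> m0 r0 hphi; case/andP: hphi0 => p0 p1.
have hc := ler_cos_abs hphi (ltW p1); have c1 : c <= 1 by have := cos_le1 phi0; rewrite /c; lra.
have -> : resolvent_den mu rho phi = rho ^+ 2 + 2 * (rho * mu) * cos phi + mu ^+ 2.
  have h : sin phi ^+ 2 = 1 - cos phi ^+ 2 by exact: sin2cos2.
  by rewrite /resolvent_den [(rho * sin phi) ^+ 2]exprMn h; ring.
have h1 : 0 <= (1 - c) * (rho - mu) ^+ 2 by rewrite mulr_ge0 ?sqr_ge0 ?subr_ge0.
have h2 : 0 <= rho * mu * (cos phi - cos phi0) by rewrite !mulr_ge0// subr_ge0.
rewrite -subr_ge0; have -> : rho ^+ 2 + 2 * (rho * mu) * cos phi + mu ^+ 2 - c * (rho + mu) ^+ 2 =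
  (1 - c) * (rho - mu) ^+ 2 + 2 * (rho * mu * (cos phi - cos phi0)) by rewrite /c; field.
by rewrite addr_ge0// mulr_ge0.
Qed.

Lemma resolvent_bound mu rho phi : 0 < mu -> 0 < rho -> `|phi| <= phi0 ->
  `|resolvent_re mu rho phi| <= c^-1 * (rho / (rho + mu)) /\
  `|resolvent_im mu rho phi| <= c^-1 * (rho / (rho + mu)).
Proof.
move=> m0 r0 hphi; have := resolvent_den_ge (ltW m0) (ltW r0) hphi.
have d0 : 0 < rho + mu by exact: addr_gt0.
have cd0 : 0 < c * (rho + mu) ^+ 2 by rewrite mulr_gt0// exprn_gt0.
move=> hd; have den0 := lt_le_trans cd0 hd.
have key N : `|N| <= rho * (rho + mu) -> `|N / resolvent_den mu rho phi| <= c^-1 * (rho / (rho + mu)).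
  move=> hN; rewrite normrM normfV (gtr0_norm den0) ler_pdivrMr//.
  apply: (le_trans hN); have -> : rho * (rho + mu) = c^-1 * (rho / (rho + mu)) * (c * (rho + mu) ^+ 2).
    by field; rewrite !gt_eqF.
  by rewrite ler_wpM2l// mulr_ge0 ?invr_ge0 ?divr_ge0 ?(ltW c0) ?(ltW r0) ?(ltW d0).
split; apply: key.
- have -> : rho * cos phi * (rho * cos phi + mu) + (rho * sin phi) ^+ 2 = rho * (rho + mu * cos phi).
    by have h : sin phi ^+ 2 = 1 - cos phi ^+ 2 := sin2cos2 phi; rewrite [(rho * sin phi) ^+ 2]exprMn h; ring.
  rewrite normrM (gtr0_norm r0) ler_wpM2l ?(ltW r0)//.
  apply: (le_trans (ler_normD _ _)); rewrite (gtr0_norm r0) lerD2l normrM (gtr0_norm m0).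
  by rewrite -[leRHS]mulr1 ler_wpM2l ?cos_max ?ltW.
- rewrite !normrM (gtr0_norm m0) (gtr0_norm r0) mulrCA ler_wpM2l ?(ltW r0)//.
  apply: (@le_trans _ _ mu); last by rewrite lerDr ltW.
  by rewrite -[leRHS]mulr1 ler_wpM2l ?sin_max ?ltW.
Qed.

(** The numerator of the imaginary part contains only mu rho, so unlike the real part it decays as
    rho tends to infinity as well as at 0. *)
Lemma resolvent_im_bound mu rho phi : 0 < mu -> 0 < rho -> `|phi| <= phi0 ->
  `|resolvent_im mu rho phi| <= c^-1 * (mu * rho / (rho + mu) ^+ 2).
Proof.
move=> m0 r0 hphi; have := resolvent_den_ge (ltW m0) (ltW r0) hphi.
have d0 : 0 < rho + mu by exact: addr_gt0.
have cd0 : 0 < c * (rho + mu) ^+ 2 by rewrite mulr_gt0// exprn_gt0.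
move=> hd; have den0 := lt_le_trans cd0 hd.
rewrite normrM normfV (gtr0_norm den0) ler_pdivrMr//.
apply: (@le_trans _ _ (mu * rho)).
  rewrite !normrM (gtr0_norm m0) (gtr0_norm r0) mulrCA [mu * rho]mulrC ler_wpM2l ?(ltW r0)//.
  by rewrite -[leRHS]mulr1 ler_wpM2l ?sin_max ?ltW.
rewrite [leLHS](_ : _ = c^-1 * (mu * rho / (rho + mu) ^+ 2) * (c * (rho + mu) ^+ 2)); last by field; rewrite !gt_eqF.
rewrite ler_wpM2l// mulr_ge0 ?invr_ge0 ?(ltW c0)// divr_ge0 ?sqr_ge0//.
by rewrite mulr_ge0 ?(ltW m0) ?(ltW r0).
Qed.

End resolvent.

(** By the mean value theorem. [B] bounds the exponential between [y] and [x]; on the rays the value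
    at [y] serves, so the exponential decay is kept. *)
Lemma exp_trig_lip (p q x y B : R) : y <= x -> (forall s, y <= s <= x -> expR (s * p) <= B) ->
  `|expR (x * p) * cos (x * q) - expR (y * p) * cos (y * q)| <= (`|p| + `|q|) * B * (x - y) /\
  `|expR (x * p) * sin (x * q) - expR (y * p) * sin (y * q)| <= (`|p| + `|q|) * B * (x - y).
Proof.
move=> yx hB.
have key (f df : R -> R) : (forall s : R, is_derive s 1 f (df s)) ->
   (forall s, `|df s| <= (`|p| + `|q|) * expR (s * p)) ->
   `|f x - f y| <= (`|p| + `|q|) * B * (x - y).
  move=> dfE hdf; have [|s sI ->] := MVT_segment yx (fun s _ => dfE s).
    apply: derivable_within_continuous => s _; exact: (@ex_derive _ _ _ _ _ _ _ (dfE s)).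
  rewrite normrM [`|x - y|]ger0_norm ?subr_ge0// ler_wpM2r ?subr_ge0//.
  apply: (le_trans (hdf s)); rewrite ler_wpM2l ?addr_ge0//; apply: hB.
  by move: sI; rewrite in_itv.
split.
- apply: (key (fun s => expR (s * p) * cos (s * q)) (fun s => expR (s * p) * (p * cos (s * q) - q * sin (s * q)))).
    move=> s; apply: is_derive_eq; rewrite /GRing.scale/=; ring.
  move=> s; rewrite normrM gtr0_norm ?expR_gt0// mulrC ler_wpM2r ?expR_ge0//.
  apply: (le_trans (ler_normB _ _)); rewrite !normrM.
  by apply: lerD; rewrite -[leRHS]mulr1 ler_wpM2l ?cos_max ?sin_max.
- apply: (key (fun s => expR (s * p) * sin (s * q)) (fun s => expR (s * p) * (p * sin (s * q) + q * cos (s * q)))).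
    move=> s; apply: is_derive_eq; rewrite /GRing.scale/=; ring.
  move=> s; rewrite normrM gtr0_norm ?expR_gt0// mulrC ler_wpM2r ?expR_ge0//.
  apply: (le_trans (ler_normD _ _)); rewrite !normrM.
  by apply: lerD; rewrite -[leRHS]mulr1 ler_wpM2l ?cos_max ?sin_max.
Qed.

(** The square of e^(x/2) >= x / 2. Quadratic decay suffices, the powers integrated against it
    having exponent a - 1 < 1. *)
Lemma expRN_le (x : R) : 0 < x -> expR (- x) <= 4 / x ^+ 2.
Proof.
move=> x0; have h : x / 2 <= expR (x / 2) by have := expR_ge1Dx (x / 2); lra.
rewrite expRN -[4 / _]invrK; rewrite ler_pV2; last 2 first.
- by rewrite inE/= unitfE gt_eqF expR_gt0.
- by rewrite inE/= unitfE gt_eqF ?invr_gt0 ?divr_gt0 ?exprn_gt0.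
rewrite invf_div; have -> : x = x / 2 + x / 2 by lra.
rewrite expRD; have -> : (x / 2 + x / 2) ^+ 2 / 4 = x / 2 * (x / 2) by field.
by apply: ler_pM => //; lra.
Qed.

(** Extending the ray down to 0 and cutting at a scale [m] leaves one power majorant on each side
    and a bound free of [kappa]. *)
Lemma ge0_integral_ray_split (f g h : measurableTypeR R -> R) (kappa m A B : R) : 0 < kappa ->
  measurable_fun setT f -> measurable_fun setT g -> measurable_fun setT h ->
  (forall r, 0 <= f r) -> (forall r, 0 <= h r) ->
  (forall r, 0 < r -> r <= m -> f r <= g r) -> (forall r, 0 < r -> m < r -> f r <= h r) ->
  (\int[mu1]_(r in `]0%R, m]) (g r)%:E <= A%:E)%E -> (\int[mu1]_(r in `[m, +oo[) (h r)%:E <= B%:E)%E ->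
  0 <= m -> (\int[mu1]_(r in `[kappa, +oo[) (f r)%:E <= (A + B)%:E)%E.
Proof.
move=> k0 mf mg mh f0 h0 fg fh gA hB m0.
have mE D (k : measurableTypeR R -> R) : measurable_fun setT k -> measurable_fun D (EFin \o k).
  by move=> mk; apply/measurable_EFinP; exact: measurable_funTS.
pose U : set (measurableTypeR R) := `]0, m]%classic `|` `]m, +oo[%classic.
apply: (@le_trans _ _ (\int[mu1]_(r in U) (f r)%:E)%E).
  apply: ge0_subset_integral => //; [exact: measurableU|exact: mE|by move=> r _; rewrite lee_fin|].
  move=> r; rewrite /U /= !in_itv/= !andbT => kr; have r0 : 0 < r by apply: lt_le_trans kr.
  by have [rt|rt] := leP r m; [left; rewrite r0|right].
rewrite /U ge0_integral_setU//; last 3 first.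
- exact: mE.
- by move=> r _; rewrite lee_fin.
- by apply/disj_setPS => r [/=]; rewrite !in_itv/= andbT => /andP[_]; rewrite leNgt => /negP.
rewrite EFinD; apply: leeD.
  apply: le_trans gA; apply: ge0_le_integral => //; try exact: mE.
  - by move=> r _; rewrite lee_fin.
  - by move=> r /=; rewrite in_itv/= lee_fin => /andP[r0 rm]; exact: fg.
apply: (@le_trans _ _ (integral mu1 (`]m, +oo[%classic : set (measurableTypeR R)) (fun r => (h r)%:E))).
  apply: ge0_le_integral => //; try exact: mE.
  - by move=> r _; rewrite lee_fin.
  - by move=> r /=; rewrite in_itv/= andbT lee_fin => mr; apply: fh => //; exact: le_lt_trans mr.
apply: le_trans hB; apply: ge0_subset_integral => //; [exact: mE|by move=> r _; rewrite lee_fin|].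
by move=> r /=; rewrite !in_itv/= !andbT => /ltW.
Qed.

Lemma exp_pow_integral (c a kappa : R) : 0 < c -> 0 < a < 2 -> 0 < kappa ->
  exists2 C : R, 0 <= C & forall t, 0 < t ->
    (\int[mu1]_(r in `[kappa, +oo[) (expR (- (c * t * r)) * r `^ (a - 1))%:E <= (C * t `^ (- a))%:E)%E.
Proof.
move=> c0 /andP[a0 a2] k0.
exists (a^-1 + 4 / c ^+ 2 / (2 - a)) => [|t t0].
  by apply: addr_ge0; [rewrite invr_ge0 ltW|rewrite !divr_ge0 ?sqr_ge0//; lra].
have t1 : 0 < t^-1 by rewrite invr_gt0.
have tE e : t^-1 `^ e = t `^ (- e) by rewrite -(powR_inv1 (ltW t0)) -powRrM mulN1r.
have mp e : measurable_fun setT (fun r : measurableTypeR R => r `^ e) by exact: measurable_powR.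
have cst0 : 0 <= 4 / c ^+ 2 / t ^+ 2 by rewrite !divr_ge0 ?sqr_ge0.
rewrite [X in (_ <= X%:E)%E](_ : _ = t `^ (- a) / a + 4 / c ^+ 2 / (2 - a) * t `^ (- a)); last by ring.
apply: (@ge0_integral_ray_split _ (fun r => r `^ (a - 1)) (fun r => (4 / c ^+ 2 / t ^+ 2) * r `^ (a - 3)) _ t^-1) => //.
- apply: measurable_funM => //; apply: (measurableT_comp (@measurable_expR R)).
  apply: (@measurable_funN _ _ _ _ (fun r : measurableTypeR R => c * t * r)).
  by apply: measurable_funM; [exact: measurable_cst|exact: measurable_id].
- by apply: measurable_funM.
- by move=> r; rewrite mulr_ge0 ?expR_ge0 ?powR_ge0.
- by move=> r; rewrite mulr_ge0 ?powR_ge0.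
- move=> r r0 _; rewrite -[leRHS]mul1r ler_wpM2r ?powR_ge0//.
  by rewrite -expR0 ler_expR oppr_le0 !mulr_ge0// ltW.
- move=> r r0 _; rewrite (_ : a - 1 = (a - 3) + 2%:R); last by ring.
  rewrite powRD_gt0// powR_mulrn ?(ltW r0)// [X in _ <= X]mulrC mulrCA ler_wpM2l ?powR_ge0//.
  have z0 : 0 < c * t * r by rewrite !mulr_gt0.
  have := expRN_le z0; move: (expR _) => X hX.
  apply: (@le_trans _ _ (4 / (c * t * r) ^+ 2 * r ^+ 2)); first by rewrite ler_wpM2r ?sqr_ge0.
  rewrite le_eqVlt; apply/orP; left; apply/eqP; field.
  by rewrite !gt_eqF.
- rewrite integral_pow_seg; [|lra|exact: ltW].
  by rewrite subrK tE.
- under eq_integral do rewrite EFinM.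
  rewrite ge0_integralZl_EFin//; last 2 first.
  + by move=> r _; rewrite lee_fin powR_ge0.
  + by apply/measurable_EFinP; exact: measurable_funTS.
  rewrite integral_pow_infty//; last by lra.
  rewrite -EFinM lee_fin le_eqVlt; apply/orP; left; apply/eqP.
  have -> : t^-1 `^ (a - 3 + 1) = t `^ (- a) * t ^+ 2.
    rewrite tE (_ : - (a - 3 + 1) = - a + 2%:R); last by ring.
    by rewrite powRD_gt0// powR_mulrn ?ltW.
  have a20 : 2 - a != 0 by rewrite gt_eqF// subr_gt0.
  have -> : - (a - 3 + 1) = 2 - a by ring.
  by field; rewrite a20 !gt_eqF.
- exact: ltW.
Qed.

Lemma measurable_invr D0 (f : measurableTypeR R -> R) : measurable_fun D0 f -> (forall x, 0 <= f x) ->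
  measurable_fun D0 (fun x => (f x)^-1).
Proof.
move=> mf f0; have -> : (fun x => (f x)^-1) = (fun x => f x `^ (-1)).
  by apply/funext => x; rewrite powR_inv1.
exact: measurableT_comp (measurable_powR _) mf.
Qed.

Lemma measurable_resolvent_sq alpha mu : measurable_fun setT
  (fun r : measurableTypeR R => mu * r `^ (alpha - 1) / (r `^ alpha + mu) ^+ 2).
Proof.
have mp e : measurable_fun setT (fun r : measurableTypeR R => r `^ e) by exact: measurable_powR.
apply: measurable_funM; first exact: measurable_funM.
apply: measurable_invr; last by move=> r; exact: sqr_ge0.
by apply: measurable_funX; exact: measurable_funD.
Qed.

(** Cutting where r^alpha = mu makes the contribution of each side at most 1 / alpha, so the bound
    is uniform in [mu]. *)
Lemma resolvent_sq_integral alpha mu kappa : 0 < alpha -> 0 < mu -> 0 < kappa ->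
  (\int[mu1]_(r in `[kappa, +oo[) (mu * r `^ (alpha - 1) / (r `^ alpha + mu) ^+ 2)%:E <=
   (2 / alpha)%:E)%E.
Proof.
move=> a0 m0 k0; pose m := mu `^ alpha^-1; have mp0 : 0 < m by exact: powR_gt0.
have mE : m `^ alpha = mu by rewrite -powRrM mulVf ?gt_eqF// powRr1// ltW.
have mp e : measurable_fun setT (fun r : measurableTypeR R => r `^ e) by exact: measurable_powR.
rewrite [X in (_ <= X%:E)%E](_ : _ = alpha^-1 + alpha^-1); last by field; rewrite gt_eqF.
apply: (@ge0_integral_ray_split _ (fun r => mu^-1 * r `^ (alpha - 1)) (fun r => mu * r `^ (- alpha - 1)) _ m) => //.
- exact: measurable_resolvent_sq.
- exact: measurable_funM.
- exact: measurable_funM.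
- by move=> r; rewrite divr_ge0 ?sqr_ge0 ?mulr_ge0 ?powR_ge0 ?(ltW m0).
- by move=> r; rewrite mulr_ge0 ?powR_ge0 ?(ltW m0).
- move=> r r0 _; rewrite mulrAC ler_wpM2r ?powR_ge0// ler_pdivrMr ?exprn_gt0 ?addr_gt0 ?powR_gt0//.
  rewrite [leLHS](_ : mu = mu^-1 * mu ^+ 2); last by field; rewrite gt_eqF.
  rewrite ler_wpM2l ?invr_ge0 ?(ltW m0)//.
  by rewrite lerXn2r ?nnegrE ?addr_ge0 ?powR_ge0 ?(ltW m0)// lerDr powR_ge0.
- move=> r r0 _; rewrite -mulrA ler_wpM2l ?(ltW m0)// ler_pdivrMr ?exprn_gt0 ?addr_gt0 ?powR_gt0//.
  rewrite (_ : alpha - 1 = (- alpha - 1) + alpha * 2%:R); last by ring.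
  rewrite powRD_gt0// ler_wpM2l ?powR_ge0// powRrM powR_mulrn ?powR_ge0//.
  by rewrite lerXn2r ?nnegrE ?addr_ge0 ?powR_ge0 ?(ltW m0)// lerDl ltW.
- under eq_integral do rewrite EFinM.
  rewrite ge0_integralZl_EFin ?invr_ge0 ?(ltW m0)//; last 2 first.
  + by move=> r _; rewrite lee_fin powR_ge0.
  + by apply/measurable_EFinP; exact: measurable_funTS.
  rewrite integral_pow_seg ?(ltW mp0)//; last by lra.
  by rewrite subrK mE -EFinM lee_fin mulrA mulVf ?gt_eqF// mul1r.
- under eq_integral do rewrite EFinM.
  rewrite ge0_integralZl_EFin ?(ltW m0)//; last 2 first.
  + by move=> r _; rewrite lee_fin powR_ge0.
  + by apply/measurable_EFinP; exact: measurable_funTS.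
  rewrite integral_pow_infty//; last by lra.
  by rewrite subrK powRN mE -EFinM lee_fin opprK mulrA divff ?gt_eqF// mul1r.
- exact: ltW.
Qed.

Lemma Rintegral_bound (D : set (measurableTypeR R)) (f g : measurableTypeR R -> R) B :
  measurable D -> measurable_fun D f -> measurable_fun D g ->
  (forall x, D x -> `|f x| <= g x) -> (\int[mu1]_(x in D) (g x)%:E <= B%:E)%E ->
  mu1.-integrable D (EFin \o f) /\ `|\int[mu1]_(x in D) f x| <= B.
Proof.
move=> mD mf mg fg gB.
have fB : (\int[mu1]_(x in D) `|(f x)%:E| <= B%:E)%E.
  apply: le_trans gB; apply: ge0_le_integral => //.
  - by apply/measurable_EFinP; apply: measurableT_comp.
  - exact/measurable_EFinP.
have intf : mu1.-integrable D (EFin \o f).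
  by apply/integrableP; split; [exact/measurable_EFinP|exact: (le_lt_trans fB (ltry _))].
split => //; rewrite -lee_fin EFin_normr_Rintegral//; apply: le_trans fB.
exact: (le_abse_integral _ mD (integrableP _ _ _ intf).1).
Qed.

Lemma Rintegral_lip (D : set (measurableTypeR R)) (f1 f2 g : measurableTypeR R -> R) B :
  measurable D -> mu1.-integrable D (EFin \o f1) -> mu1.-integrable D (EFin \o f2) ->
  measurable_fun D g -> (forall x, D x -> `|f1 x - f2 x| <= g x) ->
  (\int[mu1]_(x in D) (g x)%:E <= B%:E)%E ->
  `|\int[mu1]_(x in D) f1 x - \int[mu1]_(x in D) f2 x| <= B.
Proof.
move=> mD i1 i2 mg fg gB; rewrite -RintegralB//.
have mf : measurable_fun D (fun x => f1 x - f2 x).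
  by apply: measurable_funB; apply/measurable_EFinP; [exact: measurable_int i1|exact: measurable_int i2].
by have [] := Rintegral_bound mD mf mg fg gB.
Qed.

Lemma ge0_integral_lincomb_le (D : set (measurableTypeR R)) (g h : measurableTypeR R -> R) p q A B :
  measurable D -> measurable_fun D g -> measurable_fun D h ->
  (forall x, D x -> 0 <= g x) -> (forall x, D x -> 0 <= h x) -> 0 <= p -> 0 <= q ->
  (\int[mu1]_(x in D) (g x)%:E <= A%:E)%E -> (\int[mu1]_(x in D) (h x)%:E <= B%:E)%E ->
  (\int[mu1]_(x in D) (p * g x + q * h x)%:E <= (p * A + q * B)%:E)%E.
Proof.
move=> mD mg mh g0 h0 p0 q0 gA hB; under eq_integral do rewrite EFinD 2!EFinM.
have mpg : measurable_fun D (fun x => (p%:E * (g x)%:E)%E).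
  by apply/measurable_EFinP; exact: measurable_funM.
have mqh : measurable_fun D (fun x => (q%:E * (h x)%:E)%E).
  by apply/measurable_EFinP; exact: measurable_funM.
rewrite ge0_integralD//.
- rewrite !ge0_integralZl_EFin//; try (by move=> x Dx; rewrite lee_fin ?g0 ?h0); try exact/measurable_EFinP.
  by rewrite EFinD (EFinM p) (EFinM q); apply: leeD; apply: lee_wpmul2l; rewrite ?lee_fin.
- by move=> x Dx; rewrite lee_fin mulr_ge0// g0.
- by move=> x Dx; rewrite lee_fin mulr_ge0// h0.
Qed.

Lemma resolvent_den_ge0 mu rho phi : 0 <= resolvent_den mu rho phi.
Proof. by rewrite addr_ge0// sqr_ge0. Qed.

Section measurability.
Variables (D0 : set (measurableTypeR R)) (rho phi r psi : measurableTypeR R -> R).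
Variables (mrho : measurable_fun D0 rho) (mphi : measurable_fun D0 phi).
Variables (mr : measurable_fun D0 r) (mpsi : measurable_fun D0 psi).

Let mcos (g : measurableTypeR R -> R) : measurable_fun D0 g -> measurable_fun D0 (fun x => cos (g x)).
Proof. by move=> mg; apply: (measurableT_comp _ mg); apply: continuous_measurable_fun; exact: continuous_cos. Qed.

Let msin (g : measurableTypeR R -> R) : measurable_fun D0 g -> measurable_fun D0 (fun x => sin (g x)).
Proof. by move=> mg; apply: (measurableT_comp _ mg); apply: continuous_measurable_fun; exact: continuous_sin. Qed.

Let mA : measurable_fun D0 (fun x => rho x * cos (phi x)).
Proof. by apply: measurable_funM => //; exact: mcos. Qed.

Let mB : measurable_fun D0 (fun x => rho x * sin (phi x)).
Proof. by apply: measurable_funM => //; exact: msin. Qed.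

Let mden mu : measurable_fun D0 (fun x => (resolvent_den mu (rho x) (phi x))^-1).
Proof.
apply: measurable_invr; last by move=> x; exact: resolvent_den_ge0.
by apply: measurable_funD; apply: measurable_funX => //; exact: measurable_funD.
Qed.

Lemma measurable_resolvent mu :
  measurable_fun D0 (fun x => resolvent_re mu (rho x) (phi x)) /\
  measurable_fun D0 (fun x => resolvent_im mu (rho x) (phi x)).
Proof.
split; (apply: measurable_funM; last exact: mden).
  by apply: measurable_funD; [apply: measurable_funM => //; exact: measurable_funD|exact: measurable_funX].
exact: measurable_funM.
Qed.

Lemma measurable_exp_trig t :
  measurable_fun D0 (fun x => exp_re t (r x) (psi x)) /\
  measurable_fun D0 (fun x => exp_im t (r x) (psi x)).
Proof.
have m1 : measurable_fun D0 (fun x => t * (r x * cos (psi x))).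
  by apply: measurable_funM => //; apply: measurable_funM => //; exact: mcos.
have m2 : measurable_fun D0 (fun x => t * (r x * sin (psi x))).
  by apply: measurable_funM => //; apply: measurable_funM => //; exact: msin.
have m3 : measurable_fun D0 (fun x => expR (t * (r x * cos (psi x)))).
  exact: measurableT_comp (@measurable_expR R) m1.
by split; apply: measurable_funM => //; [exact: mcos|exact: msin].
Qed.

End measurability.

Lemma measurable_ray_integrand (D0 : set (measurableTypeR R)) alpha mu t psi : D0 `<=` `[0, +oo[ ->
  measurable_fun D0 (ray_integrand alpha mu t psi : measurableTypeR R -> R).
Proof.
move=> D0p.
have mid : measurable_fun D0 (fun r : measurableTypeR R => r) by exact: measurable_id.
have mp : measurable_fun D0 (fun r : measurableTypeR R => r `^ alpha).
  by apply: measurable_funTS; exact: measurable_powR.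
have mc c : measurable_fun D0 (fun r : measurableTypeR R => c : R) by exact: measurable_cst.
have [m1 m2] := measurable_resolvent mp (mc (alpha * psi)) mu.
have [m3 m4] := measurable_exp_trig mid (mc psi) t.
apply: (eq_measurable_fun (fun r : measurableTypeR R => (exp_im t r psi * resolvent_re mu (r `^ alpha) (alpha * psi) +
   exp_re t r psi * resolvent_im mu (r `^ alpha) (alpha * psi)) * r `^ (-1))).
  move=> r; rewrite inE => /D0p; rewrite /= in_itv/= andbT => r0.
  by rewrite /ray_integrand powR_inv1.
apply: measurable_funM; last by apply: measurable_funTS; exact: measurable_powR.
by apply: measurable_funD; apply: measurable_funM.
Qed.

Lemma measurable_arc_integrand (D0 : set (measurableTypeR R)) alpha mu t r :
  measurable_fun D0 (arc_integrand alpha mu t r : measurableTypeR R -> R).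
Proof.
have mid : measurable_fun D0 (fun r : measurableTypeR R => r) by exact: measurable_id.
have mp : measurable_fun D0 (fun psi : measurableTypeR R => alpha * psi) by exact: measurable_funM.
have mc c : measurable_fun D0 (fun r : measurableTypeR R => c : R) by exact: measurable_cst.
have [m1 m2] := measurable_resolvent (mc (r `^ alpha)) mp mu.
have [m3 m4] := measurable_exp_trig (mc r) mid t.
by apply: measurable_funB; apply: measurable_funM.
Qed.

(** The quotient q lies in ]0, 1], hence q <= q^b, and dropping [rho] from its denominator only
    increases it. *)
Lemma resolvent_powR (mu rho b : R) : 0 < mu -> 0 < rho -> 0 <= b <= 1 ->
  rho / (rho + mu) <= (mu `^ b)^-1 * rho `^ b.
Proof.
move=> m0 r0 /andP[b0 b1]; have d0 : 0 < rho + mu by exact: addr_gt0.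
set q := rho / (rho + mu); have q0 : 0 < q by rewrite divr_gt0.
have q1 : q <= 1 by rewrite ler_pdivrMr// mul1r lerDl ltW.
apply: (@le_trans _ _ (q `^ b)).
  rewrite -{1}(powRr1 (ltW q0)); have -> : 1 = b + (1 - b) by ring.
  rewrite powRD; last by apply/implyP => _; rewrite gt_eqF.
  rewrite -[leRHS]mulr1 ler_wpM2l ?powR_ge0//.
  have := @ge0_powR_le _ q 1 (1 - b); rewrite powR1; apply => //; rewrite ?subr_ge0 ?(ltW q0)//.
have -> : (mu `^ b)^-1 = mu^-1 `^ b by rewrite -powRN -(powR_inv1 (ltW m0)) -powRrM mulN1r.
rewrite mulrC.
rewrite -powRM ?invr_ge0 ?(ltW m0) ?(ltW r0)//.
apply: ge0_ler_powR => //; rewrite ?nnegrE ?mulr_ge0 ?invr_ge0 ?(ltW q0) ?(ltW m0) ?(ltW r0) ?(ltW d0)//.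
by rewrite /q ler_pM2l// lef_pV2 ?posrE// lerDr ltW.
Qed.

Section bounds.
Variables (alpha theta kappa : R).
Hypotheses (halpha : 0 < alpha < 1) (htheta : pi / 2 < theta < pi) (hkappa : 0 < kappa).
Let phi0 := alpha * theta.
Let c := (1 + cos phi0) / 2.
Let d := - cos theta.

Let a0 : 0 < alpha. Proof. by case/andP: halpha. Qed.
Let th0 : 0 < theta. Proof. by case/andP: htheta => h _; apply: le_lt_trans h; rewrite divr_ge0 ?pi_ge0. Qed.
Let thpi : theta < pi. Proof. by case/andP: htheta. Qed.

Let hphi0 : 0 <= phi0 < pi.
Proof.
rewrite mulr_ge0 ?(ltW a0) ?(ltW th0)//=; case/andP: halpha => _ a1.
by apply: le_lt_trans thpi; rewrite ler_piMl ?(ltW th0) ?(ltW a1).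
Qed.

Let c0 : 0 < c. Proof. by rewrite divr_gt0//; have := cos_gtN1 hphi0; rewrite -/phi0; lra. Qed.

Let d0 : 0 < d.
Proof.
rewrite /d oppr_gt0 -(@cos_pihalf R); case/andP: htheta => h1 h2.
by rewrite ltr_cos// in_itv/= ?(ltW th0) ?(ltW h2) ?divr_ge0 ?pi_ge0// ler_pdivrMr// ler_peMr ?pi_ge0// ler1n.
Qed.

Let hpsi psi : - theta <= psi <= theta -> `|alpha * psi| <= phi0.
Proof. by move=> h; rewrite normrM (gtr0_norm a0) ler_wpM2l ?(ltW a0)// ler_norml. Qed.

Let den_neq0 mu : 0 < mu -> forall r psi, 0 < r -> - theta <= psi <= theta ->
  resolvent_den mu (r `^ alpha) (alpha * psi) != 0.
Proof.
move=> m0 r psi r0 /hpsi h; rewrite gt_eqF//.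
apply: lt_le_trans (resolvent_den_ge hphi0 (ltW m0) (powR_ge0 _ _) h).
by rewrite mulr_gt0// exprn_gt0// addr_gt0// powR_gt0.
Qed.

Let EkernelE mu t (m0 : 0 < mu) : Ekernel alpha theta kappa mu t = (2 * pi)^-1 *
   (- (\int[mu1]_(r in `[kappa, +oo[) ray_integrand alpha mu t (- theta) r)
    + (\int[mu1]_(psi in `[- theta, theta]) arc_integrand alpha mu t kappa psi)
    + (\int[mu1]_(r in `[kappa, +oo[) ray_integrand alpha mu t theta r)).
Proof. by apply: Ekernel_realE => //; [rewrite th0|exact: den_neq0]. Qed.

Let pi2 : 0 < 2 * pi :> R. Proof. by rewrite mulr_gt0 ?pi_gt0. Qed.

Let Ekernel_bound_aux mu t B1 B2 : 0 < mu ->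
  (forall psi, psi = theta \/ psi = - theta ->
     `|\int[mu1]_(r in `[kappa, +oo[) ray_integrand alpha mu t psi r| <= B1) ->
  `|\int[mu1]_(psi in `[- theta, theta]) arc_integrand alpha mu t kappa psi| <= B2 ->
  `|Ekernel alpha theta kappa mu t| <= (2 * pi)^-1 * (2 * B1 + B2).
Proof.
move=> m0 h1 h2; rewrite EkernelE// normrM gtr0_norm ?invr_gt0//.
rewrite ler_wpM2l ?invr_ge0 ?(ltW pi2)//.
have := h1 theta (or_introl erefl); have := h1 (- theta) (or_intror erefl); move: h2.
move: (\int[mu1]_(r in `[kappa, +oo[) ray_integrand alpha mu t theta r)%R.
move: (\int[mu1]_(r in `[kappa, +oo[) ray_integrand alpha mu t (- theta) r)%R.
move: (\int[mu1]_(psi in `[- theta, theta]) arc_integrand alpha mu t kappa psi)%R.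
move=> X Y Z; rewrite !ler_norml => /andP[? ?] /andP[? ?] /andP[? ?]; lra.
Qed.

Let Ekernel_lip_aux mu x y B1 B2 : 0 < mu ->
  (forall psi, psi = theta \/ psi = - theta ->
     `|(\int[mu1]_(r in `[kappa, +oo[) ray_integrand alpha mu x psi r)
       - (\int[mu1]_(r in `[kappa, +oo[) ray_integrand alpha mu y psi r)| <= B1) ->
  `|(\int[mu1]_(psi in `[- theta, theta]) arc_integrand alpha mu x kappa psi)
   - (\int[mu1]_(psi in `[- theta, theta]) arc_integrand alpha mu y kappa psi)| <= B2 ->
  `|Ekernel alpha theta kappa mu x - Ekernel alpha theta kappa mu y| <= (2 * pi)^-1 * (2 * B1 + B2).
Proof.
move=> m0 h1 h2; rewrite !EkernelE// -mulrBr normrM gtr0_norm ?invr_gt0//.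
rewrite ler_wpM2l ?invr_ge0 ?(ltW pi2)//.
have := h1 theta (or_introl erefl); have := h1 (- theta) (or_intror erefl); move: h2.
move: (\int[mu1]_(r in `[kappa, +oo[) ray_integrand alpha mu x theta r)%R.
move: (\int[mu1]_(r in `[kappa, +oo[) ray_integrand alpha mu x (- theta) r)%R.
move: (\int[mu1]_(psi in `[- theta, theta]) arc_integrand alpha mu x kappa psi)%R.
move: (\int[mu1]_(r in `[kappa, +oo[) ray_integrand alpha mu y theta r)%R.
move: (\int[mu1]_(r in `[kappa, +oo[) ray_integrand alpha mu y (- theta) r)%R.
move: (\int[mu1]_(psi in `[- theta, theta]) arc_integrand alpha mu y kappa psi)%R.
move=> X Y Z X' Y' Z'; rewrite !ler_norml => /andP[? ?] /andP[? ?] /andP[? ?]; lra.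
Qed.

Let theta_in psi : psi = theta \/ psi = - theta -> - theta <= psi <= theta /\ cos psi = - d.
Proof. by rewrite /d opprK; case=> ->; rewrite ?cosN; split => //; move: th0; lra. Qed.

Let exp_bound t r psi B : expR (t * (r * cos psi)) <= B ->
  `|exp_re t r psi| <= B /\ `|exp_im t r psi| <= B.
Proof.
move=> h; split; rewrite /exp_re /exp_im normrM gtr0_norm ?expR_gt0//; apply: le_trans h.
  by rewrite -[leRHS]mulr1 ler_wpM2l ?expR_ge0 ?cos_max.
by rewrite -[leRHS]mulr1 ler_wpM2l ?expR_ge0 ?sin_max.
Qed.

Let exp_lip x y r psi B : y <= x -> 0 <= r -> 0 <= B ->
  (forall s : R, y <= s <= x -> expR (s * (r * cos psi)) <= B) ->
  `|exp_re x r psi - exp_re y r psi| <= 2 * r * B * (x - y) /\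
  `|exp_im x r psi - exp_im y r psi| <= 2 * r * B * (x - y).
Proof.
move=> yx r0 B0 hB; have [h1 h2] := exp_trig_lip (r * sin psi) yx hB.
have le2 : `|r * cos psi| + `|r * sin psi| <= 2 * r.
  rewrite !normrM (ger0_norm r0) -mulrDr mulrC ler_wpM2r//.
  by have := cos_max psi; have := sin_max psi; lra.
have le3 : (`|r * cos psi| + `|r * sin psi|) * B * (x - y) <= 2 * r * B * (x - y).
  by rewrite ler_wpM2r ?subr_ge0// ler_wpM2r.
by split; [apply: le_trans h1 le3|apply: le_trans h2 le3].
Qed.

Let comb_bound (p q u v A B : R) : `|p| <= A -> `|q| <= A -> `|u| <= B -> `|v| <= B ->
  `|p * u + q * v| <= 2 * A * B /\ `|p * u - q * v| <= 2 * A * B.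
Proof.
move=> hp hq hu hv.
have h1 : `|p * u| <= A * B by rewrite normrM ler_pM.
have h2 : `|q * v| <= A * B by rewrite normrM ler_pM.
by split; [apply: (le_trans (ler_normD _ _))|apply: (le_trans (ler_normB _ _))]; lra.
Qed.

Section exponents.
Variables (a b : R) (hb : 0 <= b <= 1) (ha : 0 < a < 1) (hab : alpha * b <= a).
(** The power of [kappa] is the cost of replacing r^(alpha b) by r^a on r >= kappa. It allows a >
    alpha b, which is needed to keep a positive when b = 0. *)
Let K := c^-1 * kappa `^ (alpha * b - a).

Let K0 : 0 <= K. Proof. by rewrite mulr_ge0 ?invr_ge0 ?powR_ge0 ?(ltW c0). Qed.

Let res_bound mu r psi : 0 < mu -> kappa <= r -> - theta <= psi <= theta ->
  `|resolvent_re mu (r `^ alpha) (alpha * psi)| <= K * (mu `^ b)^-1 * r `^ a /\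
  `|resolvent_im mu (r `^ alpha) (alpha * psi)| <= K * (mu `^ b)^-1 * r `^ a.
Proof.
move=> m0 kr /hpsi h; have r0 : 0 < r by exact: lt_le_trans kr.
have [h1 h2] := resolvent_bound hphi0 m0 (powR_gt0 alpha r0) h.
have h3 : c^-1 * (r `^ alpha / (r `^ alpha + mu)) <= K * (mu `^ b)^-1 * r `^ a.
  rewrite /K -!mulrA ler_wpM2l ?invr_ge0 ?(ltW c0)//.
  apply: (le_trans (resolvent_powR m0 (powR_gt0 alpha r0) hb)).
  rewrite mulrCA ler_wpM2l ?invr_ge0 ?powR_ge0// -powRrM.
  have -> : alpha * b = (alpha * b - a) + a by ring.
  rewrite powRD_gt0// ler_wpM2r ?powR_ge0//.
  have -> : alpha * b - a + a - a = alpha * b - a by ring.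
  by apply: le0_powR_le => //; rewrite subr_le0.
by split; [apply: le_trans h1 h3|apply: le_trans h2 h3].
Qed.

Let ray_bound mu t r psi : 0 < mu -> 0 < t -> kappa <= r -> psi = theta \/ psi = - theta ->
  `|ray_integrand alpha mu t psi r| <= 2 * K * (mu `^ b)^-1 * (expR (- (d * t * r)) * r `^ (a - 1)).
Proof.
move=> m0 t0 kr /theta_in[hp cp]; have r0 : 0 < r by exact: lt_le_trans kr.
have [h1 h2] := res_bound m0 kr hp.
have [h3 h4] : `|exp_re t r psi| <= expR (- (d * t * r)) /\ `|exp_im t r psi| <= expR (- (d * t * r)).
  by apply: exp_bound; rewrite cp ler_expR le_eqVlt; apply/orP; left; apply/eqP; ring.
have [h _] := comb_bound h4 h3 h1 h2.
rewrite /ray_integrand normrM normfV (gtr0_norm r0) ler_pdivrMr//; apply: (le_trans h).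
have -> : r `^ a = r `^ (a - 1) * r by rewrite -{3}(powRr1 (ltW r0)) -powRD_gt0// subrK.
by rewrite le_eqVlt; apply/orP; left; apply/eqP; ring.
Qed.

(** Differentiation in time yields a factor r, which raises the power r^(a - 1) by one. The exponent
    is left as [a + 1 - 1] so that [exp_pow_integral] applies at a + 1. *)
Let ray_lip mu x y r psi : 0 < mu -> 0 < y -> y <= x -> kappa <= r -> psi = theta \/ psi = - theta ->
  `|ray_integrand alpha mu x psi r - ray_integrand alpha mu y psi r| <=
  4 * K * (mu `^ b)^-1 * (x - y) * (expR (- (d * y * r)) * r `^ (a + 1 - 1)).
Proof.
move=> m0 y0 yx kr /theta_in[hp cp]; have r0 : 0 < r by exact: lt_le_trans kr.
have [h1 h2] := res_bound m0 kr hp.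
have [h3 h4] : `|exp_re x r psi - exp_re y r psi| <= 2 * r * expR (- (d * y * r)) * (x - y) /\
   `|exp_im x r psi - exp_im y r psi| <= 2 * r * expR (- (d * y * r)) * (x - y).
  apply: exp_lip => //; rewrite ?(ltW r0) ?expR_ge0// => s /andP[ys _].
  rewrite cp ler_expR -subr_ge0; have -> : - (d * y * r) - s * (r * - d) = d * r * (s - y) by ring.
  by rewrite !mulr_ge0 ?(ltW d0) ?(ltW r0) ?subr_ge0.
have [h _] := comb_bound h4 h3 h1 h2.
rewrite /ray_integrand -mulrBl normrM normfV (gtr0_norm r0) ler_pdivrMr//.
set p := exp_im x r psi in h *; set q := exp_re x r psi in h *.
set p' := exp_im y r psi in h *; set q' := exp_re y r psi in h *.
set u := resolvent_re _ _ _ in h *; set v := resolvent_im _ _ _ in h *.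
have -> : p * u + q * v - (p' * u + q' * v) = (p - p') * u + (q - q') * v by ring.
apply: (le_trans h); rewrite addrK.
by rewrite le_eqVlt; apply/orP; left; apply/eqP; ring.
Qed.

Lemma measurable_exp_powR t e : measurable_fun (`[kappa, +oo[%classic : set (measurableTypeR R))
  (fun r : measurableTypeR R => expR (- (d * t * r)) * r `^ e).
Proof.
apply: measurable_funTS; apply: measurable_funM; last exact: measurable_powR.
apply: (measurableT_comp (@measurable_expR R)).
apply: (@measurable_funN _ _ _ _ (fun r : measurableTypeR R => d * t * r)).
by apply: measurable_funM; [exact: measurable_cst|exact: measurable_id].
Qed.

Lemma measurable_ray_integrand_itv mu t psi : measurable_fun (`[kappa, +oo[%classic : set (measurableTypeR R)) (ray_integrand alpha mu t psi).
Proof.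
apply: measurable_ray_integrand => r; rewrite /= !in_itv/= !andbT; apply: le_trans; exact: ltW.
Qed.

Let integral_scale (D : set (measurableTypeR R)) (g : measurableTypeR R -> R) (p A : R) :
  measurable D -> measurable_fun D g -> (forall x, D x -> 0 <= g x) -> 0 <= p ->
  (\int[mu1]_(x in D) (g x)%:E <= A%:E)%E ->
  (\int[mu1]_(x in D) (p * g x)%:E <= (p * A)%:E)%E.
Proof.
move=> mD mg g0 p0 gA; have := ge0_integral_lincomb_le mD mg mg g0 g0 p0 (lexx 0) gA gA.
by rewrite mul0r addr0; under eq_integral do rewrite mul0r addr0.
Qed.

Let muK mu : 0 < mu -> 0 <= K * (mu `^ b)^-1.
Proof. by move=> m0; rewrite mulr_ge0 ?invr_ge0 ?powR_ge0. Qed.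

Let ray_integral C (HC : forall t, 0 < t ->
    (\int[mu1]_(r in `[kappa, +oo[) (expR (- (d * t * r)) * r `^ (a - 1))%:E <= (C * t `^ (- a))%:E)%E)
  mu t psi : 0 < mu -> 0 < t -> psi = theta \/ psi = - theta ->
  mu1.-integrable `[kappa, +oo[ (EFin \o ray_integrand alpha mu t psi) /\
  `|\int[mu1]_(r in `[kappa, +oo[) ray_integrand alpha mu t psi r| <= 2 * K * (mu `^ b)^-1 * (C * t `^ (- a)).
Proof.
move=> m0 t0 hpsi'.
have p0 : 0 <= 2 * K * (mu `^ b)^-1 by rewrite -mulrA mulr_ge0// muK.
apply: (Rintegral_bound (g := fun r => 2 * K * (mu `^ b)^-1 * (expR (- (d * t * r)) * r `^ (a - 1)))) => //.
- exact: measurable_ray_integrand_itv.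
- by apply: measurable_funM => //; exact: measurable_exp_powR.
- by move=> r /=; rewrite in_itv/= andbT => kr; exact: ray_bound.
apply: integral_scale => //; last exact: HC.
  exact: measurable_exp_powR.
by move=> r _; rewrite mulr_ge0 ?expR_ge0 ?powR_ge0.
Qed.

Let kappa_in : kappa <= kappa. Proof. by []. Qed.

Let arc_exp T t psi : 0 < t <= T -> expR (t * (kappa * cos psi)) <= expR (kappa * T).
Proof.
move=> /andP[t0 tT]; rewrite ler_expR mulrCA ler_wpM2l ?(ltW hkappa)//.
apply: (@le_trans _ _ t) => //; rewrite -[leRHS]mulr1 ler_wpM2l ?(ltW t0) ?cos_le1//.
Qed.

Let arc_cst (B : R) : 0 <= B ->
  (\int[mu1]_(psi in (`[(- theta)%R, theta]%classic : set (measurableTypeR R))) B%:E <= (B * (2 * theta))%:E)%E.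
Proof.
move=> B0; rewrite integral_cst//= lebesgue_measure_itv/= lte_fin.
have -> : (- theta < theta)%R = true by move: th0; lra.
rewrite -EFinD -EFinM lee_fin le_eqVlt; apply/orP; left; apply/eqP; ring.
Qed.

Lemma arc_integral T mu t : 0 < mu -> 0 < t <= T ->
  mu1.-integrable `[- theta, theta] (EFin \o arc_integrand alpha mu t kappa) /\
  `|\int[mu1]_(psi in `[- theta, theta]) arc_integrand alpha mu t kappa psi| <=
    2 * expR (kappa * T) * (K * (mu `^ b)^-1 * kappa `^ a) * (2 * theta).
Proof.
move=> m0 tT; set B := 2 * _ * _.
have B0 : 0 <= B.
  by apply: mulr_ge0; [rewrite mulr_ge0 ?expR_ge0|apply: mulr_ge0; rewrite ?muK ?powR_ge0].
apply: (Rintegral_bound (g := cst B)) => //; last exact: arc_cst.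
  exact: measurable_arc_integrand.
move=> psi /=; rewrite in_itv/= => hp.
have [h1 h2] := res_bound m0 kappa_in hp.
have [h3 h4] := exp_bound (arc_exp psi tT).
by have [_ h] := comb_bound h3 h4 h1 h2; rewrite /B -mulrA; move: h; rewrite mulrA.
Qed.

Let mu_cancel mu : 0 < mu -> mu `^ b * (mu `^ b)^-1 = 1.
Proof. by move=> m0; rewrite divff// gt_eqF// powR_gt0. Qed.

(** The arc contributes a term without singularity in time; this factor, at least 1, merges it with
    the singular terms from the rays. *)
Let pow_ge1 T t e : 0 < t <= T -> 0 <= e -> 1 <= T `^ e * t `^ (- e).
Proof.
move=> /andP[t0 tT] e0; rewrite powRN ler_pdivlMr ?powR_gt0// mul1r.
by apply: ge0_powR_le => //; exact: ltW.
Qed.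

Lemma Ekernel_bound T : 0 < T -> exists2 C : R, 0 <= C & forall mu t, 0 < mu -> 0 < t <= T ->
  mu `^ b * `|Ekernel alpha theta kappa mu t| <= C * t `^ (- a).
Proof.
move=> T0; case/andP: (ha) => a_0 a_1; have a2 : 0 < a < 2 by rewrite a_0 (lt_trans a_1)// ltr1n.
have [I I0 HI] := exp_pow_integral d0 a2 hkappa.
pose Q := 2 * expR (kappa * T) * (K * kappa `^ a) * (2 * theta).
have Kk : 0 <= K * kappa `^ a by apply: mulr_ge0; [exact: K0|exact: powR_ge0].
have Q0 : 0 <= Q.
  by apply: mulr_ge0; [apply: mulr_ge0 => //; rewrite mulr_ge0 ?expR_ge0|rewrite mulr_ge0 ?(ltW th0)].
exists ((2 * pi)^-1 * (2 * (2 * K * I) + Q * T `^ a)).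
  rewrite mulr_ge0 ?invr_ge0 ?(ltW pi2)// addr_ge0//; last by rewrite mulr_ge0 ?powR_ge0.
  by apply: mulr_ge0 => //; apply: mulr_ge0 => //; apply: mulr_ge0 => //; exact: K0.
move=> mu t m0 tT; case/andP: (tT) => t0 _.
have := Ekernel_bound_aux m0 (fun psi h => (ray_integral HI m0 t0 h).2) (arc_integral m0 tT).2.
move=> h; apply: (le_trans (ler_wpM2l (powR_ge0 mu b) h)).
have mc := mu_cancel m0; have t1 := pow_ge1 tT (ltW a_0).
set m := mu `^ b in mc *; set tt := t `^ (- a) in t1 *.
have -> : m * ((2 * pi)^-1 * (2 * (2 * K * m^-1 * (I * tt)) + 2 * expR (kappa * T) * (K * m^-1 * kappa `^ a) * (2 * theta)))
   = (m * m^-1) * ((2 * pi)^-1 * (2 * (2 * K * I) * tt + Q)) by rewrite /Q; ring.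
clearbody Q; rewrite mc mul1r -[leRHS]mulrA ler_wpM2l ?invr_ge0 ?(ltW pi2)// [leRHS]mulrDl lerD2l -[leRHS]mulrA.
by rewrite -{1}[Q]mulr1 ler_wpM2l.
Qed.

(** The factor y^(-a) (x - y) / y is y^(-(a + 1)) (x - y): the ray estimate at exponent a + 1 times
    the length of the time interval. *)
Lemma Ekernel_lip T : 0 < T -> exists2 C : R, 0 <= C & forall mu x y, 0 < mu -> 0 < y -> y < x -> x <= T ->
  mu `^ b * `|Ekernel alpha theta kappa mu x - Ekernel alpha theta kappa mu y| <=
  C * (y `^ (- a) * ((x - y) / y)).
Proof.
move=> T0; case/andP: (ha) => a_0 a_1; have a2 : 0 < a < 2 by rewrite a_0 (lt_trans a_1)// ltr1n.
have [I _ HI] := exp_pow_integral d0 a2 hkappa.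
have a12 : 0 < a + 1 < 2 by lra.
have [I' I'0 HI'] := exp_pow_integral d0 a12 hkappa.
pose Q := 2 * (2 * kappa * expR (kappa * T)) * (K * kappa `^ a) * (2 * theta).
have Kk : 0 <= K * kappa `^ a by apply: mulr_ge0; [exact: K0|exact: powR_ge0].
have Q0 : 0 <= Q.
  by apply: mulr_ge0; [apply: mulr_ge0 => //; rewrite !mulr_ge0 ?expR_ge0 ?(ltW hkappa)|rewrite mulr_ge0 ?(ltW th0)].
exists ((2 * pi)^-1 * (2 * (4 * K * I') + Q * T `^ (a + 1))).
  rewrite mulr_ge0 ?invr_ge0 ?(ltW pi2)// addr_ge0//; last by rewrite mulr_ge0 ?powR_ge0.
  by apply: mulr_ge0 => //; apply: mulr_ge0 => //; apply: mulr_ge0 => //; exact: K0.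
move=> mu x y m0 y0 yx xT; have x0 : 0 < x by exact: lt_trans yx.
have yT : 0 < y <= T by rewrite y0 ltW// (lt_le_trans yx).
have xT' : 0 < x <= T by rewrite x0.
have xy0 : 0 <= x - y by rewrite subr_ge0 ltW.
have arcl : `|(\int[mu1]_(psi in `[- theta, theta]) arc_integrand alpha mu x kappa psi)
   - (\int[mu1]_(psi in `[- theta, theta]) arc_integrand alpha mu y kappa psi)| <=
   2 * (2 * kappa * expR (kappa * T) * (x - y)) * (K * (mu `^ b)^-1 * kappa `^ a) * (2 * theta).
  set B := 2 * _ * (K * _ * _).
  have B0 : 0 <= B.
    apply: mulr_ge0; last by apply: mulr_ge0; rewrite ?muK ?powR_ge0.
    by rewrite !mulr_ge0 ?expR_ge0 ?(ltW hkappa).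
  apply: (Rintegral_lip (g := cst B)) => //; last exact: arc_cst.
  - exact: (arc_integral m0 xT').1.
  - exact: (arc_integral m0 yT).1.
  move=> psi /=; rewrite in_itv/= => hp.
  have [h1 h2] := res_bound m0 kappa_in hp.
  have [h3 h4] : `|exp_re x kappa psi - exp_re y kappa psi| <= 2 * kappa * expR (kappa * T) * (x - y) /\
     `|exp_im x kappa psi - exp_im y kappa psi| <= 2 * kappa * expR (kappa * T) * (x - y).
    apply: exp_lip => //; rewrite ?(ltW yx) ?(ltW hkappa) ?expR_ge0// => s /andP[ys sx].
    by apply: arc_exp; rewrite (lt_le_trans y0 ys) (le_trans sx).
  have [_ h] := comb_bound h3 h4 h1 h2.
  rewrite /arc_integrand; apply: le_trans h; rewrite le_eqVlt; apply/orP; left; apply/eqP.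
  by congr (`|_|); ring.
have rayl psi (hpsi' : psi = theta \/ psi = - theta) :
  `|(\int[mu1]_(r in `[kappa, +oo[) ray_integrand alpha mu x psi r)
       - (\int[mu1]_(r in `[kappa, +oo[) ray_integrand alpha mu y psi r)| <=
   4 * K * (mu `^ b)^-1 * (x - y) * (I' * y `^ (- (a + 1))).
  have p0 : 0 <= 4 * K * (mu `^ b)^-1 * (x - y) by rewrite mulr_ge0// -mulrA mulr_ge0// muK.
  apply: (Rintegral_lip (g := fun r => 4 * K * (mu `^ b)^-1 * (x - y) * (expR (- (d * y * r)) * r `^ (a + 1 - 1)))) => //.
  - exact: (ray_integral HI m0 x0 hpsi').1.
  - exact: (ray_integral HI m0 y0 hpsi').1.
  - by apply: measurable_funM => //; exact: measurable_exp_powR.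
  - by move=> r /=; rewrite in_itv/= andbT => kr; apply: ray_lip => //; exact: ltW.
  apply: integral_scale => //; last exact: HI'.
    exact: measurable_exp_powR.
  by move=> r _; rewrite mulr_ge0 ?expR_ge0 ?powR_ge0.
have := Ekernel_lip_aux m0 rayl arcl.
move=> h; apply: (le_trans (ler_wpM2l (powR_ge0 mu b) h)).
have a10 : 0 <= a + 1 by rewrite addr_ge0// ltW.
have mc := mu_cancel m0; have t1 := pow_ge1 yT a10.
have yE : y `^ (- a) * ((x - y) / y) = y `^ (- (a + 1)) * (x - y).
  rewrite opprD powRD_gt0// powR_inv1 ?(ltW y0)//; ring.
rewrite yE; set m := mu `^ b in mc *; set tt := y `^ (- (a + 1)) in t1 *.
have -> : m * ((2 * pi)^-1 * (2 * (4 * K * m^-1 * (x - y) * (I' * tt)) +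
    2 * (2 * kappa * expR (kappa * T) * (x - y)) * (K * m^-1 * kappa `^ a) * (2 * theta)))
   = (m * m^-1) * ((2 * pi)^-1 * ((2 * (4 * K * I') * tt + Q) * (x - y))) by rewrite /Q; ring.
clearbody Q; rewrite mc mul1r -[leRHS]mulrA ler_wpM2l ?invr_ge0 ?(ltW pi2)// [leRHS]mulrA ler_wpM2r//.
by rewrite [leRHS]mulrDl lerD2l -[leRHS]mulrA -{1}[Q]mulr1 ler_wpM2l.
Qed.

End exponents.

(* The decay of the imaginary part of the resolvent in r is what avoids a
   logarithm in t here. *)
Lemma Ekernel_bounded T : 0 < T ->
  exists M, forall mu t, 0 < mu -> 0 < t <= T -> `|Ekernel alpha theta kappa mu t| <= M.
Proof.
move=> T0; have b01 : 0 <= (0 : R) <= 1 by rewrite lexx ler01.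
have a01 : 0 < (1 / 2 : R) < 1 by lra.
have ab0 : alpha * 0 <= 1 / 2 by rewrite mulr0; lra.
have a12 : 0 < (1 : R) < 2 by rewrite ltr01 ltr1n.
have [I I0 HI] := exp_pow_integral d0 a12 hkappa.
pose J := 2 / alpha.
exists ((2 * pi)^-1 * (2 * (c^-1 * I + c^-1 * J) +
   2 * expR (kappa * T) * (c^-1 * kappa `^ (alpha * 0 - 1 / 2) * kappa `^ (1 / 2)) * (2 * theta))).
move=> mu t m0 tT; case/andP: (tT) => t0 _.
(* On the arc b = 0 removes [mu] from the estimate, and a = 1/2 is an arbitrary admissible
   exponent. *)
apply: Ekernel_bound_aux => //; last first.
  have [_] := arc_integral (b := 0) b01 ab0 m0 tT.
  by rewrite powRr0 invr1 mulr1.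
move=> psi hpsi'; have [hp cp] := theta_in hpsi'.
(* The first term majorizes the part with the real resolvent factor, where |sin x| <= |x| cancels 1
   / r; its integral is bounded because that of e^(-d t r) is of order 1 / t. The second majorizes
   the part with the imaginary factor, through its decay alone. *)
pose g (r : measurableTypeR R) := c^-1 * t * (expR (- (d * t * r)) * r `^ (1 - 1)) + c^-1 * (mu * r `^ (alpha - 1) / (r `^ alpha + mu) ^+ 2).
have mp : measurable_fun (`[kappa, +oo[%classic : set (measurableTypeR R)) (fun r : measurableTypeR R => mu * r `^ (alpha - 1) / (r `^ alpha + mu) ^+ 2).
  by apply: measurable_funTS; exact: measurable_resolvent_sq.
have mE := measurable_exp_powR t (1 - 1).
have HJ := resolvent_sq_integral a0 m0 hkappa.
have HIt := HI t t0.
apply: (Rintegral_bound (g := g) _ _ _ _ _).2 => //.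
- exact: measurable_ray_integrand_itv.
- by apply: measurable_funD; apply: measurable_funM.
- move=> r /=; rewrite in_itv/= andbT => kr; have r0 : 0 < r by exact: lt_le_trans kr.
  have [h1 _] := resolvent_bound hphi0 m0 (powR_gt0 alpha r0) (hpsi hp).
  have h2 : `|resolvent_im mu (r `^ alpha) (alpha * psi)| <= c^-1 * (mu * r `^ alpha / (r `^ alpha + mu) ^+ 2).
    exact: (resolvent_im_bound hphi0 m0 (powR_gt0 alpha r0) (hpsi hp)).
  have h1' : `|resolvent_re mu (r `^ alpha) (alpha * psi)| <= c^-1.
    apply: (le_trans h1); rewrite -[leRHS]mulr1 ler_wpM2l ?invr_ge0 ?(ltW c0)//.
    by rewrite ler_pdivrMr ?addr_gt0 ?powR_gt0// mul1r lerDl ltW.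
  (* The exponential is kept aside and the sine is compared with its value 0 at time 0 by
     [exp_trig_lip] with p = 0. *)
  have he1 : `|exp_im t r psi| <= t * r * expR (- (d * t * r)).
    rewrite /exp_im normrM gtr0_norm ?expR_gt0// cp mulrC (_ : t * (r * - d) = - (d * t * r)); last by ring.
    rewrite ler_wpM2r ?expR_ge0//.
    have [|_] := @exp_trig_lip 0 (r * sin psi) t 0 1 (ltW t0).
      by move=> s _; rewrite mulr0 expR0.
    rewrite !mulr0 mul0r !expR0 sin0 !mul1r subr0 normr0 add0r mulr1 subr0.
    move/le_trans; apply; rewrite mulrC ler_wpM2l ?(ltW t0)// normrM (gtr0_norm r0).
    by rewrite -[leRHS]mulr1 ler_wpM2l ?(ltW r0) ?sin_max.
  have he2 : `|exp_re t r psi| <= 1.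
    have [] // := @exp_bound t r psi 1.
    rewrite cp -expR0 ler_expR -oppr_ge0; have -> : - (t * (r * - d)) = t * r * d by ring.
    by rewrite !mulr_ge0 ?(ltW t0) ?(ltW r0) ?(ltW d0).
  rewrite /ray_integrand normrM normfV (gtr0_norm r0) ler_pdivrMr//.
  move: (exp_im t r psi) (exp_re t r psi) (resolvent_re mu (r `^ alpha) (alpha * psi)) (resolvent_im mu (r `^ alpha) (alpha * psi)) he1 he2 h1' h2 => p q u v he1 he2 h1' h2.
  apply: (le_trans (ler_normD _ _)); rewrite !normrM /g mulrDl; apply: lerD.
    rewrite subrr powRr0 mulr1.
    have -> : c^-1 * t * expR (- (d * t * r)) * r = t * r * expR (- (d * t * r)) * c^-1 by ring.
    by rewrite ler_pM.
  have -> : c^-1 * (mu * r `^ (alpha - 1) / (r `^ alpha + mu) ^+ 2) * r = 1 * (c^-1 * (mu * r `^ alpha / (r `^ alpha + mu) ^+ 2)).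
    have -> : r `^ alpha = r `^ (alpha - 1) * r by rewrite -{3}(powRr1 (ltW r0)) -powRD_gt0// subrK.
    by rewrite mul1r; ring.
  by rewrite ler_pM.
have -> : c^-1 * I = c^-1 * t * (I * t `^ (- 1)).
  by rewrite powR_inv1 ?(ltW t0)//; field; rewrite !gt_eqF.
apply: ge0_integral_lincomb_le => //.
- by move=> r _; rewrite mulr_ge0 ?expR_ge0 ?powR_ge0.
- by move=> r _; rewrite divr_ge0 ?sqr_ge0 ?mulr_ge0 ?powR_ge0 ?(ltW m0).
- by rewrite mulr_ge0 ?invr_ge0 ?(ltW c0) ?(ltW t0).
- by rewrite invr_ge0 ltW.
Qed.

End bounds.
End kernel_bounds.

(** * Bochner integrals of diagonal operators *)

Section bochner_estimate.
Context (R : realType) (d : nat) (D : convex_polygonal_domain R d) (phi : nat -> L2 D).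
Hypothesis phi_orth : forall j k, inner (phi j) (phi k) = (j == k)%:R.
Hypothesis phi_complete : forall g, (forall k, inner g (phi k) = 0) -> hnorm g = 0.
Local Notation mu := (@lebesgue_measure R).

(** By Parseval the norm is a limit of measurable sums of coordinates. Coordinatewise measurability,
    unlike [hmeasurable], passes directly to differences. *)
Lemma measurable_hnorm_coord d0 (T : measurableType d0) (A : set T) (X : T -> L2 D) :
  (forall k, measurable_fun A (fun x => inner (X x) (phi k))) ->
  measurable_fun A (fun x => hnorm (X x)).
Proof.
move=> mX; have msq : measurable_fun A (fun x => hnorm (X x) ^+ 2).
  apply: (@measurable_fun_cvg _ _ _ _ (fun n x => \sum_(i < n) inner (X x) (phi i) ^+ 2)).
    by move=> n; apply: measurable_sum => i; exact: measurable_funX.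
  by move=> x _; exact: (hcvg_lin_sq phi_orth (parseval phi_orth phi_complete (X x))).
have -> : (fun x => hnorm (X x)) = (fun x => Num.sqrt (hnorm (X x) ^+ 2)).
  by apply/funext => x; rewrite sqrtr_sqr ger0_norm ?hnorm_ge0.
by apply: (measurableT_comp _ msq); apply: continuous_measurable_fun; exact: sqrt_continuous.
Qed.

Lemma measurable_inner d0 (T : measurableType d0) (A : set T) (X : T -> L2 D) h :
  measurable A -> hmeasurable A X -> measurable_fun A (fun x => inner (X x) h).
Proof.
move=> mA mX; apply: (hmeasurable_lipschitz phi_orth phi_complete (F := fun u => inner u h) (L := hnorm h) mA mX).
by move=> u v; rewrite -innerBl mulrC cauchy_schwarz.
Qed.

Lemma measurable_hnorm d0 (T : measurableType d0) (A : set T) (X : T -> L2 D) :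
  measurable A -> hmeasurable A X -> measurable_fun A (fun x => hnorm (X x)).
Proof. by move=> mA mX; apply: measurable_hnorm_coord => k; exact: measurable_inner. Qed.

(** For simple functions this is the triangle inequality for a scalar integral. Both sides then pass
    to the limit, the error being at most [hnorm h] times the L^1 distance to the integrand. *)
Lemma bochner_inner_le (J : set (measurableTypeR R)) (g : R -> L2 D) v h :
  measurable J -> (mu J < +oo)%E -> bochner_integral J g v ->
  ((`|inner v h|)%:E <= \int[mu]_(x in J) (`|inner (g x) h|)%:E)%E.
Proof.
move=> mJ Joo [mg [N [B [c [mB gS Sv]]]]].
have mB' n i : measurable (B n i : set (measurableTypeR R)) by exact: mB.
pose S n (x : measurableTypeR R) : L2 D := \sum_(i < N n) \1_(B n i) x *: c n i.
pose w n := \sum_(i < N n) fine (mu (J `&` B n i)) *: c n i.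
have mgk k : measurable_fun J (fun x : measurableTypeR R => inner (g x) k) by exact: measurable_inner.
have SE n x k : inner (S n x) k = \sum_(i < N n) inner (c n i) k * \1_(B n i) x.
  by rewrite inner_suml; apply: eq_bigr => i _; rewrite innerZl mulrC.
have mSk n k : measurable_fun J (fun x : measurableTypeR R => inner (S n x) k).
  under eq_fun do rewrite SE; apply: measurable_sum => i; apply: measurable_funM => //.
have mgSk n k : measurable_fun J (fun x : measurableTypeR R => inner (g x - S n x) k).
  by under eq_fun do rewrite innerBl; exact: measurable_funB.
have mgS n : measurable_fun J (fun x : measurableTypeR R => hnorm (g x - S n x)).
  by apply: measurable_hnorm_coord => k; exact: mgSk.
have mabs (f : measurableTypeR R -> R) : measurable_fun J f -> measurable_fun J (fun x => (`|f x|)%:E).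
  by move=> mf; apply/measurable_EFinP; apply: measurableT_comp.
have wle n : ((`|inner (w n) h|)%:E <= \int[mu]_(x in J) (`|inner (S n x) h|)%:E)%E.
  have hi i : has_integral mu (fun x : measurableTypeR R => inner (c n i) h * \1_(J `&` B n i) x)
      (inner (c n i) h * fine (mu (J `&` B n i))).
    have mJB : measurable (J `&` B n i : set (measurableTypeR R)) := measurableI _ _ mJ (mB' n i).
    apply: has_integralZ; apply: has_integral_ge0.
    - exact: (@measurable_indic _ (measurableTypeR R) R setT _ mJB).
    - by move=> x; rewrite indicE.
    rewrite integral_indic// setIT fineK// ge0_fin_numE//.
    by apply: le_lt_trans Joo; apply: le_measure; rewrite ?inE//; exact: subIsetl.
  have := @has_integral_sum _ _ _ mu _ (index_enum 'I_(N n)) _ _ xpredT (all_predT _) (fun i _ => hi i).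
  have -> : \sum_(i < N n) inner (c n i) h * fine (mu (J `&` B n i)) = inner (w n) h.
    by rewrite inner_suml; apply: eq_bigr => i _; rewrite innerZl mulrC.
  set G := (fun x => _) => hG.
  have GE x : G x = ((fun x => inner (S n x) h) \_ J) x.
    rewrite patchE; case: ifPn => xJ; last first.
      by rewrite /G big1// => i _; rewrite indicE in_setI (negbTE xJ) mulr0.
    by rewrite SE; apply: eq_bigr => i _; rewrite !indicE in_setI xJ.
  have GE' : (fun x => (G x)%:E) = (fun x => (inner (S n x) h)%:E) \_ J.
    by apply/funext => x; rewrite GE !patchE; case: ifP.
  have := has_integral_ereal hG; rewrite GE' -integral_mkcond => SI.
  have -> : (`|inner (w n) h|)%:E = `|(inner (w n) h)%:E|%E by [].
  rewrite -SI; apply: (le_abse_integral _ mJ); exact/measurable_EFinP.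
have key n : ((`|inner (w n) h|)%:E <= \int[mu]_(x in J) (`|inner (g x) h|)%:E +
     (hnorm h)%:E * \int[mu]_(x in J) (hnorm (g x - S n x))%:E)%E.
  apply: (le_trans (wle n)).
  rewrite -ge0_integralZl_EFin ?hnorm_ge0//; last 2 first.
  - by move=> x _; rewrite lee_fin hnorm_ge0.
  - exact/measurable_EFinP.
  rewrite -ge0_integralD//; last 3 first.
  - exact: mabs.
  - by move=> x _; rewrite -EFinM lee_fin mulr_ge0 ?hnorm_ge0.
  - by apply: measurable_funeM; exact/measurable_EFinP.
  apply: ge0_le_integral => //; first exact: mabs.
  - apply: emeasurable_funD; first exact: mabs.
    by apply: measurable_funeM; exact/measurable_EFinP.
  move=> x _; rewrite -EFinM -EFinD lee_fin.
  have -> : inner (S n x) h = inner (g x) h - inner (g x - S n x) h by rewrite innerBl; ring.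
  by apply: (le_trans (ler_normB _ _)); rewrite lerD2l mulrC cauchy_schwarz.
have I0 : (0 <= \int[mu]_(x in J) (`|inner (g x) h|)%:E)%E by apply: integral_ge0 => x _; rewrite lee_fin.
move: key I0; case: (\int[mu]_(x in J) (`|inner (g x) h|)%:E)%E => [I| |] key I0 //; last by rewrite leey.
have lim1 : (fun n => (`|inner (w n) h|)%:E) @ \oo --> (`|inner v h|)%:E.
  by apply: cvg_EFin; [exact: nearW|apply: cvg_norm; exact: hcvg_inner].
have lim2 : ((fun n => I%:E + (hnorm h)%:E * \int[mu]_(x in J) (hnorm (g x - S n x))%:E) @ \oo --> I%:E)%E.
  rewrite -[X in _ --> X]adde0 -(mule0 (hnorm h)%:E); apply: cvgeD; first by rewrite mule0 fin_num_adde_defl.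
    exact: cvg_cst.
  exact: cvgeZl.
rewrite -(cvg_lim _ lim1)// -(cvg_lim _ lim2)//; apply: lee_lim; [exact: cvgP lim1|exact: cvgP lim2|].
exact: nearW.
Qed.

(** Cauchy-Schwarz for the combinations with coefficients |a_i| and |(G, phi_i)|, the norm of the
    latter being bounded by Bessel's inequality. *)
Lemma sum_norm_inner_le (a : nat -> R) G n :
  \sum_(i < n) `|a i| * `|inner G (phi i)| <= Num.sqrt (\sum_(i < n) a i ^+ 2) * hnorm G.
Proof.
pose p := lin_comb phi (fun i => `|a i|) n; pose q := lin_comb phi (fun i => `|inner G (phi i)|) n.
have -> : \sum_(i < n) `|a i| * `|inner G (phi i)| = inner q p.
  rewrite inner_lin_combr; apply: eq_bigr => i _.
  by rewrite (inner_lin_comb phi_orth) ltn_ord mulr1.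
apply: (le_trans (ler_inner _ _)); rewrite mulrC; apply: ler_pM; rewrite ?hnorm_ge0//.
  rewrite -[hnorm p]ger0_norm ?hnorm_ge0// -sqrtr_sqr ler_sqrt ?sumr_ge0//; last by move=> i _; exact: sqr_ge0.
  by rewrite (hnorm_lin_comb phi_orth); apply: ler_sum => i _; rewrite real_normK ?num_real.
rewrite -(@ler_pXn2r _ 2) ?nnegrE ?hnorm_ge0// (hnorm_lin_comb phi_orth).
apply: le_trans (bessel phi_orth G n); apply: ler_sum => i _; by rewrite real_normK ?num_real.
Qed.

(** A Minkowski inequality in disguise: the norm of the integral, weighted by [m], is at most the
    integral of the weighted operator norms, on the first [n] coordinates. *)
Lemma diag_bochner_bound (m : nat -> R) (E : nat -> R -> R) (G : R -> L2 D) (kap : R -> R) t v n : 0 < t ->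
  bochner_integral `]0, t[ (fun r => diag_op phi (fun k => E k (t - r)) (G r)) v ->
  measurable_fun (`]0, t[%classic : set (measurableTypeR R)) (fun r => hnorm (G r)) ->
  measurable_fun (`]0, t[%classic : set (measurableTypeR R)) (fun r => kap (t - r)) ->
  (forall r, 0 < r < t -> 0 <= kap r) ->
  (forall r, 0 < r < t -> exists M, forall k, `|E k r| <= M) ->
  (forall k r, 0 < r < t -> `|m k| * `|E k r| <= kap r) ->
  ((Num.sqrt (\sum_(i < n) (m i * inner v (phi i)) ^+ 2))%:E <=
   \int[mu]_(r in `]0%R, t[) (kap (t - r) * hnorm (G r))%:E)%E.
Proof.
move=> t0 bv mG mk k0 EM mE; set S := Num.sqrt _.
have S0 : 0 <= S by exact: sqrtr_ge0.
have tI r : `]0, t[%classic r -> 0 < t - r < t.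
  by rewrite /= in_itv/= => /andP[? ?]; apply/andP; split; lra.
have I0 : (0 <= \int[mu]_(r in `]0%R, t[) (kap (t - r) * hnorm (G r))%:E)%E.
  by apply: integral_ge0 => r /tI hr; rewrite lee_fin mulr_ge0 ?hnorm_ge0 ?k0.
have [->//|Sn0] := eqVneq S 0.
have Sp : 0 < S by rewrite lt_neqAle eq_sym Sn0.
have SS : S ^+ 2 = \sum_(i < n) (m i * inner v (phi i)) ^+ 2.
  by rewrite sqr_sqrtr// sumr_ge0// => i _; exact: sqr_ge0.
(* Testing [v] against [h] gives S^2. In the integrand one factor |m_i| joins E_i and is bounded by
   [kap], the other stays with (v, phi_i) and yields a factor S, which is then cancelled. *)
pose h := lin_comb phi (fun i => m i ^+ 2 * inner v (phi i)) n.
have vh : inner v h = S ^+ 2.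
  by rewrite SS inner_lin_combr; apply: eq_bigr => i _; ring.
have mKG : measurable_fun (`]0, t[%classic : set (measurableTypeR R)) (fun r => (kap (t - r) * hnorm (G r))%:E).
  by apply/measurable_EFinP; exact: measurable_funM.
have : ((S ^+ 2)%:E <= S%:E * \int[mu]_(r in `]0%R, t[) (kap (t - r) * hnorm (G r))%:E)%E.
  have -> : ((S ^+ 2)%:E = (`|inner v h|)%:E)%E by rewrite vh ger0_norm ?sqr_ge0.
  have J1 : measurable (`]0, t[%classic : set (measurableTypeR R)) by exact: measurable_itv.
  have J2 : (mu (`]0%R, t[%classic : set (measurableTypeR R)) < +oo)%E.
    by rewrite lebesgue_measure_itv/= lte_fin t0 -EFinB ltry.
  apply: (le_trans (bochner_inner_le h J1 J2 bv)).
  rewrite -ge0_integralZl_EFin//; last by move=> r /tI hr; rewrite lee_fin mulr_ge0 ?hnorm_ge0 ?k0.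
  apply: ge0_le_integral => //.
  - apply/measurable_EFinP; apply: measurableT_comp => //; apply: measurable_inner => //.
    by case: bv.
  - exact: measurable_funeM.
  move=> r /tI hr; rewrite -EFinM lee_fin.
  have [M HM] := EM _ hr.
  have dom := diag_dom_bounded phi_orth (G r) HM.
  rewrite inner_lin_combr; apply: (le_trans (ler_norm_sum _ _ _)).
  apply: (@le_trans _ _ (kap (t - r) * \sum_(i < n) `|m i * inner v (phi i)| * `|inner (G r) (phi i)|)).
    rewrite mulr_sumr; apply: ler_sum => i _.
    rewrite (inner_diag_op phi_orth _ dom) !normrM.
    rewrite [X in X <= _](_ : _ = (`|m i| * `|E i (t - r)|) * (`|m i| * `|inner v (phi i)| * `|inner (G r) (phi i)|)); last by ring.
    by rewrite ler_wpM2r ?mulr_ge0//; exact: mE.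
  rewrite mulrCA ler_wpM2l ?k0//; exact: (sum_norm_inner_le (fun i => m i * inner v (phi i))).
move: I0; case: (\int[mu]_(r in `]0%R, t[) _)%E => [I| |] // _; last by rewrite leey.
by rewrite -EFinM !lee_fin expr2 ler_pM2l.
Qed.

End bochner_estimate.

(** * Gronwall's inequality *)

Section integral_bounds.
Context d (X : measurableType d) (R : realType) (m : {measure set X -> \bar R}).

Lemma fatou_bound (f : nat -> X -> R) (g : X -> R) (M : \bar R) :
  (forall n, measurable_fun setT (f n)) -> (forall n x, 0 <= f n x) ->
  (forall x, f ^~ x @ \oo --> g x) -> (forall n, (\int[m]_x (f n x)%:E <= M)%E) ->
  (\int[m]_x (g x)%:E <= M)%E.
Proof.
move=> mf f0 fg fM; pose ff n x := (f n x)%:E.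
have mff n : measurable_fun setT (ff n) by exact/measurable_EFinP.
have ff0 n x : setT x -> (0 <= ff n x)%E by move=> _; rewrite lee_fin.
have := fatou m measurableT mff ff0.
have -> : (\int[m]_x limn_einf (ff^~ x) = \int[m]_x (g x)%:E)%E.
  apply: eq_integral => x _; apply: (cvg_limn_einf_sup _).1.
  by apply: cvg_EFin; [exact: nearW|exact: fg].
by move/le_trans; apply; exact: limn_einf_le.
Qed.

Lemma integral_series_bound (f : nat -> X -> R) (M : R) :
  (forall n, measurable_fun setT (f n)) -> (forall n x, 0 <= f n x) ->
  (forall n, \int[m]_x (\sum_(k < n) f k x)%:E <= M%:E)%E ->
  (\int[m]_x (\sum_(k <oo) (f k x)%:E) <= M%:E)%E.
Proof.
move=> mf f0 fM.
have mE k : measurable_fun setT (fun x => (f k x)%:E) by exact/measurable_EFinP.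
have f0' k x : setT x -> (0 <= (f k x)%:E)%E by move=> _; rewrite lee_fin.
rewrite (integral_nneseries m measurableT mE f0').
apply: lime_le; first by apply: is_cvg_nneseries => k _ _; exact: ge0_integralr_ge0.
apply: nearW => n; rewrite -(ge0_integral_sum m measurableT mE f0').
apply: le_trans (fM n); rewrite le_eqVlt; apply/orP; left; apply/eqP.
by apply: eq_integral => x _; rewrite sumEFin big_mkord.
Qed.

(** The optimal parameter is l = y / K. *)
Lemma real_sq_bound (y K J : R) : 0 <= y -> 0 < K -> 0 <= J ->
  (forall l, 0 < l -> y <= l / 2 * K + (2 * l)^-1 * J) -> y ^+ 2 <= K * J.
Proof.
move=> y0 K0 J0 hl; have [->|yn0] := eqVneq y 0; first by rewrite expr0n/= mulr_ge0// ltW.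
have yp : 0 < y by rewrite lt_neqAle eq_sym yn0.
have := hl (y / K) (divr_gt0 yp K0).
have -> : y / K / 2 * K = y / 2 by field; rewrite gt_eqF.
have -> : (2 * (y / K))^-1 * J = K * J / (2 * y) by field; rewrite !gt_eqF.
move=> h; have : y / 2 <= K * J / (2 * y) by lra.
rewrite ler_pdivlMr ?mulr_gt0// => h2; nra.
Qed.

(** Obtained from h <= l / 2 + h^2 / (2 l) by optimising l. The integral of [k * h] may be infinite;
    only a number [y] below it is squared. *)
Lemma weighted_cauchy_schwarz (k h : X -> R) (y K : R) :
  measurable_fun setT k -> (forall x, 0 <= k x) -> measurable_fun setT h -> (forall x, 0 <= h x) ->
  0 <= y -> 0 < K -> (\int[m]_x (k x)%:E <= K%:E)%E ->
  (y%:E <= \int[m]_x (k x * h x)%:E)%E ->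
  ((y ^+ 2)%:E <= K%:E * \int[m]_x (k x * h x ^+ 2)%:E)%E.
Proof.
move=> mk k0 mh h0 y0 K0 kK yI.
have mkh2 : measurable_fun setT (fun x => k x * h x ^+ 2).
  by apply: measurable_funM => //; exact: measurable_funX.
have kh20 x : 0 <= k x * h x ^+ 2 by rewrite mulr_ge0// sqr_ge0.
have := @ge0_integralr_ge0 _ _ _ m _ kh20.
case J : (\int[m]_x (k x * h x ^+ 2)%:E)%E => [j| |] //; last first.
  by move=> _; rewrite gt0_muley ?lte_fin// leey.
rewrite lee_fin => j0; rewrite -EFinM lee_fin; apply: real_sq_bound => // l l0.
rewrite -lee_fin; apply: (le_trans yI).
have l2 : 0 <= l / 2 by rewrite divr_ge0// ltW.
have l2' : 0 <= (2 * l)^-1 by rewrite invr_ge0 mulr_ge0// ltW.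
apply: (@le_trans _ _ ((l / 2)%:E * \int[m]_x (k x)%:E + (2 * l)^-1%:E * \int[m]_x (k x * h x ^+ 2)%:E)%E).
  apply: ge0_integralr_le_lin => //.
  - exact: measurable_funM.
  - by move=> x; rewrite mulr_ge0.
  move=> x; have -> : l / 2 * k x + (2 * l)^-1 * (k x * h x ^+ 2) = k x * (l / 2 + (2 * l)^-1 * h x ^+ 2) by ring.
  rewrite ler_wpM2l// -subr_ge0.
  have -> : l / 2 + (2 * l)^-1 * h x ^+ 2 - h x = (2 * l)^-1 * (h x - l) ^+ 2 by field; rewrite gt_eqF.
  by rewrite mulr_ge0// sqr_ge0.
rewrite J EFinD -EFinM; apply: leeD => //.
by rewrite (EFinM (l / 2)); apply: lee_wpmul2l; rewrite ?lee_fin.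
Qed.

End integral_bounds.

Section gronwall.
Context (R : realType).
Local Notation mu := (@lebesgue_measure R).

Lemma integral_exp_itv (b r s : R) : 0 < b -> r < s ->
  (\int[mu]_(t in `[r, s]) (expR (- (b * t)))%:E = ((expR (- (b * r)) - expR (- (b * s))) / b)%:E)%E.
Proof.
move=> b0 rs; pose F (t : R) := - expR (- (b * t)) / b.
have dF (t : R) : is_derive t 1 F (expR (- (b * t))).
  rewrite /F; apply: is_derive_eq; rewrite /GRing.scale/=; field; rewrite gt_eqF//.
have cF : continuous F.
  move=> t; apply/differentiable_continuous/derivable1_diffP; exact: ex_derive.
have cE : continuous (fun t : R => expR (- (b * t))).
  move=> t; apply/differentiable_continuous/derivable1_diffP; exact: ex_derive.
rewrite (@continuous_FTC2 _ _ F)//.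
- by rewrite -EFinB; congr (_%:E); rewrite /F; field; rewrite gt_eqF.
- by apply: continuous_subspaceT.
- split.
  + by move=> t _; exact: ex_derive.
  + by apply: cvg_at_right_filter; exact: cF.
  + by apply: cvg_at_left_filter; exact: cF.
- by move=> t _; rewrite derive1E; exact: derive_val.
Qed.

(* Integrating against exp (- 2 c t) halves the integral term, which can then be
   absorbed: no regularity of [G] is needed. *)
Lemma gronwall (T c : R) (G h : measurableTypeR R -> R) : 0 < T -> 0 < c ->
  measurable_fun setT G -> measurable_fun setT h -> (forall t, 0 <= G t) -> (forall t, 0 <= h t) ->
  (\int[mu]_(r in `[0%R, T]) (G r)%:E < +oo)%E ->
  (forall t, 0 <= t <= T -> ((G t)%:E <= (h t)%:E + c%:E * \int[mu]_(r in `[0%R, t]) (G r)%:E)%E) ->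
  (\int[mu]_(r in `[0%R, T]) (G r)%:E <= (2 * expR (2 * c * T))%:E * \int[mu]_(r in `[0%R, T]) (h r)%:E)%E.
Proof.
move=> T0 c0 mG mh G0 h0 Goo GI.
pose I : measurableTypeR R -> R := \1_(`[0, T]%classic).
pose E (t : measurableTypeR R) := expR (- (2 * c * t)).
pose V : measurableTypeR R -> R := \1_(`[0, +oo[%classic).
(* [V] applied to the difference expresses r <= t in a jointly measurable way. *)
pose F (z : measurableTypeR R * measurableTypeR R) := I z.1 * E z.1 * (I z.2 * V (z.1 - z.2) * G z.2).
have I0 t : 0 <= I t by rewrite /I indicE.
have V0 t : 0 <= V t by rewrite /V indicE.
have E0 t : 0 <= E t by exact: expR_ge0.
have F0 z : 0 <= F z by rewrite !mulr_ge0.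
have mI : measurable_fun setT I by exact: measurable_indic.
have mE : measurable_fun setT E.
  apply: (measurableT_comp (@measurable_expR R)).
  apply: (@measurable_funN _ _ _ _ (fun r : measurableTypeR R => 2 * c * r)).
  by apply: measurable_funM; [exact: measurable_cst|exact: measurable_id].
have mV : measurable_fun setT (fun z : measurableTypeR R * measurableTypeR R => V (z.1 - z.2)).
  apply: (@measurableT_comp _ _ _ _ _ _ V); first exact: measurable_indic.
  by apply: measurable_funB; [exact: measurable_fst|exact: measurable_snd].
have mF : measurable_fun setT F.
  apply: measurable_funM.
    by apply: (measurable_comp_fst (f := fun t => I t * E t)); exact: measurable_funM.
  apply: measurable_funM; last exact: (measurable_comp_snd mG).
  by apply: measurable_funM => //; exact: (measurable_comp_snd mI).
pose A := (\int[mu]_t (I t * E t * G t)%:E)%E.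
have mIEG : measurable_fun setT (fun t => I t * E t * G t) by do 2?apply: measurable_funM.
have IEG0 t : 0 <= I t * E t * G t by rewrite !mulr_ge0.
have GE : (\int[mu]_(r in `[0%R, T]) (G r)%:E = \int[mu]_r (I r * G r)%:E)%E by rewrite -integral_indicM.
have hE : (\int[mu]_(r in `[0%R, T]) (h r)%:E = \int[mu]_r (I r * h r)%:E)%E by rewrite -integral_indicM.
have mIG : measurable_fun setT (fun t => I t * G t) by exact: measurable_funM.
have mIh : measurable_fun setT (fun t => I t * h t) by exact: measurable_funM.
have IG0 t : 0 <= I t * G t by rewrite mulr_ge0.
have Ih0 t : 0 <= I t * h t by rewrite mulr_ge0.
have E1 t : I t * E t <= I t.
  rewrite /I indicE; case: (boolP (t \in _)); rewrite ?mul0r// inE/= in_itv/= => /andP[t0 _].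
  by rewrite mul1r /E -expR0 ler_expR oppr_le0 !mulr_ge0// ltW.
have Aoo : (A < +oo)%E.
  apply: le_lt_trans Goo; rewrite GE; apply: ge0_le_integralr => // t.
  by rewrite ler_wpM2r.
have A0 : (0 <= A)%E by exact: ge0_integralr_ge0.
have step1 : (A <= \int[mu]_t (I t * h t)%:E + c%:E * \int[mu \x mu]_z (F z)%:E)%E.
  have mTL : measurable_fun setT (fun x : measurableTypeR R => \int[mu]_y (F (x, y))%:E)%E.
    by apply: (measurable_tonelli_line (f := fun z => (F z)%:E)) => //; exact/measurable_EFinP.
  rewrite (@tonelli_line _ (fun z => (F z)%:E)) => //; last exact/measurable_EFinP.
  have TL0 x : (0 <= \int[mu]_y (F (x, y))%:E)%E by apply: ge0_integralr_ge0 => y.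
  rewrite -ge0_integralZl//; last by rewrite lee_fin ltW.
  rewrite -ge0_integralD//; last 4 first.
  - by move=> t _; rewrite lee_fin.
  - exact/measurable_EFinP.
  - by move=> t _; rewrite mule_ge0// lee_fin ltW.
  - exact: measurable_funeM.
  apply: ge0_le_integral => //.
  - by move=> t _; rewrite lee_fin.
  - exact/measurable_EFinP.
  - by apply: emeasurable_funD; [exact/measurable_EFinP|exact: measurable_funeM].
  move=> t _; have [tI|tI] := boolP (0 <= t <= T); last first.
    rewrite {1}/I indicE memNset ?mul0r/=; last by rewrite in_itv/=; exact/negP.
    by rewrite adde_ge0 ?lee_fin// mule_ge0// lee_fin ltW.
  have It : I t = 1 by rewrite /I indicE mem_set//= in_itv.
  have -> : (\int[mu]_y (F (t, y))%:E = (E t)%:E * \int[mu]_(r in `[0%R, t]) (G r)%:E)%E.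
    rewrite -integral_indicM.
    have -> : ((E t)%:E * \int[mu]_r (\1_(`[0, t]%classic) r * G r)%:E =
       \int[mu]_r (E t * (\1_(`[0, t]%classic) r * G r))%:E)%E.
      apply/esym; apply: ge0_integralrZ => //.
        by apply: measurable_funM => //; exact: measurable_indic.
      by move=> r; rewrite mulr_ge0// indicE.
    apply: eq_integral => r _; rewrite /F/= It mul1r; congr (_%:E); congr (_ * (_ * _)).
    rewrite /I /V !indicE -natrM mulnb; congr ((nat_of_bool _)%:R).
    case/andP: tI => t0 tT.
    apply/andP/idP => [[]|]; rewrite !inE/= !in_itv/= andbT subr_ge0.
      by move=> /andP[-> _] ->.
    by move=> /andP[-> rt]; rewrite rt (le_trans rt).
  rewrite muleCA; have := GI t tI; set Q := (\int[mu]_(r in `[0%R, t]) _)%E => hGI.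
  rewrite It !mul1r EFinM; apply: (le_trans (lee_wpmul2l _ hGI)); first by rewrite lee_fin.
  have Q0 : (0 <= Q)%E by apply: integral_ge0 => r _; rewrite lee_fin.
  rewrite ge0_muleDr ?lee_fin ?mule_ge0 ?lee_fin ?(ltW c0)//; apply: leeD => //.
  rewrite -EFinM lee_fin -[leRHS]mul1r ler_wpM2r//.
  by have := E1 t; rewrite It mul1r.
have step2 : (\int[mu \x mu]_z (F z)%:E <= A * ((2 * c)^-1)%:E)%E.
  have c2 : 0 < 2 * c by rewrite mulr_gt0.
  rewrite -(@tonelli_line_swap _ (fun z => (F z)%:E)); last 2 first.
  - exact/measurable_EFinP.
  - by move=> z; rewrite lee_fin.
  apply: (@tonelli_line_le _ (fun z => F (z.2, z.1)) (fun t => I t * E t * G t)) => //.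
  - by apply: (measurableT_comp mF); exact: measurable_swap.
  - by rewrite lee_fin invr_ge0 ltW.
  move=> r; rewrite /F/=.
  have [rI|rI] := boolP (0 <= r <= T); last first.
    have -> : I r = 0 by rewrite /I indicE memNset//= in_itv/=; exact/negP.
    under eq_integral do rewrite !mul0r mulr0.
    by rewrite integral0 !mul0r mul0e.
  have -> : I r = 1 by rewrite /I indicE mem_set//= in_itv.
  case/andP: rI => r0 rT.
  (* For fixed r the exponential integrates over t >= r to at most e^(-2 c r) / (2 c). The range is
     enlarged to [T + 1] because [integral_exp_itv] needs a nondegenerate interval, also for r =
     T. *)
  apply: (@le_trans _ _ (\int[mu]_t (G r * (\1_(`[r, T + 1]%classic) t * E t))%:E)%E).
    apply: ge0_le_integralr => //.
    - apply: measurable_funM; first exact: measurable_funM.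
      apply: measurable_funM => //; apply: measurable_funM => //.
      apply: (@measurableT_comp _ _ _ _ _ _ V); first exact: measurable_indic.
      exact: measurable_funB.
    - by move=> t; rewrite !mulr_ge0.
    - by apply: measurable_funM => //; apply: measurable_funM => //; exact: measurable_indic.
    move=> t; rewrite mul1r.
    rewrite [X in X <= _](_ : _ = G r * (I t * V (t - r) * E t)); last by ring.
    rewrite ler_wpM2l// ler_wpM2r// /I /V !indicE -natrM mulnb ler_nat.
    case: (boolP (_ && _)) => // /andP[]; rewrite !inE/= !in_itv/= andbT subr_ge0 => /andP[t0 tT] rt.
    by rewrite mem_set//= in_itv/= rt/= (le_trans tT)// lerDl.
  rewrite ge0_integralrZ//; last 2 first.
  - by apply: measurable_funM => //; exact: measurable_indic.
  - by move=> t; rewrite mulr_ge0// indicE.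
  rewrite (integral_indicM _ E) integral_exp_itv//; last by rewrite (le_lt_trans rT)// ltrDl.
  rewrite -!EFinM lee_fin mul1r -/(E r) [leRHS](_ : _ = G r * (E r / (2 * c))); last by ring.
  rewrite ler_wpM2l// ler_wpM2r ?invr_ge0 ?(ltW c2)// gerBl.
  exact: expR_ge0.
(* The two estimates combine to A <= J + A / 2, with J the integral of [I t * h t]; finiteness of
   [A] permits the subtraction. *)
have step3 : (A <= 2%:E * \int[mu]_t (I t * h t)%:E)%E.
  move: A0 Aoo step1 step2; have := @ge0_integralr_ge0 _ _ _ mu _ Ih0.
  case: (\int[mu]_t (I t * h t)%:E)%E => [J| |] //; last by move=> *; rewrite gt0_muley ?lte_fin// leey.
  case: A => [a| |] // J0 a0 _ h1 h2.
  have := le_trans h1 (leeD (lexx J%:E) (lee_wpmul2l _ h2)).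
  rewrite -!EFinM -EFinD !lee_fin => /(_ (ltW c0)).
  have -> : c * (a * (2 * c)^-1) = a / 2 by field; rewrite gt_eqF.
  lra.
rewrite GE hE; apply: (@le_trans _ _ ((expR (2 * c * T))%:E * A)%E).
  rewrite -ge0_integralrZ ?expR_ge0//; apply: ge0_le_integralr => //.
  - exact: measurable_funM.
  move=> t; rewrite mulrA ler_wpM2r// /I indicE; case: (boolP (t \in _)); rewrite ?mul0r ?mulr0// inE/= in_itv/= => /andP[_ tT].
  rewrite mul1r /E -expRD -expR0 ler_expR -mulrBr.
  by rewrite !mulr_ge0 ?(ltW c0)// subr_ge0.
by rewrite [2 * expR _]mulrC (EFinM (expR _) 2) -muleA; apply: lee_wpmul2l.
Qed.

End gronwall.

(** * The stochastic convolution *)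

Section stochastic_term.
Context (R : realType) (d : nat) (D : convex_polygonal_domain R d) (phi : nat -> L2 D).
Hypothesis phi_orth : forall j k, inner (phi j) (phi k) = (j == k)%:R.
Hypothesis phi_complete : forall g, (forall k, inner g (phi k) = 0) -> hnorm g = 0.

(** Stated through coefficients, because the value of [diag_op] is a representative chosen among
    many. It serves to compute A^(-rho) Q^(1/2) phi_k. *)
Lemma diag_op_single (m : nat -> R) (v : L2 D) (c : R) k :
  (forall i, inner v (phi i) = c * (i == k)%:R) ->
  forall i, inner (diag_op phi m v) (phi i) = m k * c * (i == k)%:R.
Proof.
move=> vE i; rewrite (inner_diag_op phi_orth); last first.
  apply: (diag_dom_le phi_orth (M := (m k * c) ^+ 2)) => n.
  rewrite (eq_bigr (fun j : 'I_n => (m k * c) ^+ 2 * (val j == k)%:R)); last first.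
    by move=> j _; rewrite vE; case: eqP => [->|_]; rewrite ?mulr1// !mulr0 expr0n.
  rewrite -mulr_sumr -[leRHS]mulr1 ler_wpM2l ?sqr_ge0//.
  have [kn|kn] := ltnP k n.
    rewrite (bigD1 (Ordinal kn))//= eqxx big1 ?addr0// => j jk.
    by rewrite -val_eqE/= in jk; rewrite (negbTE jk).
  by rewrite big1// => j _; rewrite ltn_eqF// (leq_trans (ltn_ord j)).
by rewrite vE; case: eqP => [->|_]; rewrite ?mulr1// !mulr0.
Qed.

(** The norm of A^(-rho) Q^(1/2) phi_k is at least its coefficient along phi_k, whose square is the
    k-th term. *)
Lemma hs_norm2_bound (lam Lam : nat -> R) (rho : R) : (forall k, 0 <= Lam k) ->
  (hs_norm2 phi (fun v => Apow lam phi (- rho) (diag_op phi (fun k => Num.sqrt (Lam k)) v)) < +oo)%E ->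
  exists2 S : R, 0 <= S & forall n, \sum_(k < n) Lam k * (lam k `^ (- rho)) ^+ 2 <= S.
Proof.
move=> hLam hs.
pose B v := Apow lam phi (- rho) (diag_op phi (fun k => Num.sqrt (Lam k)) v).
have {}hs : (\sum_(k <oo) ((hnorm (B (phi k))) ^+ 2)%:E < +oo)%E by exact: hs.
pose h := (\sum_(k <oo) ((hnorm (B (phi k))) ^+ 2)%:E)%E.
have h0 : (0 <= h)%E by apply: nneseries_ge0 => k _ _; rewrite lee_fin sqr_ge0.
have hfin : h \is a fin_num by rewrite ge0_fin_numE.
exists (fine h) => [|n]; first exact: fine_ge0.
rewrite -lee_fin fineK//; apply: (@le_trans _ _ (\sum_(0 <= k < n) ((hnorm (B (phi k))) ^+ 2)%:E)%E); last first.
  by apply: nneseries_lim_ge => k _ _; rewrite lee_fin sqr_ge0.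
rewrite big_mkord sumEFin lee_fin; apply: ler_sum => k _.
have := @diag_op_single (fun k => lam k `^ - rho) (diag_op phi (fun k => Num.sqrt (Lam k)) (phi k)) (Num.sqrt (Lam k) * 1) k.
move=> /(_ _ k); rewrite eqxx !mulr1 -/(Apow lam phi (- rho) _) -/(B (phi k)) => H.
have {}H : inner (B (phi k)) (phi k) = lam k `^ (- rho) * Num.sqrt (Lam k).
  apply: H => i; rewrite (@diag_op_single _ _ 1 k) ?mulr1// => j.
  by rewrite phi_orth eq_sym mul1r.
have := cauchy_schwarz (B (phi k)) (phi k); rewrite (hnorm_phi phi_orth) mulr1 H => le.
rewrite -[X in X * _](sqr_sqrtr (hLam k)) -exprMn mulrC -[_ ^+ 2]real_normK ?num_real//.
by rewrite lerXn2r ?nnegrE ?hnorm_ge0// mulrC.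
Qed.

Context (dO : measure_display) (Om : measurableType dO) (P : probability Om R).
Context (alpha s Hu T theta kappa : R).
Hypotheses (halpha : 0 < alpha < 1) (hs : 0 < s < 1) (hH : 0 < Hu < 1) (hT : 0 < T)
  (htheta : pi / 2 < theta < pi) (hkappa : 0 < kappa).
Context (lam Lam : nat -> R) (W : nat -> R -> {RV P >-> R}).
Hypotheses (hlam : forall k, 0 < lam k) (hLam : forall k, 0 <= Lam k) (hW : forall k, fBm Hu (W k)).

Local Notation Ek := (Ek alpha s theta kappa lam).

Let s0 : 0 < s. Proof. by case/andP: hs. Qed.

Lemma Ek_bound (a beta : R) : 0 <= beta <= s -> alpha * beta / s <= a -> 0 < a < 1 ->
  exists2 C : R, 0 <= C &
  (forall k t, 0 < t <= T -> `|Ek k t| <= C * lam k `^ (- beta) * t `^ (- a)) /\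
  (forall k x y, 0 < y -> y < x -> x <= T ->
    `|Ek k x - Ek k y| <= C * lam k `^ (- beta) * (y `^ (- a) * ((x - y) / y))).
Proof.
move=> /andP[b0 bs] ab ha.
have hb : 0 <= beta / s <= 1 by rewrite divr_ge0 ?(ltW s0)//= ler_pdivrMr// mul1r.
have hab : alpha * (beta / s) <= a by rewrite mulrA.
have [C1 C10 H1] := Ekernel_bound halpha htheta hkappa hb ha hab hT.
have [C2 C20 H2] := Ekernel_lip halpha htheta hkappa hb ha hab hT.
have lb k : (lam k `^ s) `^ (beta / s) = lam k `^ beta.
  by rewrite -powRrM mulrCA divff ?mulr1// gt_eqF.
have move_pow k X Y : lam k `^ beta * X <= Y -> X <= lam k `^ (- beta) * Y.
  move=> h; have l0 : 0 < lam k `^ beta by rewrite powR_gt0.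
  by rewrite powRN mulrC ler_pdivlMr// mulrC.
exists (C1 + C2); first exact: addr_ge0.
split=> [k t tT|k x y y0 yx xT].
  have := H1 _ t (powR_gt0 s (hlam k)) tT; rewrite lb => /move_pow /le_trans; apply.
  rewrite mulrA [_ * C1]mulrC -!mulrA ler_wpM2r ?mulr_ge0 ?powR_ge0//.
  by rewrite lerDl.
have := H2 _ x y (powR_gt0 s (hlam k)) y0 yx xT; rewrite lb => /move_pow /le_trans; apply.
rewrite mulrA [_ * C2]mulrC -!mulrA ler_wpM2r ?mulr_ge0 ?powR_ge0 ?invr_ge0 ?subr_ge0 ?(ltW y0) ?(ltW yx)//.
by rewrite lerDr.
Qed.

Lemma Ek_bounded : exists2 C : R, 0 < C & forall k t, 0 < t <= T -> `|Ek k t| <= C.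
Proof.
have [M HM] := Ekernel_bounded halpha htheta hkappa hT.
exists (`|M| + 1) => [|k t tT]; first by rewrite ltr_wpDl.
have := HM _ t (powR_gt0 s (hlam k)) tT; have := ler_norm M; rewrite /Defs.Ek; lra.
Qed.

(** A coordinate is bounded by the norm, so E |(Z, phi_k) - X_k|^2 is at most the mean square error
    of the partial sums, which tends to 0. The factor 2 comes from splitting (Z, phi_k) instead of
    identifying it with X_k almost surely. *)
Lemma stochastic_convolution_coord t Z : stochastic_convolution alpha s theta kappa Hu lam phi Lam W t Z ->
  forall k, exists2 X : {RV P >-> R},
    wiener_integral Hu (W k) t (fun r => Num.sqrt (Lam k) * Ek k (t - r)) X &
    (\int[P]_w (inner (Z w) (phi k) ^+ 2)%:E <= 2%:E * \int[P]_w (X w ^+ 2)%:E)%E.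
Proof.
move=> [mZ [X [hX ZX]]] k; exists (X k); first exact: hX.
have mZk : measurable_fun setT (fun w => inner (Z w) (phi k)) by exact: measurable_inner.
have mXk : measurable_fun setT (X k : _ -> R) by [].
have mD : measurable_fun setT (fun w => inner (Z w) (phi k) - X k w) by exact: measurable_funB.
have E0 : (\int[P]_w ((inner (Z w) (phi k) - X k w) ^+ 2)%:E <= 0)%E.
  rewrite -(cvg_lim _ ZX)//; apply: lime_ge; first exact: cvgP ZX.
  (* From n = k + 1 on, the partial sum contains the term [X k]. *)
  exists k.+1 => // n /= kn; rewrite unlock; apply: ge0_le_integralr.
  - exact: measurable_funX.
  - by move=> w; exact: sqr_ge0.
  - apply: measurable_funX; apply: (measurable_hnorm_coord phi_orth phi_complete) => j.
    under eq_fun do rewrite innerBl inner_suml.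
    apply: measurable_funB; first exact: measurable_inner.
    by apply: measurable_sum => i; under eq_fun do rewrite innerZl; exact: measurable_funM.
  move=> w; have -> : inner (Z w) (phi k) - X k w = inner (Z w - \sum_(i < n) X i w *: phi i) (phi k).
    by rewrite innerBl (inner_lin_comb phi_orth (fun i => X i w)) kn mulr1.
  rewrite -real_normK ?num_real// lerXn2r ?nnegrE ?hnorm_ge0//.
  by apply: (le_trans (cauchy_schwarz _ _)); rewrite (hnorm_phi phi_orth) mulr1.
apply: (@le_trans _ _ (2%:E * \int[P]_w (X k w ^+ 2)%:E +
   2%:E * \int[P]_w ((inner (Z w) (phi k) - X k w) ^+ 2)%:E)%E).
  apply: ge0_integralr_le_lin => //; try exact: measurable_funX; try (by move=> w; exact: sqr_ge0).
  by move=> w; have := sqr_ge0 (inner (Z w) (phi k) - 2 * X k w); nra.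
rewrite -[leRHS]adde0; apply: leeD => //.
by rewrite -(mule0 2%:E); apply: lee_wpmul2l.
Qed.

(** The gain lam_k^(-beta) sits in the amplitude [A] of [fBm_norm2_bound], so it comes out squared;
    8 is the product of the factors 2 and 4 of the two preceding estimates. *)
Lemma stochastic_convolution_bound (a beta : R) : 0 <= beta <= s -> alpha * beta / s <= a -> 0 < a < Hu ->
  exists2 C : R, 0 <= C & forall t Z k, 0 < t <= T ->
    stochastic_convolution alpha s theta kappa Hu lam phi Lam W t Z ->
    (\int[P]_w (inner (Z w) (phi k) ^+ 2)%:E <= (C * (Lam k * (lam k `^ (- beta)) ^+ 2))%:E)%E.
Proof.
move=> hb hab /andP[a0 aH]; have H1 : Hu < 1 by case/andP: hH.
have [C1 C10 [hE hL]] := Ek_bound hb hab (introT andP (conj a0 (lt_trans aH H1))).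
have [C2 C20 HC2] := fBm_norm2_bound hH (introT andP (conj (ltW a0) aH)) hT.
have [M M0 HM] := Ek_bounded.
exists (8 * C2 * C1 ^+ 2) => [|t Z k tT hZ]; first by rewrite !mulr_ge0// sqr_ge0.
have [X hX /le_trans] := stochastic_convolution_coord hZ k; apply.
case/andP: (tT) => t0 tT'; set q := Num.sqrt (Lam k); have q0 : 0 <= q by exact: sqrtr_ge0.
set l := lam k `^ (- beta); have l0 : 0 <= l by exact: powR_ge0.
(* At x = t the kernel is evaluated at time 0, which [Ek_bounded] does not cover; its value there is
   added to the bound. *)
have XM := wiener_second_moment hH (hW k) (M := q * (M + `|Ek k 0|)) t0 hX.
have {XM} : ('E_P[(fun w => X w ^+ 2)%R] <= 4%:E * (C2 * (q * (C1 * l)) ^+ 2)%:E)%E.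
  apply: (le_trans (XM _)).
    move=> x /andP[x0 xt]; rewrite normrM ger0_norm// ler_wpM2l//.
    have [xt'|xt'] := eqVneq x t; first by rewrite xt' subrr lerDr ltW.
    have tx : 0 < t - x by rewrite subr_gt0 lt_neqAle xt'.
    apply: (@le_trans _ _ M); last by rewrite lerDl.
    by apply: HM; rewrite tx/= (le_trans _ tT')// gerBl.
  apply: lee_wpmul2l => //; apply: HC2 => //.
  - by case: hX.
  - by rewrite !mulr_ge0.
  - move=> r /andP[r0 rt]; have -> : t - (t - r) = r by ring.
    rewrite normrM (ger0_norm q0) -mulrA ler_wpM2l//; apply: hE.
    by rewrite r0 (le_trans rt).
  move=> x y y0 yx xt; have -> : t - (t - x) = x by ring.
  have -> : t - (t - y) = y by ring.
  rewrite -mulrBr normrM (ger0_norm q0) -[leRHS]mulrA ler_wpM2l//.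
  by apply: hL => //; exact: le_trans xt tT'.
rewrite unlock => h; apply: (le_trans (lee_wpmul2l _ h)) => //.
rewrite -!EFinM lee_fin le_eqVlt; apply/orP; left; apply/eqP.
by rewrite -(sqr_sqrtr (hLam k)) -/q; ring.
Qed.

End stochastic_term.

(** * Moments of the mild solution *)

Section mild_moment.
Context (R : realType) (d : nat) (D : convex_polygonal_domain R d) (phi : nat -> L2 D).
Hypothesis phi_orth : forall j k, inner (phi j) (phi k) = (j == k)%:R.
Hypothesis phi_complete : forall g, (forall k, inner g (phi k) = 0) -> hnorm g = 0.
Context (dO : measure_display) (Om : measurableType dO) (P : probability Om R).
Context (alpha s Hu T theta kappa : R).
Hypotheses (halpha : 0 < alpha < 1) (hs : 0 < s < 1) (hH : 0 < Hu < 1) (hT : 0 < T)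
  (htheta : pi / 2 < theta < pi) (hkappa : 0 < kappa).
Context (lam Lam : nat -> R) (W : nat -> R -> {RV P >-> R}).
Hypotheses (hlam : forall k, 0 < lam k) (hLam : forall k, 0 <= Lam k) (hW : forall k, fBm Hu (W k)).
Context (f : L2 D -> L2 D) (Cf : R).
Hypotheses (Cf0 : 0 < Cf) (f_growth : forall v, hnorm (f v) <= Cf * (1 + hnorm v))
  (f_lip : forall v v', hnorm (f v - f v') <= Cf * hnorm (v - v')).
Context (u : R -> Om -> L2 D).
Hypothesis hu : mild_solution alpha s theta kappa Hu T lam phi Lam W f u.
Context (rho S : R).
Hypotheses (hrho : 0 <= rho <= s) (hrhoH : alpha * rho / s < Hu) (S0 : 0 <= S)
  (hS : forall n, \sum_(k < n) Lam k * (lam k `^ (- rho)) ^+ 2 <= S).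
Local Notation mu := (@lebesgue_measure R).
Local Notation Ek := (Ek alpha s theta kappa lam).
Local Notation Rsol := (Rsol alpha s theta kappa lam phi).
Local Notation stoch := (stochastic_convolution alpha s theta kappa Hu lam phi Lam W).

Let s0 : 0 < s. Proof. by case/andP: hs. Qed.

(** Cut off outside [0, T], where nothing is known of [u], so as to be measurable on the whole
    product. *)
Let G (z : measurableTypeR R * Om) : R := \1_(`[0, T]%classic) z.1 * hnorm (f (u z.1 z.2)).

Let G0 z : 0 <= G z. Proof. by rewrite mulr_ge0 ?hnorm_ge0// indicE. Qed.

Let GE t w : 0 <= t <= T -> G (t, w) = hnorm (f (u t w)).
Proof. by move=> tT; rewrite /G indicE mem_set ?mul1r//= in_itv. Qed.

Let mG : measurable_fun setT G.
Proof.
pose A : set (measurableTypeR R * Om) := `[0, T]%classic `*` setT.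
have mA : measurable A by apply: measurableX => //; exact: measurable_itv.
have : measurable_fun A ((fun v => hnorm (f v)) \o (fun z : measurableTypeR R * Om => u z.1 z.2)).
  apply: (hmeasurable_lipschitz phi_orth phi_complete (L := Cf) mA (mild_measurable hu)) => v v'.
  have := f_lip v v'; have := ler_hnormB (f v') (f v); rewrite (hnormB (f v')).
  have := ler_hnormB (f v) (f v'); rewrite ler_norml => h1 h2 h3; apply/andP; split; lra.
move=> /(measurable_restrictT _ mA).1; congr (measurable_fun _ _); apply/funext => -[r w].
rewrite patchE /G /= indicE; case: (boolP (r \in _)) => rI.
  by rewrite mem_set ?mul1r//; split => //; move: rI; rewrite inE.
by rewrite memNset ?mul0r// => -[/= h _]; move/negP: rI; apply; rewrite inE.
Qed.

Let mut t : 0 <= t <= T -> hmeasurable setT (u t).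
Proof.
move=> tT v r; have := measurable_xsection t (mild_measurable hu v r).
congr (measurable _); apply/seteqP; split => w; rewrite /xsection/= inE/=.
  by move=> [_].
by move=> [_ h]; split => //; split => //; rewrite in_itv.
Qed.

Let mGw w : measurable_fun setT (fun r : measurableTypeR R => G (r, w)).
Proof. exact: measurableT_comp mG (pair2_measurable w). Qed.

Let mGt t : measurable_fun setT (fun w => G (t, w)).
Proof. exact: measurableT_comp mG (pair1_measurable t). Qed.

Let V (x : measurableTypeR R) : R := \1_(`[0, +oo[%classic) x.
Let mV : measurable_fun setT V. Proof. exact: measurable_indic. Qed.
Let V0 x : 0 <= V x. Proof. by rewrite /V indicE. Qed.

(** The integral of |f(u)| up to time t. The constraint r <= t is written [V (t - r)], so that joint
    measurability in time and chance follows from Tonelli's theorem. *)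
Let Y (z : measurableTypeR R * Om) : \bar R := (\int[mu]_r (V (z.1 - r) * G (r, z.2))%:E)%E.

Let Y0 z : (0 <= Y z)%E. Proof. by apply: ge0_integralr_ge0 => r; rewrite mulr_ge0. Qed.

Let mY : measurable_fun setT Y.
Proof.
pose F (q : (measurableTypeR R * Om) * measurableTypeR R) := (V (q.1.1 - q.2) * G (q.2, q.1.2))%:E.
apply: (@measurable_fun_fubini_tonelli_F _ _ _ _ _ mu F); last by move=> q; rewrite lee_fin mulr_ge0.
apply/measurable_EFinP; apply: measurable_funM.
  apply: (measurableT_comp mV); apply: measurable_funB; last exact: measurable_snd.
  by apply: (@measurableT_comp _ _ _ _ _ _ fst) => //; exact: measurable_fst.
apply: (measurableT_comp mG); apply/measurable_fun_pairP; split; first exact: measurable_snd.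
exact: (measurableT_comp measurable_snd measurable_fst).
Qed.

Let YE t w : 0 <= t <= T -> Y (t, w) = (\int[mu]_(r in `[0%R, t]) (G (r, w))%:E)%E.
Proof.
move=> /andP[t0 tT]; rewrite -integral_indicM; apply: eq_integral => r _; congr (_%:E).
rewrite /V /G !indicE /=; case: (boolP (r \in `[0, T]%classic)) => rI; last by rewrite !mul0r !mulr0.
move: rI; rewrite inE/= in_itv/= => /andP[r0 rT]; congr (_ * _); congr (nat_of_bool _)%:R.
by apply/idP/idP; rewrite !inE/= !in_itv/= ?andbT subr_ge0 r0.
Qed.

Let good w := (\int[mu]_(r in `[0%R, T]) (G (r, w))%:E < +oo)%E.

Let ae_good : {ae P, forall w, good w}.
Proof.
have := mild_integrable hu; apply: filterS => w; rewrite /good; congr (_ < _)%E.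
by apply: eq_integral => r; rewrite inE/= in_itv/= => hr; rewrite GE.
Qed.

Let Yfin t w : t <= T -> good w -> Y (t, w) \is a fin_num.
Proof.
move=> tT gw; rewrite ge0_fin_numE//; apply: le_lt_trans gw.
rewrite -integral_indicM; apply: ge0_le_integralr.
- apply: measurable_funM => //; apply: (measurableT_comp mV); exact: measurable_funB.
- by move=> r; rewrite mulr_ge0.
- by apply: measurable_funM => //; exact: measurable_indic.
move=> r; rewrite /V /G !indicE /=; case: (boolP (r \in `[0, T]%classic)) => rI; last by rewrite !mul0r !mulr0.
by rewrite ler_wpM2r ?mulr_ge0 ?hnorm_ge0// ler_nat leq_b1.
Qed.

Let bochner_bound (m : nat -> R) (kap : R -> R) t w v n : 0 < t <= T ->
  bochner_integral `]0, t[ (fun r => Rsol (t - r) (f (u r w))) v ->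
  measurable_fun setT (kap : measurableTypeR R -> R) ->
  (forall r, 0 < r <= T -> 0 <= kap r) ->
  (forall k r, 0 < r <= T -> `|m k| * `|Ek k r| <= kap r) ->
  ((Num.sqrt (\sum_(i < n) (m i * inner v (phi i)) ^+ 2))%:E <=
   \int[mu]_r (\1_(`]0%R, t[%classic) r * kap (t - r)%R * G (r, w))%:E)%E.
Proof.
move=> /andP[t0 tT] bv mk k0 mE.
have [C C0 HC] := Ek_bounded s halpha hT htheta hkappa hlam.
have tI r : `]0, t[%classic r -> 0 <= r <= T.
  by rewrite /= in_itv/= => /andP[r0 rt]; rewrite (ltW r0) (le_trans (ltW rt)).
have tI' r : 0 < r < t -> 0 < r <= T by move=> /andP[r0 rt]; rewrite r0 (le_trans (ltW rt)).
apply: (le_trans (@diag_bochner_bound _ _ _ _ phi_orth phi_complete m Ek (fun r => f (u r w)) kap t v n t0 bv _ _ _ _ _)).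
- apply: (eq_measurable_fun (fun r => G (r, w))) => [r|]; last exact: measurable_funTS.
  by rewrite inE => /tI hr; rewrite GE.
- by apply: measurable_funTS; apply: (measurableT_comp mk); exact: measurable_funB.
- by move=> r /tI'; exact: k0.
- by move=> r /tI' hr; exists C => k; exact: HC.
- by move=> k r /tI'; exact: mE.
rewrite -integral_indicM le_eqVlt; apply/orP; left; apply/eqP; apply: eq_integral => r _; congr (_%:E).
rewrite indicE; case: (boolP (r \in _)) => [|_]; last by rewrite !mul0r.
by rewrite inE => /tI hr; rewrite GE// !mul1r.
Qed.

(** The drift estimate with weights [m] = 1 and a constant kernel bound, which is why the E_k must
    be bounded uniformly in k down to time 0. *)
Let mild_norm_bound : exists2 C, 0 < C & forall t, 0 < t <= T -> exists2 Z, stoch t Z &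
  {ae P, forall w, ((hnorm (u t w))%:E <= (hnorm (Z w))%:E + C%:E * Y (t, w))%E}.
Proof.
have [C C0 HC] := Ek_bounded s halpha hT htheta hkappa hlam.
exists C => // t tT; case/andP: (tT) => t0 tT'.
have tT0 : 0 <= t <= T by rewrite ltW.
have [Z hZ aeZ] := mild_eq hu tT0; exists Z => //.
apply: filterS aeZ => w [v bv uv].
have nu : hnorm (u t w) <= hnorm (Z w) + hnorm v.
  by apply: (le_trans (ler_hnormB _ (v + Z w))); rewrite uv addr0 addrC; exact: hnormD.
apply: (@le_trans _ _ (hnorm (Z w) + hnorm v)%:E) => //; rewrite EFinD; apply: leeD => //.
have vn n : ((Num.sqrt (\sum_(i < n) (1 * inner v (phi i)) ^+ 2))%:E <= C%:E * Y (t, w))%E.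
  apply: (le_trans (@bochner_bound (fun=> 1) (fun=> C) t w v n tT bv _ _ _)).
  - exact: measurable_cst.
  - by move=> r _; exact: ltW.
  - by move=> k r hr; rewrite normr1 mul1r; exact: HC.
  rewrite -ge0_integralrZ ?(ltW C0)//; last 2 first.
  - apply: measurable_funM => //; apply: (measurableT_comp mV); exact: measurable_funB.
  - by move=> r; rewrite mulr_ge0.
  apply: ge0_le_integralr.
  - apply: measurable_funM => //; apply: measurable_funM; last exact: measurable_cst.
    exact: measurable_indic.
  - by move=> r; apply: mulr_ge0; [apply: mulr_ge0; [rewrite indicE|exact: ltW]|exact: G0].
  - apply: measurable_funM => //; apply: measurable_funM => //; apply: (measurableT_comp mV); exact: measurable_funB.
  move=> r; rewrite [X in _ <= X]mulrA [C * _]mulrC ler_wpM2r// ler_wpM2r ?(ltW C0)//.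
  rewrite /V !indicE; case: (boolP (r \in _)) => [|_]; last by rewrite ler0n.
  by rewrite inE/= in_itv/= => /andP[r0 rt]; rewrite mem_set//= in_itv/= andbT subr_ge0 ltW.
move: vn (Y0 (t, w)); case: (Y (t, w)) => [y| |] // vn; last by move=> _; rewrite gt0_muley ?lte_fin// leey.
rewrite lee_fin -EFinM lee_fin => y0.
have Cy0 : 0 <= C * y by rewrite mulr_ge0// ltW.
rewrite -(@ler_pXn2r _ 2) ?nnegrE ?hnorm_ge0//.
apply: (hnorm_sq_le phi_orth phi_complete) => n.
have := vn n; rewrite -EFinM lee_fin; under eq_bigr do rewrite mul1r.
move=> h; rewrite -[leLHS]sqr_sqrtr; last by apply: sumr_ge0 => i _; exact: sqr_ge0.
by rewrite lerXn2r ?nnegrE ?sqrtr_ge0.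
Qed.

Lemma integral_sum_bound (g : nat -> Om -> R) (c : nat -> R) n :
  (forall k, measurable_fun setT (g k)) -> (forall k w, 0 <= g k w) ->
  (forall k, \int[P]_w (g k w)%:E <= (c k)%:E)%E ->
  (\int[P]_w (\sum_(k < n) g k w)%:E <= (\sum_(k < n) c k)%:E)%E.
Proof.
move=> mg g0 gc; elim: n => [|n IH].
  by under eq_integral do rewrite big_ord0; rewrite integral0 big_ord0.
under eq_integral do rewrite big_ord_recr/=; rewrite big_ord_recr/= ge0_integralrD//.
- by rewrite EFinD; apply: leeD.
- by apply: measurable_sum => k.
- by move=> w; apply: sumr_ge0.
Qed.

Let stoch_measurable t Z k : stoch t Z -> measurable_fun setT (fun w => inner (Z w) (phi k)).
Proof. by case=> mZ _; exact: measurable_inner. Qed.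

Let stoch_hnorm : exists2 C, 0 <= C & forall t Z, 0 < t <= T -> stoch t Z ->
  (\int[P]_w (hnorm (Z w) ^+ 2)%:E <= C%:E)%E.
Proof.
case/andP: (hH) => H0 H1.
(* H / 2 keeps the exponent positive when rho = 0, without reaching H. *)
pose a := Num.max (alpha * rho / s) (Hu / 2).
have ar : alpha * rho / s <= a by rewrite le_max lexx.
have aH : 0 < a < Hu.
  rewrite lt_max (_ : 0 < Hu / 2) ?orbT/=; last by rewrite divr_gt0.
  by rewrite gt_max hrhoH/= ltr_pdivrMr// ltr_pMr// ltr1n.
have [C C0 HC] := stochastic_convolution_bound phi_orth phi_complete halpha hs hH hT htheta hkappa hlam hLam hW hrho ar aH.
exists (C * S) => [|t Z tT hZ]; first exact: mulr_ge0.
apply: (fatou_bound (f := fun n w => \sum_(i < n) inner (Z w) (phi i) ^+ 2)).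
- by move=> n; apply: measurable_sum => k; apply: measurable_funX; exact: stoch_measurable hZ.
- by move=> n w; apply: sumr_ge0 => k _; exact: sqr_ge0.
- by move=> w; exact: (hcvg_lin_sq phi_orth (parseval phi_orth phi_complete (Z w))).
move=> n; apply: (le_trans (@integral_sum_bound (fun k w => inner (Z w) (phi k) ^+ 2) _ n _ _ (fun k => HC t Z k tT hZ))).
- by move=> k; apply: measurable_funX; exact: stoch_measurable hZ.
- by move=> k w; exact: sqr_ge0.
by rewrite lee_fin -mulr_sumr ler_wpM2l.
Qed.

Let tonelliP (F : measurableTypeR R * Om -> R) : measurable_fun setT F -> (forall z, 0 <= F z) ->
  (\int[P]_w \int[mu]_r (F (r, w))%:E = \int[mu]_r \int[P]_w (F (r, w))%:E)%E.
Proof.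
move=> mF F0; apply/esym; apply: (@fubini_tonelli _ _ _ _ _ mu P (fun z => (F z)%:E)).
  exact/measurable_EFinP.
by move=> z; rewrite lee_fin.
Qed.

(** Carries moment bounds at each fixed time over to time integrals; the order of integration is
    exchanged because the bounds hold in expectation only. *)
Let tonelli_weight (k : measurableTypeR R -> R) (H : measurableTypeR R * Om -> R) (K M : R) :
  measurable_fun setT k -> (forall r, 0 <= k r) -> measurable_fun setT H -> (forall z, 0 <= H z) ->
  0 <= M -> (\int[mu]_r (k r)%:E <= K%:E)%E ->
  (forall r, 0 < r <= T -> (\int[P]_w (H (r, w))%:E <= M%:E)%E) ->
  (forall r, k r != 0 -> 0 <= r <= T) ->
  (\int[P]_w \int[mu]_r (k r * H (r, w))%:E <= (K * M)%:E)%E.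
Proof.
move=> mk k0 mH H0 M0 kK HM kT.
have mkH : measurable_fun setT (fun z : measurableTypeR R * Om => k z.1 * H z).
  by apply: measurable_funM => //; apply: (measurableT_comp mk); exact: measurable_fst.
rewrite (@tonelliP (fun z => k z.1 * H z))//; last by move=> z; rewrite mulr_ge0.
apply: (@le_trans _ _ (\int[mu]_r (M%:E * (k r)%:E))%E); last first.
  rewrite ge0_integralZl_EFin//; last 2 first.
  - by move=> r _; rewrite lee_fin.
  - exact/measurable_EFinP.
  by rewrite mulrC EFinM; apply: lee_wpmul2l; rewrite ?lee_fin.
apply: ae_ge0_le_integral => //.
- by move=> r _; apply: ge0_integralr_ge0 => w; rewrite mulr_ge0.
- apply: (@measurable_fun_fubini_tonelli_F _ _ _ _ _ P (fun z => (k z.1 * H z)%:E)).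
    exact/measurable_EFinP.
  by move=> z; rewrite lee_fin mulr_ge0.
- by move=> r _; rewrite mule_ge0 ?lee_fin.
- by apply: measurable_funeM; exact/measurable_EFinP.
(* Time 0 is discarded, since the moments are bounded for positive times. *)
apply: (@ae_line_neq _ _ 0 0) => r r0 _ _ /=.
have [kr|kr] := eqVneq (k r) 0.
  by rewrite kr; under eq_integral do rewrite mul0r; rewrite integral0 mule0.
rewrite ge0_integralrZ//; last exact: measurableT_comp mH (pair1_measurable r).
rewrite [leRHS]muleC; apply: lee_wpmul2l; first by rewrite lee_fin.
by apply: HM; have /andP[r0' ->] := kT r kr; rewrite lt_neqAle eq_sym r0 r0'.
Qed.

Let measurable_fine_Y : measurable_fun setT (fun z => fine (Y z)).
Proof. exact: (measurableT_comp (@fine_measurable R setT measurableT) mY). Qed.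

Let itvT : (\int[mu]_r (\1_(`[0%R, T]%classic) r)%:E <= T%:E)%E.
Proof.
apply: (@le_trans _ _ (mu (`[0%R, T]%classic : set (measurableTypeR R)))).
  by rewrite integral_indic// setIT.
by rewrite lebesgue_measure_itv/= lte_fin hT -EFinB subr0.
Qed.

Let measurable_integral_r (F : measurableTypeR R * Om -> R) : measurable_fun setT F -> (forall z, 0 <= F z) ->
  measurable_fun setT (fun w => \int[mu]_r (F (r, w))%:E)%E.
Proof.
move=> mF F0; apply: (@measurable_fun_fubini_tonelli_G _ _ _ _ _ mu (fun z => (F z)%:E)).
  exact/measurable_EFinP.
by move=> z; rewrite lee_fin.
Qed.

(* No second moment of the solution is known beforehand, so Gronwall's inequality
   is applied pathwise, with the jointly measurable remainder
   [h = max (0, G - C2 Y)]; expectations are taken afterwards. *)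
Let G_moment : exists2 C, 0 <= C & forall t, 0 < t <= T -> (\int[P]_w (G (t, w) ^+ 2)%:E <= C%:E)%E.
Proof.
have [C1 C10 HC1] := mild_norm_bound; have [CZ CZ0 HZ] := stoch_hnorm.
pose C2 := Cf * C1; have C20 : 0 < C2 by exact: mulr_gt0.
pose h z := Num.max 0 (G z - C2 * fine (Y z)).
have h0 z : 0 <= h z by rewrite /h le_max lexx.
have mh : measurable_fun setT h.
  apply: (measurable_maxr (measurable_cst _)); apply: measurable_funB => //.
  by apply: measurable_funM; [exact: measurable_cst|exact: measurable_fine_Y].
pose zz (Z : Om -> L2 D) w := Cf * (1 + hnorm (Z w)).
have ptw t : 0 < t <= T -> exists2 Z, stoch t Z & {ae P, forall w, G (t, w) <= zz Z w + C2 * fine (Y (t, w))}.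
  move=> tT; have [Z hZ aeZ] := HC1 t tT; exists Z => //; case/andP: (tT) => t0 tT'.
  have := ae_good; apply: filterS2 aeZ => w nu gw.
  rewrite GE ?(ltW t0)//; apply: (le_trans (f_growth _)).
  have : hnorm (u t w) <= hnorm (Z w) + C1 * fine (Y (t, w)).
    by rewrite -lee_fin EFinD (EFinM C1) (fineK (Yfin tT' gw)).
  by move=> hn; rewrite /zz /C2 -mulrA -mulrDr ler_wpM2l ?(ltW Cf0)// -addrA lerD2l.
pose K := 2 * Cf ^+ 2 * (1 + CZ).
have K0 : 0 <= K by rewrite mulr_ge0 ?addr_ge0// mulr_ge0// sqr_ge0.
have mzz t Z : stoch t Z -> measurable_fun setT (zz Z).
  move=> [mZ _]; apply: measurable_funM => //; apply: measurable_funD => //.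
  exact: (measurable_hnorm phi_orth phi_complete).
have zz2 t Z : 0 < t <= T -> stoch t Z -> (\int[P]_w (zz Z w ^+ 2)%:E <= K%:E)%E.
  move=> tT hZ; apply: (@le_trans _ _ ((2 * Cf ^+ 2)%:E * \int[P]_w (cst 1 w)%:E +
      (2 * Cf ^+ 2)%:E * \int[P]_w (hnorm (Z w) ^+ 2)%:E)%E).
    have c0 : 0 <= 2 * Cf ^+ 2 by rewrite mulr_ge0// sqr_ge0.
    apply: ge0_integralr_le_lin => //.
    - by apply: measurable_funX; exact: mzz hZ.
    - by move=> w; exact: sqr_ge0.
    - by apply: measurable_funX; apply: (measurable_hnorm phi_orth phi_complete) => //; case: hZ.
    - by move=> w; exact: sqr_ge0.
    move=> w; rewrite /zz /= -subr_ge0.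
    have -> : 2 * Cf ^+ 2 * 1 + 2 * Cf ^+ 2 * hnorm (Z w) ^+ 2 - (Cf * (1 + hnorm (Z w))) ^+ 2 =
      (Cf * (1 - hnorm (Z w))) ^+ 2 by ring.
    exact: sqr_ge0.
  have one : (\int[P]_w (cst 1 w)%:E = 1%:E)%E.
    transitivity (1%:E * P setT)%E; last by rewrite probability_setT mule1.
    exact: (integral_cst P measurableT 1%:E).
  rewrite one mule1 /K mulrDr mulr1 EFinD; apply: leeD => //.
  rewrite (EFinM (2 * Cf ^+ 2)); apply: lee_wpmul2l; last exact: HZ hZ.
  by rewrite lee_fin mulr_ge0// sqr_ge0.
have mht t : measurable_fun setT (fun w => h (t, w)) by exact: measurableT_comp mh (pair1_measurable t).
have mhw w : measurable_fun setT (fun r : measurableTypeR R => h (r, w)) by exact: measurableT_comp mh (pair2_measurable w).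
(* [Z] is obtained for each t separately, with an exceptional null set depending on t. This is
   harmless for an expectation at fixed t, and [h] carries the bound over to a jointly measurable
   function. *)
have h2 t : 0 < t <= T -> (\int[P]_w (h (t, w) ^+ 2)%:E <= K%:E)%E.
  move=> tT; have [Z hZ aeG] := ptw t tT; apply: le_trans (zz2 t Z tT hZ).
  apply: ae_ge0_le_integralr.
  - exact: measurable_funX.
  - by move=> w; exact: sqr_ge0.
  - by apply: measurable_funX; exact: mzz hZ.
  - by move=> w; exact: sqr_ge0.
  have zz0 w : 0 <= zz Z w by rewrite mulr_ge0 ?(ltW Cf0)// addr_ge0 ?hnorm_ge0.
  by apply: filterS aeG => w Gw; rewrite lerXn2r ?nnegrE// ge_max zz0/= lerBlDr.
pose IT : measurableTypeR R -> R := \1_(`[0, T]%classic).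
have mIT : measurable_fun setT IT by exact: measurable_indic.
have IT0 r : 0 <= IT r by rewrite /IT indicE.
pose Q w := (\int[mu]_r (IT r * h (r, w) ^+ 2)%:E)%E.
have mh2 : measurable_fun setT (fun z => h z ^+ 2) by exact: measurable_funX.
have QK : (\int[P]_w Q w <= (T * K)%:E)%E.
  apply: (@tonelli_weight IT (fun z => h z ^+ 2)) => //.
  - by move=> z; exact: sqr_ge0.
  - by move=> r; rewrite /IT indicE; case: (boolP (r \in _)); rewrite ?eqxx// inE/= in_itv.
have mQ : measurable_fun setT Q.
  apply: (@measurable_integral_r (fun z => IT z.1 * h z ^+ 2)).
    by apply: measurable_funM => //; apply: (measurableT_comp mIT); exact: measurable_fst.
  by move=> z; rewrite mulr_ge0// sqr_ge0.
have Q0 w : (0 <= Q w)%E by apply: ge0_integralr_ge0 => r; rewrite mulr_ge0// sqr_ge0.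
pose yT w := fine (Y (T, w)).
have myT : measurable_fun setT yT by exact: measurableT_comp measurable_fine_Y (pair1_measurable T).
pose c3 := 2 * expR (2 * C2 * T); have c30 : 0 < c3 by rewrite mulr_gt0// expR_gt0.
have yQ w : good w -> ((yT w ^+ 2)%:E <= (c3 ^+ 2 * T)%:E * Q w)%E.
  move=> gw; have Tin : 0 <= T <= T by rewrite lexx ltW.
  have := @gronwall R T C2 (fun r => G (r, w)) (fun r => h (r, w)) hT C20 (mGw w) (mhw w) (fun r => G0 _) (fun r => h0 _) gw.
  rewrite -YE// -/c3 => gron.
  have {}gron : ((yT w)%:E <= c3%:E * \int[mu]_r (IT r * h (r, w))%:E)%E.
    rewrite /yT fineK ?Yfin//; rewrite integral_indicM; apply: gron => t tT.
    rewrite -YE//; case/andP: (tT) => t0 tT'.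
    rewrite -[Y _]fineK ?Yfin// -EFinM -EFinD lee_fin -lerBlDr /h le_max lexx orbT//.
  (* Gronwall bounds [yT / c3] by the integral of [h] over [0, T]; Cauchy-Schwarz on an interval of
     length T then bounds its square by T times the integral of h^2. *)
  have y0 : 0 <= yT w / c3 by rewrite divr_ge0 ?(ltW c30)// fine_ge0.
  have yI : ((yT w / c3)%:E <= \int[mu]_r (IT r * h (r, w))%:E)%E.
    move: gron; have := @ge0_integralr_ge0 _ _ _ mu (fun r => IT r * h (r, w)) (fun r => mulr_ge0 (IT0 r) (h0 _)).
    case: (\int[mu]_r (IT r * h (r, w))%:E)%E => [I| |] //; last by move=> _ _; exact: leey.
    by move=> _; rewrite -EFinM !lee_fin ler_pdivrMr// mulrC.
  have := @weighted_cauchy_schwarz _ _ _ mu IT (fun r => h (r, w)) _ T mIT IT0 (mhw w) (fun r => h0 _) y0 hT itvT yI.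
  have -> : yT w ^+ 2 = c3 ^+ 2 * (yT w / c3) ^+ 2 by field; rewrite gt_eqF.
  move=> cs; rewrite (EFinM (c3 ^+ 2)) (EFinM (c3 ^+ 2)) -muleA; apply: lee_wpmul2l => //.
  by rewrite lee_fin sqr_ge0.
pose K2 := c3 ^+ 2 * T * (T * K).
have c3T : 0 <= c3 ^+ 2 * T by rewrite mulr_ge0 ?sqr_ge0 ?(ltW hT).
have K20 : 0 <= K2 by rewrite mulr_ge0// mulr_ge0 ?(ltW hT).
have yT2 : (\int[P]_w (yT w ^+ 2)%:E <= K2%:E)%E.
  apply: (@le_trans _ _ (\int[P]_w ((c3 ^+ 2 * T)%:E * Q w))%E).
    apply: ae_ge0_le_integral => //.
    - by move=> w _; rewrite lee_fin sqr_ge0.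
    - by apply/measurable_EFinP; exact: measurable_funX.
    - by move=> w _; rewrite mule_ge0// lee_fin.
    - exact: measurable_funeM.
    by have := ae_good; apply: filterS => w gw _; exact: yQ.
  by rewrite ge0_integralZl// /K2 (EFinM (c3 ^+ 2 * T)); apply: lee_wpmul2l; rewrite ?lee_fin.
exists (2 * K + 2 * C2 ^+ 2 * K2).
  by apply: addr_ge0; apply: mulr_ge0 => //; apply: mulr_ge0 => //; exact: sqr_ge0.
move=> t tT; have [Z hZ aeG] := ptw t tT; case/andP: (tT) => t0 tT'.
apply: (@le_trans _ _ (2%:E * \int[P]_w (zz Z w ^+ 2)%:E + (2 * C2 ^+ 2)%:E * \int[P]_w (yT w ^+ 2)%:E)%E).
  apply: ae_ge0_integralr_le_lin => //.
  - exact: measurable_funX.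
  - by move=> w; exact: sqr_ge0.
  - by apply: measurable_funX; exact: mzz hZ.
  - by move=> w; exact: sqr_ge0.
  - exact: measurable_funX.
  - by move=> w; exact: sqr_ge0.
  - by rewrite mulr_ge0// sqr_ge0.
  have := ae_good; apply: filterS2 aeG => w Gw gw.
  (* [Y] grows with time, so its moment at [T] serves for all earlier times. *)
  have YT : fine (Y (t, w)) <= yT w.
    apply: fine_le; [exact: Yfin|exact: Yfin|]; apply: ge0_le_integralr.
    - apply: measurable_funM => //; apply: (measurableT_comp mV); exact: measurable_funB.
    - by move=> r; rewrite mulr_ge0.
    - apply: measurable_funM => //; apply: (measurableT_comp mV); exact: measurable_funB.
    move=> r /=; rewrite ler_wpM2r// /V !indicE ler_nat.
    case: (boolP (t - r \in _)) => // ; rewrite inE/= in_itv/= andbT => tr.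
    by rewrite mem_set//= in_itv/= andbT; apply: le_trans tr _; rewrite lerD2r.
  have Gle : G (t, w) <= zz Z w + C2 * yT w.
    by apply: (le_trans Gw); rewrite lerD2l ler_wpM2l ?(ltW C20).
  apply: (@le_trans _ _ ((zz Z w + C2 * yT w) ^+ 2)).
    by rewrite lerXn2r ?nnegrE ?(le_trans (G0 _) Gle).
  have := sqr_ge0 (zz Z w - C2 * yT w); rewrite -subr_ge0 => hsq.
  rewrite -subr_ge0; have -> : 2 * zz Z w ^+ 2 + 2 * C2 ^+ 2 * yT w ^+ 2 - (zz Z w + C2 * yT w) ^+ 2 = (zz Z w - C2 * yT w) ^+ 2 by ring.
  exact: sqr_ge0.
rewrite (EFinD (2 * K)) (EFinM 2 K) (EFinM (2 * C2 ^+ 2) K2); apply: leeD; apply: lee_wpmul2l => //.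
  exact: zz2 hZ.
by rewrite lee_fin mulr_ge0// sqr_ge0.
Qed.

(** Drift and noise share the exponent a but use different decay: lam_k^(-sigma) compensates the
    weight in the drift, lam_k^(-sigma - rho) leaves the summable factor lam_k^(-2 rho) Lam_k in the
    noise. The series is estimated as an extended real, so no domain of A^sigma enters yet. *)
Lemma mild_coord_moment (sigma : R) : 0 <= sigma -> sigma + rho <= s -> alpha * (sigma + rho) / s < Hu ->
  exists2 C : R, 0 < C & forall t, 0 < t <= T ->
    (forall k, measurable_fun setT (fun w => inner (u t w) (phi k))) /\
    (\int[P]_w (\sum_(k <oo) ((lam k `^ sigma * inner (u t w) (phi k)) ^+ 2)%:E) <= C%:E)%E.
Proof.
case/andP: (hH) => H0 H1; case/andP: (hrho) => rho0 _; case/andP: (halpha) => al0 _.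
move=> sg0 sgs abH; pose beta := sigma + rho.
pose a := Num.max (alpha * beta / s) (Hu / 2).
have ab : alpha * beta / s <= a by rewrite le_max lexx.
have aH : 0 < a < Hu.
  rewrite lt_max (_ : 0 < Hu / 2) ?orbT/=; last by rewrite divr_gt0.
  by rewrite gt_max abH/= ltr_pdivrMr// ltr_pMr// ltr1n.
case/andP: (aH) => a0 aH'; have a1 : a < 1 by exact: lt_trans H1.
have hb : 0 <= beta <= s by rewrite addr_ge0.
have hsg : 0 <= sigma <= s by rewrite sg0 (le_trans _ sgs)// lerDl.
have asg : alpha * sigma / s <= a.
  apply: le_trans ab; rewrite ler_wpM2r ?invr_ge0 ?(ltW s0)// ler_wpM2l ?(ltW al0)//.
  by rewrite lerDl.
have [C C0 HC] := stochastic_convolution_bound phi_orth phi_complete halpha hs hH hT htheta hkappa hlam hLam hW hb ab aH.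
have [C3 C30 [HE _]] := Ek_bound halpha hs hT htheta hkappa hlam hsg asg (introT andP (conj a0 a1)).
have [CG CG0 HG] := G_moment.
pose kap (r : measurableTypeR R) : R := C3 * r `^ (- a).
have kap0 r : 0 <= kap r by rewrite mulr_ge0 ?powR_ge0.
have mkap : measurable_fun setT kap by apply: measurable_funM => //; exact: measurable_powR.
have lam_cancel k : lam k `^ sigma * lam k `^ (- sigma) = 1.
  by rewrite powRN divff// gt_eqF// powR_gt0.
pose e1 := - a + 1; have e10 : 0 < e1 by rewrite /e1; lra.
(* C3 may be 0; the added 1 gives the positive total mass required by [weighted_cauchy_schwarz]. *)
pose K3 := C3 * (T `^ e1 / e1) + 1.
have K30 : 0 < K3 by rewrite ltr_wpDl// mulr_ge0// divr_ge0 ?powR_ge0 ?ltW.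
pose M := 2 * K3 * (K3 * CG) + 2 * (C * S) + 1.
have M0 : 0 < M by rewrite ltr_wpDl// addr_ge0// !mulr_ge0 ?(ltW K30).
exists M => // t tT; case/andP: (tT) => t0 tT'.
have tT0 : 0 <= t <= T by rewrite ltW.
have mcoord k : measurable_fun setT (fun w => inner (u t w) (phi k)).
  by apply: measurable_inner => //; exact: mut.
split => //.
have mterm k : measurable_fun setT (fun w => (lam k `^ sigma * inner (u t w) (phi k)) ^+ 2).
  by apply: measurable_funX; exact: measurable_funM.
apply: integral_series_bound => // [k w|n]; first exact: sqr_ge0.
have [Z hZ aeZ] := mild_eq hu tT0.
pose k (r : measurableTypeR R) : R := \1_(`]0, t[%classic) r * kap (t - r).
have mk : measurable_fun setT k.
  apply: measurable_funM; first exact: measurable_indic.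
  by apply: (measurableT_comp mkap); exact: measurable_funB.
have k0 r : 0 <= k r by rewrite mulr_ge0// indicE.
have kK : (\int[mu]_r (k r)%:E <= K3%:E)%E.
  apply: (@le_trans _ _ (\int[mu]_r (C3 * (\1_(`[0%R, t[%classic) r * (t - r)%R `^ (- a)))%:E)%E).
    have m1 : measurable_fun setT (fun r : measurableTypeR R => \1_(`[0%R, t[%classic) r * (t - r) `^ (- a)).
      apply: measurable_funM; first exact: measurable_indic.
      by apply: (measurableT_comp (measurable_powR _)); exact: measurable_funB.
    apply: ge0_le_integralr => //; first exact: measurable_funM.
    move=> r; rewrite /k /kap mulrCA ler_wpM2l// ler_wpM2r ?powR_ge0// !indicE ler_nat.
    case: (boolP (r \in _)) => //; rewrite inE/= in_itv/= => /andP[r0 rt].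
    by rewrite mem_set//= in_itv/= rt (ltW r0).
  rewrite ge0_integralrZ//; last 2 first.
  - apply: measurable_funM; first exact: measurable_indic.
    by apply: (measurableT_comp (measurable_powR _)); exact: measurable_funB.
  - by move=> r; rewrite mulr_ge0 ?powR_ge0// indicE.
  rewrite (integral_indicM _ (fun r => (t - r) `^ (- a))) integral_powr ?(ltW t0)//; last by lra.
  rewrite -EFinM lee_fin subr0 -/e1; apply: (@le_trans _ _ (C3 * (T `^ e1 / e1))); last by rewrite /K3 lerDl.
  rewrite ler_wpM2l// ler_wpM2r ?invr_ge0 ?(ltW e10)//.
  by apply: ge0_powR_le => //; exact: ltW.
pose Q w := (\int[mu]_r (k r * G (r, w) ^+ 2)%:E)%E.
have mG2 : measurable_fun setT (fun z => G z ^+ 2) by exact: measurable_funX.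
have Q0 w : (0 <= Q w)%E by apply: ge0_integralr_ge0 => r; rewrite mulr_ge0// sqr_ge0.
have mQ : measurable_fun setT Q.
  apply: (@measurable_integral_r (fun z => k z.1 * G z ^+ 2)).
    by apply: measurable_funM => //; apply: (measurableT_comp mk); exact: measurable_fst.
  by move=> z; rewrite mulr_ge0// sqr_ge0.
have QK : (\int[P]_w Q w <= (K3 * CG)%:E)%E.
  apply: (@tonelli_weight k (fun z => G z ^+ 2)) => //.
  - by move=> z; exact: sqr_ge0.
  - move=> r; rewrite /k indicE; case: (boolP (r \in _)); rewrite ?mul0r ?eqxx//.
    by rewrite inE/= in_itv/= => /andP[r0 rt] _; rewrite (ltW r0) (le_trans (ltW rt)).
pose z (i : nat) w := (lam i `^ sigma * inner (Z w) (phi i)) ^+ 2.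
have mz i : measurable_fun setT (z i).
  by apply: measurable_funX; apply: measurable_funM => //; exact: stoch_measurable hZ.
have z0 i w : 0 <= z i w by exact: sqr_ge0.
have zK : (\int[P]_w (\sum_(i < n) z i w)%:E <= (C * S)%:E)%E.
  apply: (le_trans (@integral_sum_bound z (fun i => C * (Lam i * (lam i `^ (- rho)) ^+ 2)) n mz z0 _)).
    move=> i; rewrite /z; under eq_integral do rewrite exprMn.
    rewrite ge0_integralrZ ?sqr_ge0//; last 2 first.
    - by apply: measurable_funX; exact: stoch_measurable hZ.
    - by move=> w; exact: sqr_ge0.
    apply: (le_trans (lee_wpmul2l _ (HC t Z i tT hZ))); first by rewrite lee_fin sqr_ge0.
    rewrite -EFinM lee_fin le_eqVlt; apply/orP; left; apply/eqP.
    (* The weight lam^sigma uses up the sigma part of beta = sigma + rho. *)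
    have -> : lam i `^ (- rho) = lam i `^ sigma * lam i `^ (- beta).
      by rewrite /beta opprD powRD_gt0// mulrA lam_cancel mul1r.
    by rewrite exprMn; ring.
  by rewrite lee_fin -mulr_sumr ler_wpM2l.
have zs0 w : 0 <= \sum_(i < n) z i w by apply: sumr_ge0.
have mzs : measurable_fun setT (fun w => \sum_(i < n) z i w) by apply: measurable_sum.
apply: (@le_trans _ _ (\int[P]_w ((2 * K3)%:E * Q w + 2%:E * (\sum_(i < n) z i w)%:E))%E).
  apply: ae_ge0_le_integral => //.
  - by move=> w _; rewrite lee_fin; apply: sumr_ge0 => i _; exact: sqr_ge0.
  - by apply/measurable_EFinP; apply: measurable_sum.
  - move=> w _; apply: adde_ge0; apply: mule_ge0 => //.
      by rewrite lee_fin mulr_ge0 ?(ltW K30).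
    by rewrite lee_fin.
  - by apply: emeasurable_funD; apply: measurable_funeM => //; exact/measurable_EFinP.
  apply: filterS aeZ => w [v bv uv] _.
  have yI := @bochner_bound (fun i => lam i `^ sigma) kap t w v n tT bv mkap (fun r _ => kap0 r) _.
  have {}yI : ((Num.sqrt (\sum_(i < n) (lam i `^ sigma * inner v (phi i)) ^+ 2))%:E <=
      \int[mu]_r (k r * G (r, w))%:E)%E.
    apply: yI => i r hr; rewrite ger0_norm ?powR_ge0//.
    apply: (le_trans (ler_wpM2l (powR_ge0 _ _) (HE i r hr))).
    have -> : lam i `^ sigma * (C3 * lam i `^ (- sigma) * r `^ (- a)) =
      (lam i `^ sigma * lam i `^ (- sigma)) * (C3 * r `^ (- a)) by ring.
    by rewrite lam_cancel mul1r.
  (* The squared drift is at most K3 times the integral of k(r) |f(u(r))|^2: the singular kernel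
     enters to the first power only, so a < 1 suffices and [G_moment] bounds the expectation. *)
  have := weighted_cauchy_schwarz mk k0 (mGw w) (fun r => G0 _) (sqrtr_ge0 _) K30 kK yI.
  rewrite sqr_sqrtr; last by apply: sumr_ge0 => i _; exact: sqr_ge0.
  rewrite -/(Q w) => hQ.
  apply: (@le_trans _ _ (2%:E * (\sum_(i < n) (lam i `^ sigma * inner v (phi i)) ^+ 2)%:E +
       2%:E * (\sum_(i < n) z i w)%:E)%E).
    rewrite -!EFinM -EFinD lee_fin !mulr_sumr -big_split/=; apply: ler_sum => i _.
    have -> : inner (u t w) (phi i) = inner v (phi i) + inner (Z w) (phi i).
      by have := hnorm_eq0_inner (phi i) uv; rewrite innerBl innerDl => /eqP; rewrite subr_eq0 => /eqP.
    rewrite /z mulrDr; set p := lam i `^ sigma * inner v _; set q := lam i `^ sigma * inner (Z w) _.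
    rewrite -subr_ge0; have -> : 2 * p ^+ 2 + 2 * q ^+ 2 - (p + q) ^+ 2 = (p - q) ^+ 2 by ring.
    exact: sqr_ge0.
  by apply: leeD => //; rewrite (EFinM 2 K3) -muleA; apply: lee_wpmul2l.
rewrite ge0_integralD//; last 4 first.
- by move=> w _; rewrite mule_ge0// lee_fin mulr_ge0// ltW.
- exact: measurable_funeM.
- by move=> w _; apply: mule_ge0 => //; rewrite lee_fin.
- by apply: measurable_funeM; exact/measurable_EFinP.
rewrite ge0_integralZl//; last by rewrite lee_fin mulr_ge0// ltW.
rewrite ge0_integralZl_EFin//; last 2 first.
- by move=> w _; rewrite lee_fin.
- exact/measurable_EFinP.
apply: (@le_trans _ _ ((2 * K3)%:E * (K3 * CG)%:E + 2%:E * (C * S)%:E)%E); last first.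
  by rewrite -!EFinM -EFinD lee_fin /M lerDl.
by apply: leeD; apply: lee_wpmul2l => //; rewrite lee_fin mulr_ge0// ltW.
Qed.

End mild_moment.

(** * Domain and norm of A^sigma u(t) *)

Section apow_moment.
Context (R : realType) (d : nat) (D : convex_polygonal_domain R d) (phi : nat -> L2 D).
Hypothesis phi_orth : forall j k, inner (phi j) (phi k) = (j == k)%:R.

(* If the series diverges, both sides of the equality are the junk value 0. *)
Lemma diag_op_sq_series (m : nat -> R) (v : L2 D) (L := (\sum_(k <oo) ((m k * inner v (phi k)) ^+ 2)%:E)%E) :
  ((L < +oo)%E -> diag_dom phi m v) /\ hnorm (diag_op phi m v) ^+ 2 = fine L.
Proof.
pose a k := m k * inner v (phi k).
have L0 : (0 <= L)%E by apply: nneseries_ge0 => k _ _; rewrite lee_fin sqr_ge0.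
have partial n : ((\sum_(k < n) a k ^+ 2)%:E <= L)%E.
  apply: (@le_trans _ _ (\sum_(0 <= k < n) (a k ^+ 2)%:E)%E); first by rewrite big_mkord sumEFin.
  by apply: nneseries_lim_ge => k _ _; rewrite lee_fin sqr_ge0.
have domP : (L < +oo)%E -> diag_dom phi m v.
  move=> Loo; have Lfin : L \is a fin_num by rewrite ge0_fin_numE.
  apply: (diag_dom_le phi_orth (M := fine L)) => n.
  by rewrite -lee_fin fineK.
split => //.
have [dom|ndom] := pselect (diag_dom phi m v).
  have sq := hcvg_lin_sq phi_orth (diag_opP dom).
  have : (fun n => (\sum_(k < n) a k ^+ 2)%:E) @ \oo --> (hnorm (diag_op phi m v) ^+ 2)%:E.
    by apply: cvg_EFin; [exact: nearW|exact: sq].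
  have : (fun n => (\sum_(k < n) a k ^+ 2)%:E) @ \oo --> L.
    rewrite (_ : (fun n => _) = (fun n => \sum_(0 <= k < n) (a k ^+ 2)%:E)%E); last first.
      by apply/funext => n; rewrite big_mkord sumEFin.
    by apply: is_cvg_nneseries => k _ _; rewrite lee_fin sqr_ge0.
  by move=> /cvg_unique c1 /c1 ->.
have -> : L = +oo%E by apply/eqP; rewrite -leye_eq leNgt; apply/negP => /domP.
rewrite /diag_op xgetPN ?hnorm0 ?expr0n// => w /= hw; apply: ndom; by exists w.
Qed.

End apow_moment.

Theorem theorem1 (R : realType) (d : nat) (hd : (0 < d <= 3)%N)
  (D : convex_polygonal_domain R d)
  (lam : nat -> R) (phi : nat -> L2 D) (hA : dirichlet_eigensystem lam phi)
  (f : L2 D -> L2 D)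
  (hf : exists C : R, 0 < C /\
    (forall u, hnorm (f u) <= C * (1 + hnorm u)) /\
    (forall u v, hnorm (f u - f v) <= C * hnorm (u - v)))
  (dO : measure_display) (Om : measurableType dO) (P : probability Om R)
  (F : R -> set (set Om)) (hF : complete_filtration P F)
  (alpha s Hu T eps theta kappa : R)
  (halpha : 0 < alpha < 1) (hs : 0 < s < 1) (hH : 0 < Hu < 1) (hT : 0 < T)
  (heps : 0 < eps) (htheta : pi / 2 < theta < pi) (hkappa : 0 < kappa)
  (Lam : nat -> R) (hLam : forall k, 0 <= Lam k)
  (W : nat -> R -> {RV P >-> R})
  (hW : forall k, fBm Hu (W k)) (hWF : forall k, adapted F (W k))
  (u : R -> Om -> L2 D)
  (hu : mild_solution alpha s theta kappa Hu T lam phi Lam W f u)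
  (rho : R) (hrho : 0 <= rho < Num.min (s * Hu / alpha) (s + eps))
  (hQ : (hs_norm2 phi (fun v => Apow lam phi (- rho)
           (diag_op phi (fun k => Num.sqrt (Lam k)) v)) < +oo)%E)
  (sigma : R)
  (hsigma : 0 <= sigma <= Num.min (s - rho) (s * Hu / alpha - rho - eps)) :
  exists C : R, 0 < C /\ forall t, 0 < t <= T ->
    {ae P, forall w, Apow_dom lam phi sigma (u t w)} /\
    ('E_P[(fun w => (hnorm (Apow lam phi sigma (u t w))) ^+ 2)%R] <= C%:E)%E.
Proof.
have [Cf [Cf0 [fg fl]]] := hf.
have phi_orth := eigen_orthonormal hA; have phi_complete := eigen_complete hA.
have hlam := eigen_gt0 hA.
have [S S0 hS] := hs_norm2_bound phi_orth hLam hQ.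
case/andP: hrho => rho0; rewrite lt_min => /andP[rhoH _].
case/andP: hsigma => sg0; rewrite le_min => /andP[sgs sgH].
case/andP: (halpha) => al0 al1; case/andP: (hs) => s0 s1.
(* The hypothesis on rho alone gives only rho < s + epsilon; rho <= s follows from 0 <= sigma <= s -
   rho. *)
have hrho' : 0 <= rho <= s by rewrite rho0; lra.
have scale x : x < s * Hu / alpha -> alpha * x / s < Hu.
  by rewrite ltr_pdivlMr// => hx; rewrite ltr_pdivrMr// mulrC [Hu * s]mulrC.
have sgs' : sigma + rho <= s by lra.
(* Here epsilon is spent: sigma + rho <= s H / alpha - epsilon makes the inequality strict. *)
have sgH' : alpha * (sigma + rho) / s < Hu by apply: scale; lra.
have [C C0 HC] := mild_coord_moment phi_orth phi_complete halpha hs hH hT htheta hkappa hlam hLam hW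
  Cf0 fg fl hu hrho' (scale _ rhoH) S0 hS sg0 sgs' sgH'.
exists C; split=> // t /HC[mc EC].
pose L w := (\sum_(k <oo) ((lam k `^ sigma * inner (u t w) (phi k)) ^+ 2)%:E)%E.
have mL : measurable_fun setT L.
  apply: ge0_emeasurable_sum => [k w _ _|k _]; first by rewrite lee_fin sqr_ge0.
  by apply/measurable_EFinP; apply: measurable_funX; exact: measurable_funM.
have L0 w : (0 <= L w)%E by apply: nneseries_ge0 => k _ _; rewrite lee_fin sqr_ge0.
split.
  (* An integrable series is finite almost surely, and its finiteness places u(t) in the domain of
     A^sigma. *)
  have iL : P.-integrable setT L.
    apply/integrableP; split => //; apply: le_lt_trans (ltry C).
    by under eq_integral do rewrite gee0_abs//.
  have := integrable_ae measurableT iL; apply: filterS => w /(_ I) Lw.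
  by apply: (diag_op_sq_series phi_orth (fun k => lam k `^ sigma) (u t w)).1; rewrite -ge0_fin_numE; [exact: Lw|exact: L0].
have AE w : hnorm (Apow lam phi sigma (u t w)) ^+ 2 = fine (L w).
  exact: (diag_op_sq_series phi_orth (fun k => lam k `^ sigma) (u t w)).2.
rewrite unlock; apply: le_trans EC; apply: ge0_le_integral => //.
- by move=> w _; rewrite lee_fin sqr_ge0.
- apply/measurable_EFinP; rewrite (_ : (fun w => _) = fun w => fine (L w)); last by apply/funext => w; rewrite AE.
  exact: (measurableT_comp (@fine_measurable R setT measurableT) mL).
move=> w _; rewrite AE.
(* Where [L w] is infinite, the squared norm is the default value 0, so the inequality holds for
   every [w]. *)
change ((fine (L w))%:E <= L w)%E.
by case: (L w) (L0 w) => [r| |] // _; exact: leey.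
Qed.
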